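(* Let $\mu_t^y(dx)=\Pr\{\sigma^{f,y}(t)\in dx\}$ be the law on $[0,\infty)$ of the subordinator $\sigma^{f,y}$ with Laplace exponent $f(\cdot,y)$ at time $t$ ($t\ge 0$ fixed), and suppose that $\mu_t^y\in\mathrm{ME}$ for all $y\in E$. Then the corresponding distributed order subordinator $\sigma^{f,p}$ is such that $\mu_t^p(dx)=\Pr\{\sigma^{f,p}(t)\in dx\}$ satisfies $\mu_t^p\in\mathrm{ME}$.
   Context: Setting. $E$ is a Polish space, $W\subseteq E$ is Borel, $p$ is a probability measure on $W$, $Y$ is a random variable with law $p$, and $\mathbb{E}g(Y)=\int_W g(y)\,p(dy)$. For each $y\in E$, $$f(\lambda,y)=a(y)+b(y)\lambda+\int_0^\infty(1-e^{-\lambda s})\,\nu(ds,y),\qquad \lambda>0,$$ is a Bernstein function, where $a(y),b(y)\ge 0$ and $\nu(ds,y)$ is a non-negative $\sigma$-finite measure on $(0,\infty)$ (depending measurably on $y$) with $V(y):=\int_0^\infty (s\wedge 1)\,\nu(ds,y)<\infty$. Standing assumptions. A1) the functions $a,b$ are Borel measurable and either bounded, or such that $\int_W a(y)p(dy)<\infty$ and $\int_W b(y)p(dy)<\infty$. A2) either $V$ is bounded, or $\int_W V(y)p(dy)<\infty$. Under these, $\mathbb{E}f(\lambda,Y)=\mathbb{E}a(Y)+\mathbb{E}b(Y)\lambda+\int_0^\infty(1-e^{-\lambda s})\int_W\nu(ds,y)p(dy)$ is a Bernstein function. Subordinators. $\sigma^{f,y}$ is the (possibly killed, i.e. sent to $\infty$)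 subordinator with $\mathbb{E}e^{-\lambda\sigma^{f,y}(t)}=e^{-tf(\lambda,y)}$. The distributed order subordinator is $\sigma^{f,p}(t)=t\int_W b(y)p(dy)+\sum_{0\le s\le t}\mathbf{e}(s)$, where $\mathbf{e}$ is a Poisson point process with characteristic measure $\int_W(\nu(dx,y)+a(y)\delta_\infty(dx))p(dy)$; equivalently it is the subordinator with $\mathbb{E}e^{-\lambda\sigma^{f,p}(t)}=e^{-t\,\mathbb{E}f(\lambda,Y)}$. Mixtures of exponential distributions. A measure $\mu$ on $[0,\infty)$ belongs to $\mathrm{ME}$ if there is a sub-probability measure $\rho$ on $(0,\infty]$ such that $\mu[0,t]=\int_{(0,\infty]}(1-e^{-t\alpha})\,\rho(d\alpha)$ (the value $\alpha=\infty$ contributes an atom of mass $\rho(\{\infty\})$ at $0$). Equivalently, the Laplace transform of $\mu$ is a Stieltjes function with value at $0+$ at most $1$, where a Stieltjes function is a function of the form $h(\lambda)=\frac{a}{\lambda}+b+\int_0^\infty\frac{1}{\lambda+t}\,w(dt)$ with $a,b\ge0$ and $w$ a measure on $(0,\infty)$ with $\int_0^\infty\frac{1}{1+t}w(dt)<\infty$. *)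

(* Defs.v *)
From HB Require Import structures.
From mathcomp Require Import all_boot all_order all_algebra.
From mathcomp Require Import all_classical all_reals all_analysis.
From mathcomp Require Import measurable_realfun.

Set Implicit Arguments.
Unset Strict Implicit.
Unset Printing Implicit Defensive.

Import Order.TTheory GRing.Theory Num.Theory.
Import numFieldNormedType.Exports.

Local Open Scope classical_set_scope.
Local Open Scope ring_scope.

Definition borel (E : ptopologicalType) := g_sigma_algebraType (@open E).

Definition polish (R : realType) (E : topologicalType) : Prop :=
  (exists2 D : set E, countable D & dense D) /\
  exists d : E -> E -> R,
    [/\ (forall x y, 0 <= d x y) /\ (forall x y, d x y = 0 <-> x = y),
        (forall x y, d x y = d y x),
        (forall x y z, d x z <= d x y + d y z),
        (forall x (A : set E),
            nbhs x A <-> exists2 r, 0 < r & [set y | d x y < r] `<=` A) &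
        (forall u : nat -> E,
            (forall r, 0 < r -> exists N, forall m n,
               (N <= m)%N -> (N <= n)%N -> d (u m) (u n) < r) ->
            exists l : E, u @ \oo --> l)].

(* A measure on (0,oo) is represented by a measure on R charging no
   nonpositive number. *)
Definition bernstein_fun (R : realType) (a b : R)
    (nu : {measure set R -> \bar R}) (lambda : R) : \bar R :=
  (a%:E + b%:E * lambda%:E +
   \int[nu]_(s in `]0%R, +oo[) (1 - expR (- (lambda * s)))%:E)%E.

Definition levy_mass (R : realType) (nu : {measure set R -> \bar R}) : \bar R :=
  (\int[nu]_(s in `]0%R, +oo[) (Num.min s 1)%:E)%E.

Definition past (R : realType) d (Omega : measurableType d)
    (sigma : R -> Omega -> \bar R) (t : R) : set (set Omega) :=
  <<s [set A | exists u (B : set (\bar R)), [/\ 0 <= u <= t, measurable B &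
                              A = sigma u @^-1` B]] >>.

(* [+oo] is the cemetery of a killed subordinator.  Before the lifetime, the
   increment over [t, t + s] is independent of the past up to time t and
   distributed as sigma s; on [sigma t < +oo] the difference in [\bar R] is
   unambiguous, and equals [+oo] if killing happens during [t, t + s]. *)
Definition subordinator (R : realType) d (Omega : measurableType d)
    (P : probability Omega R) (sigma : R -> {RV P >-> \bar R}) : Prop :=
  [/\ {ae P, forall w, sigma 0 w = 0%E},
      {ae P, forall w, forall s t : R, 0 <= s <= t -> (sigma s w <= sigma t w)%E},
      {ae P, forall w, forall t : R, 0 <= t ->
         (fun u => sigma u w) @ t^'+ --> sigma t w} &
      forall (s t : R) (A : set Omega) (B : set (\bar R)), 0 <= s -> 0 <= t ->
        past (fun u => sigma u) t A -> measurable B ->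
        P (A `&` [set w | sigma t w < +oo]%E `&`
           [set w | B (sigma (t + s)%R w - sigma t w)%E]) =
        (P (A `&` [set w | sigma t w < +oo]%E) *
         P (sigma s @^-1` B))%E].

(* Since [expeR -oo = 0], killed paths do not contribute. *)
Definition laplace_exponent (R : realType) d (Omega : measurableType d)
    (P : probability Omega R) (sigma : R -> {RV P >-> \bar R})
    (f : R -> \bar R) : Prop :=
  forall t lambda : R, 0 <= t -> 0 < lambda ->
    (\int[P]_w expeR (- (lambda%:E * sigma t w)) =
     expeR (- (t%:E * f lambda)))%E.

Definition point_count (R : realType) (Omega S : Type)
    (e : R -> Omega -> option S) (A : set (R * S)) (w : Omega) : \bar R :=
  counting [set s | exists2 x, e s w = Some x & A (s, x)].

(* [e s w = None] means that there is no point at time s.  Marks live in D and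
   only the times s >= 0 matter.  The Poisson weights are written out because
   [poisson_pmf 0 k] is 1 for every k. *)
Definition poisson_point_process (R : realType) d d' (Omega : measurableType d)
    (S : measurableType d') (P : probability Omega R) (D : set S)
    (n : {sigma_finite_measure set S -> \bar R})
    (e : R -> Omega -> option S) : Prop :=
  let region := [set A : set (R * S) |
                  measurable A /\ A `<=` `[0%R, +oo[ `*` setT] in
  [/\ forall (s : R) w x, 0 <= s -> e s w = Some x -> D x,
      forall A, region A -> measurable_fun setT (point_count e A),
      (forall A, region A -> ((lebesgue_measure \x n) A < +oo)%E ->
        let m := fine ((lebesgue_measure \x n)%E A) in
        forall k : nat, P [set w | point_count e A w = k%:R%:E] =
          (m ^+ k / k`!%:R * expR (- m))%:E) &
      forall (j : nat) (A : 'I_j -> set (R * S)) (B : 'I_j -> set (\bar R)),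
        (forall i, region (A i)) -> trivIset setT A ->
        (forall i, measurable (B i)) ->
        P (\bigcap_i (point_count e (A i) @^-1` B i)) =
        (\prod_(i < j) P (point_count e (A i) @^-1` B i))%E].

Definition mixed_levy_measure (R : realType) (E : ptopologicalType)
    (W : set (borel E)) (p : probability (borel E) R) (a : E -> R)
    (nu : R.-sigmafker borel E ~> R) (B : set (\bar R)) : \bar R :=
  (\int[p]_(y in W) (nu y (EFin @^-1` B) + (a y)%:E * \d_(+oo) B))%E.

Definition distributed_order_subordinator (R : realType) (E : ptopologicalType)
    (W : set (borel E)) (p : probability (borel E) R) (a b : E -> R)
    (nu : R.-sigmafker borel E ~> R) d (Omega : measurableType d)
    (P : probability Omega R) (sigma : R -> {RV P >-> \bar R}) : Prop :=
  exists (n : {sigma_finite_measure set (\bar R) -> \bar R})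
         (e : R -> Omega -> option (\bar R)),
    [/\ forall B : set (\bar R), measurable B -> n B = mixed_levy_measure W p a nu B,
        poisson_point_process P [set x | 0 < x]%E n e &
        forall (t : R) w, 0 <= t ->
          sigma t w = (t%:E * \int[p]_(y in W) (b y)%:E +
            \esum_(s in [set s | (0 <= s <= t)%R]) odflt 0 (e s w))%E].

Section law_on_reals.
Context (R : realType) d (Omega : measurableType d) (P : probability Omega R).
Variable X : {RV P >-> \bar R}.
Local Open Scope ereal_scope.

(* The possible atom of the law at +oo is dropped, so the mass may be < 1. *)
Definition real_law (B : set R) : \bar R := distribution P X (EFin @` B).

Let real_law0 : real_law set0 = 0.
Proof. by rewrite /real_law image_set0 measure0. Qed.

Let real_law_ge0 B : 0 <= real_law B.
Proof. exact: measure_ge0. Qed.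

Let real_law_sigma_additive : semi_sigma_additive real_law.
Proof.
move=> F mF tF mUF; rewrite /real_law image_bigcup.
apply: measure_semi_sigma_additive.
- by move=> i; apply: measurable_image_EFin; exact: mF.
- apply/trivIsetP => i j _ _ ij.
  have /trivIsetP /(_ i j I I ij) Fij := tF.
  rewrite -subset0 => _ [[x Fix <-] [y Fjy [yx]]]; rewrite yx in Fjy.
  by have : (F i `&` F j) x by []; rewrite Fij.
- by rewrite -image_bigcup; exact: measurable_image_EFin mUF.
Qed.

HB.instance Definition _ := isMeasure.Build _ _ _ real_law
  real_law0 real_law_ge0 real_law_sigma_additive.

End law_on_reals.

(* 1 - exp(- t alpha), with value 1 at alpha = +oo also for t = 0 (where
   [0 * +oo = 0] would give 0): rho {+oo} is the mass of an atom at 0. *)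
Definition exp_cdf (R : realType) (t : R) (alpha : \bar R) : \bar R :=
  if alpha is r%:E then (1 - expR (- (t * r)))%:E else 1%E.

(* A measure on [0,oo) is a measure on R charging no negative number, a
   measure on (0,oo] one on [\bar R] charging no nonpositive number. *)
Definition ME (R : realType) (mu : {measure set R -> \bar R}) : Prop :=
  mu `]-oo, 0[%classic = 0%E /\
  exists2 rho : subprobability (\bar R) R,
    rho [set x | (x <= 0)%E] = 0%E &
    forall t : R, 0 <= t ->
      mu `[0, t]%classic = (\int[rho]_(x in [set x | (0 < x)%E]) exp_cdf t x)%E.

(* Main.v *)
Require Import Defs.
From HB Require Import structures.
From mathcomp Require Import all_boot all_order all_algebra.
From mathcomp Require Import complex spectral sesquilinear finmap.
From mathcomp Require Import all_classical all_reals all_analysis.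
From mathcomp Require Import measurable_realfun ring lra.

(* A function [l |-> \sum_j w_j a_j / (l + a_j)] is a quadratic form of the
   resolvent of a diagonal matrix C.  The parallel sum of two such forms, at v
   and w, is the form of the compression of C to the orthogonal complement of
   v - w, so the spectral theorem makes the class stable under harmonic means.
   Iterating arithmetic and harmonic means, the closure of the class (in the
   sense of values at finitely many points) is stable under geometric means,
   hence is log-convex, and the nearest point argument behind Jensen's inequality
   puts exp of the p-average of the exponents [- t f(., y)] in the closure.
   By compactness such a pointwise limit is the Laplace transform of a mixture
   of exponential laws; laws on [0, oo] are determined by their Laplace transform,
   because [(1 - Y^(n l))^(2^n)] converges to the indicator of [Y^l < 1/2].
   Campbell's formula for the Poisson point process identifies the Laplace
   transform of the distributed order subordinator. *)

Set Implicit Arguments.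
Unset Strict Implicit.
Unset Printing Implicit Defensive.

Import Order.TTheory GRing.Theory Num.Theory.
Import numFieldNormedType.Exports.
Import HBNNSimple.

Local Open Scope classical_set_scope.
Local Open Scope ring_scope.

(** * Harmonic means of Stieltjes functions *)

Section harmonic_means.
Local Open Scope sesquilinear_scope.

(** The exponential of an average of exponents is a continuous geometric mean of Stieltjes
    functions, so the heart of the matter is the log-convexity of that class. It is usually read off
    from the argument of the analytic continuation to the upper half-plane; resolvents of finite
    matrices replace this by linear algebra. The mixing measures of the laws at different [y] come
    from bare existence statements, without measurability in [y], and the laws live on unrelated
    probability spaces. They are therefore never integrated over [y]: only the values of the
    exponents at finitely many points are, and membership in a closed convex set involves no choice.
    Total weights are only asked to be at most 1 and the hull contains 0, which accommodates
    killing. The constant 1, the transform of an atom at 0, is reached in the closure only. The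
    variable [a / (1 + a)] in [[0, 1]] turns the rates 0 and [+oo] into ordinary points for the
    compactness argument. *)

Lemma psd_resolventE (C : numClosedFieldType) n (M : 'M[C]_n) (v : 'cV[C]_n) :
  M \is hermsymmx -> (forall x : 'cV[C]_n, 0 <= (x ^t* *m M *m x) 0 0) ->
  exists u d : 'I_n -> C,
    [/\ forall k, 0 <= u k, forall k, 0 <= d k &
        forall (l : C) z, 0 < l -> l *: z + M *m z = v ->
          (v ^t* *m z) 0 0 = \sum_k u k / (l + d k)].
Proof.
move=> hM psdM.
have nM := hermitian_normalmx hM.
pose P := spectralmx M; pose D := spectral_diag M.
have MPD : M = P ^t* *m diag_mx D *m P.
  by rewrite -invmx_unitary ?spectral_unitarymx//; exact/orthomx_spectralP.
have PPt : P *m P ^t* = 1%:M by exact/unitarymxP/spectral_unitarymx.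
have PtP : P ^t* *m P = 1%:M by exact: mulmx1C.
have PM : P *m M = diag_mx D *m P by rewrite MPD !mulmxA PPt mul1mx.
(* The column [P ^t* *m delta_mx k 0] is an eigenvector of [M] for the [k]-th eigenvalue, so
   positivity of the form, tested on it, gives the sign. *)
have D_ge0 k : 0 <= D 0 k.
  have := psdM (P ^t* *m delta_mx k 0).
  have -> : (P ^t* *m delta_mx k 0) ^t* *m M *m (P ^t* *m delta_mx k 0)
          = delta_mx 0 k *m diag_mx D *m delta_mx k 0 :> 'M[C]_1.
    by rewrite trmx_mul map_mxM /= trmxCK trmx_delta map_delta_mx !mulmxA
       -(mulmxA (delta_mx 0 k)) PM !mulmxA -(mulmxA _ P) PPt mulmx1.
  by rewrite -rowE -colE !mxE eqxx mulr1n.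
(* In the eigenbasis [l z + M z = v] reads [(l + D_k) (P z)_k = (P v)_k], so the coefficients are
   [|(P v)_k|^2]. The resolvent enters through a solution [z]; no inverse matrix is formed. *)
pose Pv := P *m v.
exists (fun k => `|Pv k 0| ^+ 2), (fun k => D 0 k).
split=> [k|//|l z l_gt0 lMz]; first by rewrite exprn_ge0.
have PvE k : Pv k 0 = (l + D 0 k) * (P *m z) k 0.
  rewrite /Pv -lMz mulmxDr -scalemxAr mulmxA PM -mulmxA mul_diag_mx !mxE mulrDl.
  by [].

have -> : v ^t* *m z = Pv ^t* *m (P *m z).
  by rewrite /Pv trmx_mul map_mxM /= mulmxA -(mulmxA _ _ P) PtP mulmx1.
rewrite mxE; apply: eq_bigr => k _.
have ld : l + D 0 k != 0 by rewrite gt_eqF// ltr_wpDr.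
have lDr : (l + D 0 k)^* = l + D 0 k.
  by apply: (CrealP (ger0_real _)); rewrite addr_ge0// ltW.
rewrite [X in X * _]mxE [Pv^T _ _]mxE normCK PvE rmorphM /= lDr.
by field.
Qed.

(* The parallel sum [fg/(f+g)] of the resolvent forms [f] and [g] at [v] and [w]
   is a resolvent form of the compression of [diag c] to the orthogonal
   complement of [v - w]. *)
Lemma parallel_sumE (C : numClosedFieldType) n (c v w : 'I_n -> C) :
    (forall k, 0 <= c k) -> (forall k, 0 <= v k) -> (forall k, 0 <= w k) ->
    (forall k, v k * w k = 0) -> (exists k, v k + w k != 0) ->
  let f l := \sum_k v k ^+ 2 / (l + c k) in
  let g l := \sum_k w k ^+ 2 / (l + c k) in
  exists u d : 'I_n -> C,
    [/\ forall k, 0 <= u k, forall k, 0 <= d k &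
        forall l : C, 0 < l -> f l * g l / (f l + g l) = \sum_k u k / (l + d k)].
Proof.
move=> c_ge0 v_ge0 w_ge0 vw [k0 vwk0] f g.
pose V : 'cV[C]_n := \col_k v k; pose W : 'cV[C]_n := \col_k w k.
pose N := V - W; pose s := \sum_k (v k ^+ 2 + w k ^+ 2).
have N2 k : (v k - w k) ^+ 2 = v k ^+ 2 + w k ^+ 2.
  by rewrite sqrrB vw mul0rn subr0.
have s_gt0 : 0 < s.
  rewrite /s (bigD1 k0) //= ltr_pwDl//; last first.
    by rewrite sumr_ge0// => k _; rewrite addr_ge0// exprn_ge0.
  rewrite -N2 lt0r sqrf_eq0 N2 addr_ge0 ?exprn_ge0// andbT.
  apply: contra vwk0 => /eqP vw0; rewrite -sqrf_eq0 sqrrD vw mul0rn addr0 -N2 vw0.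
  by rewrite expr0n.
pose Pi : 'M[C]_n := 1%:M - s^-1 *: (N *m N^T).
have NN : N^T *m N = s%:M.
  rewrite [LHS]mx11_scalar; congr (_%:M); rewrite mxE; apply: eq_bigr => k _.
  by rewrite !mxE -expr2 N2.
have PiN : Pi *m N = 0.
  rewrite mulmxBl mul1mx -scalemxAl -mulmxA NN mul_mx_scalar.
  by rewrite scalerA mulVf ?gt_eqF// scale1r subrr.
have realV : V ^ Num.conj = V.
  by apply/matrixP=> i j; rewrite !mxE; apply: (CrealP (ger0_real _)).
have realW : W ^ Num.conj = W.
  by apply/matrixP=> i j; rewrite !mxE; apply: (CrealP (ger0_real _)).
have realN : N ^ Num.conj = N by rewrite map_mxB realV realW.
have trPi : Pi ^t* = Pi.
  rewrite linearB /= trmx1 linearZ /= trmx_mul trmxK map_mxB map_mx1 map_mxZ.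
  rewrite map_mxM /= -map_trmx realN; congr (_ - _ *: _).
  by apply: (CrealP (ger0_real _)); rewrite invr_ge0 ltW.
pose D : 'M[C]_n := diag_mx (\row_k c k).
have trD : D ^t* = D.
  rewrite tr_diag_mx map_diag_mx; congr diag_mx; apply/matrixP=> i j.
  by rewrite !mxE; apply: (CrealP (ger0_real _)).
pose M := Pi *m D *m Pi.
have hM : M \is hermsymmx.
  apply/is_hermitianmxP; rewrite expr0 scale1r.
  by rewrite /M !trmx_mul !map_mxM /= trPi trD mulmxA.
have psdM (x : 'cV[C]_n) : 0 <= (x ^t* *m M *m x) 0 0.
  have -> : x ^t* *m M *m x = (Pi *m x) ^t* *m D *m (Pi *m x).
    by rewrite trmx_mul map_mxM /= trPi !mulmxA.
  rewrite -mulmxA mul_diag_mx mxE sumr_ge0// => k _.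
  by rewrite !mxE mulrCA mulr_ge0// mulrC mul_conjC_ge0.
have [u [d [u_ge0 d_ge0 udE]]] := psd_resolventE (Pi *m V) hM psdM.
exists u, d; split=> // l l_gt0.
have lc k : l + c k != 0 by rewrite gt_eqF// ltr_wpDr.
have f_ge0 : 0 <= f l.
  by rewrite sumr_ge0// => k _; rewrite divr_ge0 ?exprn_ge0// addr_ge0// ltW.
have g_ge0 : 0 <= g l.
  by rewrite sumr_ge0// => k _; rewrite divr_ge0 ?exprn_ge0// addr_ge0// ltW.
have fgE : f l + g l = \sum_k (v k ^+ 2 + w k ^+ 2) / (l + c k).
  by rewrite -big_split; apply: eq_bigr => k _; rewrite mulrDl.
have fg0 : f l + g l != 0.
  rewrite fgE (bigD1 k0) //= gt_eqF// ltr_pwDl//; last first.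
    rewrite sumr_ge0// => k _.
    by rewrite divr_ge0 ?addr_ge0 ?exprn_ge0// ltW.
  rewrite divr_gt0//; last by rewrite ltr_wpDr.
  rewrite -N2 lt0r sqrf_eq0 N2 addr_ge0 ?exprn_ge0// andbT.
  apply: contra vwk0 => /eqP vw0; rewrite -sqrf_eq0 sqrrD vw mul0rn addr0 -N2 vw0.
  by rewrite expr0n.
(* The weights are forced by [p + q = 1] and [p f = q g]. The first gives [p v + q w = v - q N],
   which [Pi] sends to [Pi V]; the second makes [z], the diagonal resolvent of [p v + q w],
   orthogonal to [N]. So [z] is also the compressed resolvent of [Pi V], and its product with [V] is
   [p f = f g / (f + g)]. *)
pose p := g l / (f l + g l); pose q := f l / (f l + g l).
have pq : p + q = 1 by rewrite -mulrDl addrC mulfV.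
pose z : 'cV[C]_n := \col_k ((p * v k + q * w k) / (l + c k)).
have dotVz : V^T *m z = (p * f l)%:M.
  rewrite [LHS]mx11_scalar; congr (_%:M); rewrite mxE mulr_sumr.
  apply: eq_bigr => k _; rewrite !mxE mulrA.
  have -> : v k * (p * v k + q * w k) = p * v k ^+ 2 + q * (v k * w k) by ring.
  by rewrite vw mulr0 addr0 mulrA.
have dotWz : W^T *m z = (q * g l)%:M.
  rewrite [LHS]mx11_scalar; congr (_%:M); rewrite mxE mulr_sumr.
  apply: eq_bigr => k _; rewrite !mxE mulrA.
  have -> : w k * (p * v k + q * w k) = q * w k ^+ 2 + p * (v k * w k) by ring.
  by rewrite vw mulr0 addr0 mulrA.
have pfqg : p * f l = q * g l by rewrite /p /q; field.
have Piz : Pi *m z = z.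
  have NTz : N^T *m z = 0 by rewrite linearB /= mulmxBl dotVz dotWz pfqg subrr.
  by rewrite mulmxBl mul1mx -scalemxAl -mulmxA NTz mulmx0 scaler0 subr0.
have Mz : l *: z + M *m z = Pi *m V.
  have -> : l *: z = Pi *m (l *: z) by rewrite -scalemxAr Piz.
  rewrite /M -!mulmxA Piz -mulmxDr.
  have -> : l *: z + D *m z = V - q *: N.
    apply/matrixP=> k j; rewrite mul_diag_mx !mxE -mulrDl mulrC divfK//.
    by rewrite -[p](addrK q) pq; ring.
  by rewrite mulmxBr -scalemxAr PiN scaler0 subr0.
have := udE l z l_gt0 Mz.
rewrite trmx_mul map_mxM /= trPi -mulmxA Piz -map_trmx realV dotVz !mxE eqxx mulr1n.
by move=> <-; rewrite /p [RHS]mulrC mulrA.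
Qed.

(** These are the Laplace transforms of finite mixtures of exponential laws with rates [a j] and
    total mass at most 1; a rate 0 contributes nothing at [l > 0]. *)
Definition atomic_stieltjes (R : realFieldType) (f : R -> R) : Prop :=
  exists n (w a : 'I_n -> R),
    [/\ forall j, 0 <= w j, forall j, 0 <= a j, \sum_j w j <= 1 &
        forall l, 0 < l -> f l = \sum_j w j * (a j / (l + a j))].

Lemma atomic_stieltjes_le1 (R : realFieldType) (f : R -> R) l :
  atomic_stieltjes f -> 0 < l -> f l <= 1.
Proof.
move=> [n [w [a [w0 a0 w1 fE]]]] l0; rewrite fE//; apply: le_trans w1.
apply: ler_sum => j _; rewrite ler_piMr// ler_pdivrMr ?ltr_pwDl//.
by rewrite mul1r lerDr ltW.
Qed.

(** All terms are non-negative, and whether a term vanishes depends on [w j] and [a j] but not on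
    the point. Positivity thus spreads from one point to all, which keeps the denominators of
    harmonic means away from 0. *)
Lemma atomic_stieltjes_gt0 (R : realFieldType) (f : R -> R) l0 l :
  atomic_stieltjes f -> 0 < l0 -> 0 < f l0 -> 0 < l -> 0 < f l.
Proof.
move=> [n [w [a [wge0 a0 w1 fE]]]] l00 fl0 l1.
have tge0 k j : 0 < k -> 0 <= w j * (a j / (k + a j)).
  by move=> k0; rewrite mulr_ge0// divr_ge0// addr_ge0// ltW.
rewrite lt0r fE// sumr_ge0 ?andbT; last by move=> j _; exact: tge0.
move: fl0; rewrite fE// lt0r => /andP[+ _]; apply: contra => /eqP s0.
apply/eqP/big1 => j _; move: s0 => /psumr_eq0P => /(_ (fun j _ => tge0 l j l1)).
move=> /(_ j isT)/eqP; rewrite !mulf_eq0 invr_eq0 => /or3P[/eqP->|/eqP->|].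
- by rewrite mul0r.
- by rewrite mul0r mulr0.
- by rewrite gt_eqF// ltr_pwDl.
Qed.

(* The residue [u] at the pole [-d] has weight [u/d]; a pole at [0] would make
   the bounded sum blow up there. *)
Lemma atomic_stieltjes_resolvent (R : realFieldType) n (u d : 'I_n -> R)
    (f : R -> R) :
  (forall k, 0 <= u k) -> (forall k, 0 <= d k) ->
  (forall l, 0 < l -> f l = \sum_k u k / (l + d k)) ->
  (forall l, 0 < l -> f l <= 1) -> atomic_stieltjes f.
Proof.
move=> u0 d0 fE f1.
have dz k : d k = 0 -> u k = 0.
  move=> dk; apply/eqP; rewrite eq_le u0 andbT.
  have ule l : 0 < l -> u k <= l.
    move=> l0; have := f1 l l0; rewrite fE// (bigD1 k)//= dk addr0.
    have sge : 0 <= \sum_(i | i != k) u i / (l + d i).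
      by rewrite sumr_ge0// => j _; rewrite divr_ge0// addr_ge0// ltW.
    move=> h; have : u k / l <= 1 by lra.
    by rewrite ler_pdivrMr// mul1r.
  apply/ler_addgt0Pl => e e0; rewrite addr0; exact: ule.
have wE k : u k = u k / d k * d k.
  by have [/eqP dk|dk] := boolP (d k == 0); [rewrite dz ?mul0r|rewrite divfK].
exists n, (fun k => u k / d k), d; split=> //.
- by move=> k; rewrite divr_ge0.
(* The total weight is the limit of [f] at [0+]. The error [u / d - u / (l + d)] is at most
   [l u / d^2], whose sum is [l] times a constant [K], so letting [l] tend to 0 in [f l <= 1] bounds
   the weights by 1. Below, [K + 1] avoids dividing by 0. *)
- have dl (l : R) : 0 < l -> \sum_k u k / d k <= 1 + l * \sum_k u k / d k / d k.
    move=> l0; apply: le_trans (lerD (f1 _ l0) (lexx _)).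
    rewrite fE// mulr_sumr -big_split /=; apply: ler_sum => k _.
    have [/eqP dk|dk] := boolP (d k == 0); first by rewrite dz// !mul0r mulr0 addr0.
    have dk0 : 0 < d k by rewrite lt0r dk d0.
    rewrite -subr_ge0.
    have -> : u k / (l + d k) + l * (u k / d k / d k) - u k / d k =
       u k * l ^+ 2 / (d k ^+ 2 * (l + d k)).
      by field; rewrite ?dk ?gt_eqF// ?addr_gt0.
    rewrite divr_ge0 ?mulr_ge0 ?exprn_ge0 ?addr_ge0 ?u0 ?d0 ?ltW//.
  have K0 : 0 <= \sum_k u k / d k / d k.
    by rewrite sumr_ge0// => k _; rewrite !divr_ge0.
  set K := \sum_k u k / d k / d k in dl K0.
  apply/ler_addgt0Pr => e e0.
  have K1 : 0 < K + 1 by rewrite ltr_wpDl.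
  have := dl (e / (K + 1)) (divr_gt0 e0 K1); move/le_trans; apply.
  rewrite lerD2l mulrAC ler_pdivrMr// ler_wpM2l ?(ltW e0)//.
  by rewrite lerDl.
- by move=> l l0; rewrite fE//; apply: eq_bigr => k _; rewrite {1}wE mulrA.
Qed.

(** Juxtaposing the two families of poles on ['I_(m + n)], the square roots of the residues [w a]
    form two vectors with disjoint supports, as [parallel_sumE] requires. The detour through [R[i]]
    serves the spectral theorem; all data returned are non-negative, hence real. The bound by 1
    needed for the weights is the mean inequality. *)
Lemma atomic_stieltjes_harmonic (R : rcfType) (f g : R -> R) l0 :
  atomic_stieltjes f -> atomic_stieltjes g -> 0 < l0 -> 0 < f l0 -> 0 < g l0 ->
  atomic_stieltjes (fun l => 2 * (f l * g l / (f l + g l))).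
Proof.
move=> sf sg l00 fl0 gl0.
have f_gt0 l := atomic_stieltjes_gt0 sf l00 fl0 (l := l).
have g_gt0 l := atomic_stieltjes_gt0 sg l00 gl0 (l := l).
have f_le1 l := atomic_stieltjes_le1 sf (l := l).
have g_le1 l := atomic_stieltjes_le1 sg (l := l).
move: sf sg => [m [w [a [w0 a0 _ fE]]]] [n [v [b [v0 b0 _ gE]]]].
pose toC : {rmorphism R -> R[i]} := real_complex R.
pose c (k : 'I_(m + n)) := match fintype.split k with inl i => a i | inr j => b j end.
pose p (k : 'I_(m + n)) := match fintype.split k with inl i => Num.sqrt (w i * a i) | inr j => 0 end.
pose q (k : 'I_(m + n)) := match fintype.split k with inl i => 0 | inr j => Num.sqrt (v j * b j) end.
have c0 k : 0 <= c k by rewrite /c; case: fintype.splitP.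
have p0 k : 0 <= p k by rewrite /p; case: fintype.splitP => // *; rewrite sqrtr_ge0.
have q0 k : 0 <= q k by rewrite /q; case: fintype.splitP => // *; rewrite sqrtr_ge0.
have pq k : p k * q k = 0.
  by rewrite /p /q; case: fintype.splitP => *; rewrite ?mul0r ?mulr0.
have fE' l : 0 < l -> f l = \sum_k p k ^+ 2 / (l + c k).
  move=> l1; rewrite fE// big_split_ord /= [X in _ + X]big1 ?addr0; last first.
    by move=> j _; rewrite /p (unsplitK (inr _ j)) expr0n mul0r.
  apply: eq_bigr => i _; rewrite /p /c (unsplitK (inl _ i)).
  by rewrite sqr_sqrtr ?mulr_ge0// mulrA.
have gE' l : 0 < l -> g l = \sum_k q k ^+ 2 / (l + c k).
  move=> l1; rewrite gE// big_split_ord /= [X in X + _]big1 ?add0r; last first.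
    by move=> j _; rewrite /q (unsplitK (inl _ j)) expr0n mul0r.
  apply: eq_bigr => i _; rewrite /q /c (unsplitK (inr _ i)).
  by rewrite sqr_sqrtr ?mulr_ge0// mulrA.
have [k0 pk0] : exists k, p k != 0.
  apply/not_existsP => p_eq0; move: fl0; rewrite fE'// big1 ?ltxx// => k _.
  by have /negP/negPn/eqP -> := p_eq0 k; rewrite expr0n mul0r.
have [] := @parallel_sumE R[i] _ (fun k => toC (c k)) (fun k => toC (p k))
  (fun k => toC (q k)).
- by move=> k; rewrite ler0c.
- by move=> k; rewrite ler0c.
- by move=> k; rewrite ler0c.
- by move=> k; rewrite -rmorphM /= pq.
- exists k0; rewrite -rmorphD /= (inj_eq (@complexI R) _ 0).
  by rewrite gt_eqF// ltr_wpDr// lt0r pk0 p0.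
move=> u [d [u0 d0 udE]].
have uRe k : u k = toC (complex.Re (u k)) by rewrite /toC /= RRe_real// ger0_real.
have dRe k : d k = toC (complex.Re (d k)) by rewrite /toC /= RRe_real// ger0_real.
apply: (@atomic_stieltjes_resolvent R _ (fun k => 2 * complex.Re (u k))
  (fun k => complex.Re (d k))).
- by move=> k; rewrite mulr_ge0// -ler0c -[X in 0 <= X]uRe.
- by move=> k; rewrite -ler0c -[X in 0 <= X]dRe.
- move=> l l1.
  under [RHS]eq_bigr do rewrite -mulrA.
  rewrite -mulr_sumr; congr (2 * _); apply: (@complexI R); rewrite -!/(toC _).
  have toC_sum (r s : 'I_(m + n) -> R) :
      toC (\sum_k r k / (l + s k)) = \sum_k toC (r k) / (toC l + toC (s k)).
    by rewrite rmorph_sum; apply: eq_bigr => k _; rewrite fmorph_div rmorphD.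
  have toC2 (r s : 'I_(m + n) -> R) : \sum_k toC (r k ^+ 2) / (toC l + toC (s k)) =
      \sum_k toC (r k) ^+ 2 / (toC l + toC (s k)).
    by apply: eq_bigr => k _; rewrite rmorphXn.
  have := udE (toC l); rewrite ltcR => /(_ l1).
  rewrite fE'// gE'// fmorph_div rmorphM rmorphD /= -!/(toC _) !toC_sum !toC2 => ->.
  by apply: eq_bigr => k _; rewrite -uRe -dRe.
- move=> l l1; have := f_gt0 l l1; have := g_gt0 l l1.
  have := f_le1 l l1; have := g_le1 l l1.
  move: (f l) (g l) => x y y1 x1 yp xp.
  rewrite mulrA ler_pdivrMr ?addr_gt0// mul1r mulr_natl mulr2n; nra.
Qed.

End harmonic_means.

(** * Jensen's inequality for closed midpoint-convex sets *)

Definition midpoint_convex (R : realType) n (L : set 'rV[R]_n) : Prop :=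
  forall x y, L x -> L y -> L (2^-1 *: (x + y)).

(** Midpoints give dyadic steps only, which is enough: the first variation at [c] needs no more than
    step lengths tending to 0. *)
Lemma midpoint_convex_dyadic (R : realType) n (L : set 'rV[R]_n) c x k :
  midpoint_convex L -> L c -> L x -> L (c + (2^-1) ^+ k *: (x - c)).
Proof.
move=> cL Lc Lx; elim: k => [|k ih]; first by rewrite expr0 scale1r addrC subrK.
suff -> : c + 2^-1 ^+ k.+1 *: (x - c) = 2^-1 *: (c + (c + (2^-1) ^+ k *: (x - c))).
  exact: cL.
by apply/rowP => i; rewrite !mxE exprS; field.
Qed.

Lemma nearest_point (R : realType) n (L : set 'rV[R]_n) (w : 'rV[R]_n) :
  closed L -> L !=set0 ->
  exists2 c, L c & forall x, L x ->
    \sum_i (w 0 i - c 0 i) ^+ 2 <= \sum_i (w 0 i - x 0 i) ^+ 2.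
Proof.
move=> clL [x0 Lx0]; pose f (x : 'rV[R]_n) := \sum_i (w 0 i - x 0 i) ^+ 2.
(* A point at least as close as [x0] has coordinates with [y^2 <= f x0], hence
   [|y| <= y^2 + 1 <= r]; this box makes the minimisation compact. *)
pose r := f x0 + 1.
pose B := [set x : 'rV[R]_n | forall i, x ord0 i \in `[w 0 i - r, w 0 i + r]].
have cB : compact B.
  apply: (@rV_compact _ _ (fun i => `[w 0 i - r, w 0 i + r]%classic)) => i.
  exact: segment_compact.
have inB x : f x <= f x0 -> B x.
  move=> fx i; rewrite in_itv/= -ler_distl distrC -[w ord0 i]/(w 0 i).
  have : (w 0 i - x ord0 i) ^+ 2 <= f x0.
    apply: le_trans fx; rewrite /f (bigD1 i)//= lerDl sumr_ge0// => j _.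
    exact: sqr_ge0.
  rewrite /r -real_normK ?num_real//.
  by move: `|_| (normr_ge0 (w 0 i - x ord0 i)) => y y0 ?; nra.
have fc : continuous f.
  apply: continuous_big => [|i _ y]; first exact: add_continuous.
  have ci : {for y, continuous (fun z : 'rV[R]_n => w 0 i - z 0 i)}.
    by apply: continuousB; [exact: cst_continuous|exact: coord_continuous].
  exact: (continuousM ci ci).
have [c cK cmin] : exists2 c, c \in L `&` B &
    forall t, t \in L `&` B -> f c <= f t.
  apply: compact_EVT_min.
  - by exists x0; split=> //; exact: inB.
  - have cLB : closed (L `&` B).
      by apply: closedI => //; exact: (compact_closed (@norm_hausdorff _ _)).
    exact: subclosed_compact cLB cB (@subIsetr _ _ _).
  - exact: continuous_subspaceT.
move: cK; rewrite inE => -[Lc Bc]; exists c => // x Lx.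
have [xx0|/ltW xx0] := leP (f x) (f x0).
  by apply: cmin; rewrite inE; split=> //; exact: inB.
by apply: le_trans xx0; apply: cmin; rewrite inE; split=> //; exact: inB.
Qed.

(* The nearest point [c] of [L] to the barycenter [w] satisfies
   [<w - c, x - c> <= 0] on [L]; averaging over [x = v t] gives [w = c]. *)
Lemma closed_convex_integral (R : realType) d (T : measurableType d)
    (mu : {measure set T -> \bar R}) (D : set T) n (L : set 'rV[R]_n)
    (v : T -> 'rV[R]_n) :
  measurable D -> (mu D <= 1)%E -> closed L -> midpoint_convex L -> L 0 ->
  (forall t, D t -> L (v t)) ->
  (forall i, mu.-integrable D (EFin \o (fun t => v t 0 i))) ->
  L (\row_i \int[mu]_(t in D) v t 0 i).
Proof.
move=> mD muD clL cL L0 Lv iv; set w := \row_i _.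
have [c Lc cmin] := nearest_point w clL (ex_intro _ _ L0).
pose u i := w 0 i - c 0 i.
have sep x : L x -> \sum_i u i * (x 0 i - c 0 i) <= 0.
  move=> Lx; set s := \sum_i _; pose q := \sum_i (x 0 i - c 0 i) ^+ 2.
  have q0 : 0 <= q by rewrite sumr_ge0// => i _; rewrite sqr_ge0.
  (* Minimality of [c] against [c + h (x - c)] gives [2 h s <= h^2 q]; divide by [h = 2^-k], then
     let [k] grow. *)
  have sq k : 2 * s <= 2^-1 ^+ k * q.
    have := cmin _ (midpoint_convex_dyadic k cL Lc Lx); set h := 2^-1 ^+ k.
    have h0 : 0 < h by rewrite exprn_gt0// invr_gt0.
    have -> : \sum_i (w 0 i - (c + h *: (x - c)) 0 i) ^+ 2 =
        \sum_i (w 0 i - c 0 i) ^+ 2 - 2 * h * s + h ^+ 2 * q.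
      rewrite !mulr_sumr -sumrN -!big_split /=; apply: eq_bigr => i _.
      by rewrite !mxE /u !mxE; ring.
    by rewrite expr2 => H; rewrite -(ler_pM2l h0); lra.
  have : 2 * s <= 0.
    have cv : (fun k => 2^-1 ^+ k * q) @ \oo --> 0 * q.
      by apply: cvgMl; apply: cvg_expr; rewrite ger0_norm// invf_lt1 ?ltr1n.
    rewrite -(mul0r q) -(cvg_lim (@Rhausdorff R) cv).
    apply: limr_ge; first by apply/cvg_ex; eexists; exact: cv.
    by near=> k; exact: sq.
  by rewrite pmulr_rle0.
have mufin : mu D \is a fin_num.
  by rewrite ge0_fin_numE//; exact: le_lt_trans muD (ltry _).
pose m := fine (mu D).
have m1 : m <= 1 by rewrite -lee_fin fineK.
have ic (k : R) : mu.-integrable D (EFin \o cst k).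
  apply: measurable_bounded_integrable => //.
    by rewrite -ge0_fin_numE.
  by exists `|k|; split; [exact: num_real|move=> M kM t _ /=; exact: ltW].
have iuv i : mu.-integrable D (fun t => (u i)%:E * (v t 0 i)%:E)%E.
  exact: integrableZl (iv i).
have int_uv : (\int[mu]_(t in D) (\sum_i (u i)%:E * (v t 0 i)%:E) =
    (\sum_i u i * w 0 i)%:E)%E.
  rewrite integral_sum// -sumEFin; apply: eq_bigr => i _.
  rewrite integralZl//; last exact: iv.
  rewrite EFinM mxE /Rintegral fineK//; exact: integrable_fin_num (iv i).
have int_le : \sum_i u i * (w 0 i - c 0 i * m) <= 0.
  have : (\int[mu]_(t in D) (\sum_i (u i)%:E * (v t 0 i)%:E) <=
          \int[mu]_(t in D) (\sum_i u i * c 0 i)%:E)%E.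
    apply: le_integral => //; [exact: integrable_sum|exact: ic|].
    move=> t; rewrite inE => Dt; under eq_bigr do rewrite -EFinM.
    rewrite sumEFin lee_fin -subr_le0 -sumrB.
    by under eq_bigr do rewrite -mulrBr; exact: sep (Lv t Dt).
  rewrite int_uv integral_cst// -[mu D]fineK// -EFinM lee_fin -/m.
  rewrite -subr_le0 mulr_suml -sumrB => h; apply: le_trans h.
  by apply: ler_sum => i _; rewrite mulrBr mulrA.
have := sep _ L0; under eq_bigr do rewrite mxE sub0r.
move=> c0.
have : \sum_i u i ^+ 2 <= 0.
  (* The measure may have mass [m < 1]. The vector [w] is then the average of the [v t] completed by
     the point 0 with weight [1 - m], and the separation inequality at 0 accounts for this last
     part. *)
  have -> : \sum_i u i ^+ 2 = \sum_i u i * (w 0 i - c 0 i * m) +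
     (1 - m) * \sum_i u i * - c 0 i.
    by rewrite mulr_sumr -big_split/=; apply: eq_bigr => i _; rewrite /u; ring.
  by rewrite ler_wnDr// mulr_ge0_le0// subr_ge0.
move=> u20.
suff -> : w = c by [].
have /psumr_eq0P u2 : \sum_i u i ^+ 2 = 0.
  by apply/eqP; rewrite eq_le u20 sumr_ge0// => i _; exact: sqr_ge0.
apply/rowP => i; apply/eqP; rewrite -subr_eq0 -/(u i) -sqrf_eq0.
by rewrite u2// => j _; exact: sqr_ge0.
Unshelve. all: by end_near.
Qed.

(** * The closed hull and its geometric means *)

Lemma closure_rVP (R : realType) n (A : set 'rV[R]_n) (x : 'rV[R]_n) :
  closure A x <->
  forall e, 0 < e -> exists2 y, A y & forall i, `|x 0 i - y 0 i| < e.
Proof.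
split=> [cAx e e0|H B /nbhs_ballP[e /= e0 xeB]].
  have [y [Ay [_ xy]]] := cAx _ (nbhsx_ballx x e e0).
  by exists y => // i; exact: xy.
have [y Ay xy] := H e e0; exists y; split=> //; apply: xeB; split=> // i j.
by rewrite ord1; exact: xy.
Qed.

Lemma atomic_stieltjes_mean (R : realFieldType) (f g : R -> R) :
  atomic_stieltjes f -> atomic_stieltjes g ->
  atomic_stieltjes (fun l => 2^-1 * (f l + g l)).
Proof.
move=> [m [w [a [w0 a0 w1 fE]]]] [n [v [b [v0 b0 v1 gE]]]].
pose c (k : 'I_(m + n)) := match fintype.split k with inl i => a i | inr j => b j end.
pose r (k : 'I_(m + n)) := match fintype.split k with inl i => 2^-1 * w i | inr j => 2^-1 * v j end.
exists (m + n)%N, r, c; split.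
- by rewrite /r => k; case: fintype.splitP => *; rewrite mulr_ge0.
- by rewrite /c => k; case: fintype.splitP.
- rewrite big_split_ord /= /r.
  under eq_bigr do rewrite (unsplitK (inl _ _)).
  under [X in _ + X]eq_bigr do rewrite (unsplitK (inr _ _)).
  by rewrite -!mulr_sumr; lra.
- move=> l l0; rewrite fE// gE// big_split_ord /= /r /c.
  under [in RHS]eq_bigr do rewrite (unsplitK (inl _ _)) -mulrA.
  under [X in _ = _ + X]eq_bigr do rewrite (unsplitK (inr _ _)) -mulrA.
  by rewrite -!mulr_sumr mulrDr.
Qed.

Lemma atomic_stieltjes0 (R : realFieldType) : atomic_stieltjes (fun=> 0 : R).
Proof.
exists 0%N, (fun=> 0), (fun=> 0); split=> //; first by rewrite big_ord0.
by move=> l _; rewrite big_ord0.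
Qed.

Lemma atomic_stieltjes_kernel (R : realFieldType) (a : R) : 0 <= a ->
  atomic_stieltjes (fun l => a / (l + a)).
Proof.
move=> a0; exists 1%N, (fun=> 1), (fun=> a); split=> //.
  by rewrite big_ord1.
by move=> l _; rewrite big_ord1 mul1r.
Qed.

Section stieltjes_hull.
Context (R : realType) (n : nat) (lam : 'I_n.+1 -> R).
Hypothesis lam_gt0 : forall i, 0 < lam i.

Definition atomic_values : set 'rV[R]_n.+1 :=
  [set x | exists2 f, atomic_stieltjes f & forall i, x 0 i = f (lam i)].

Definition stieltjes_hull : set 'rV[R]_n.+1 := closure atomic_values.

Lemma closed_stieltjes_hull : closed stieltjes_hull.
Proof. exact: closed_closure. Qed.

Lemma atomic_stieltjes_hull f : atomic_stieltjes f ->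
  stieltjes_hull (\row_i f (lam i)).
Proof. by move=> sf; apply: subset_closure; exists f => // i; rewrite mxE. Qed.

Lemma stieltjes_hull0 : stieltjes_hull 0.
Proof.
have := atomic_stieltjes_hull (atomic_stieltjes0 R).
by congr stieltjes_hull; apply/rowP => i; rewrite !mxE.
Qed.

(** The kernel [a / (l + a)] tends to 1 as [a] grows. The choice [e a = s], with [s] the sum of the
    points, makes the defect [lam i / (lam i + a)] smaller than [e] at all points at once. *)
Lemma stieltjes_hull1 : stieltjes_hull (const_mx 1).
Proof.
apply/closure_rVP => e e0; pose s := \sum_i lam i.
pose a := s / e.
have s0 : 0 <= s by rewrite sumr_ge0// => i _; exact: ltW.
have a0 : 0 <= a by rewrite divr_ge0// ltW.
exists (\row_i (a / (lam i + a))).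
  exists (fun l => a / (l + a)); first exact: atomic_stieltjes_kernel.
  by move=> i; rewrite mxE.
move=> i; rewrite !mxE.
have li : 0 < lam i + a by rewrite ltr_pwDl.
have -> : 1 - a / (lam i + a) = lam i / (lam i + a) by field; rewrite gt_eqF.
rewrite ger0_norm ?divr_ge0 ?ltW// ltr_pdivrMr// mulrDr.
have -> : e * a = s by rewrite /a mulrC divfK// gt_eqF.
rewrite (le_lt_trans (_ : _ <= s))//.
  by rewrite /s (bigD1 i)//= lerDl sumr_ge0// => j _; exact: ltW.
by rewrite ltrDr mulr_gt0.
Qed.

Lemma stieltjes_hull_midpoint : midpoint_convex stieltjes_hull.
Proof.
move=> x y /closure_rVP hx /closure_rVP hy; apply/closure_rVP => e e0.
have [x' [f sf xf] xx'] := hx e e0; have [y' [g sg yg] yy'] := hy e e0.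
exists (2^-1 *: (x' + y')).
  exists (fun l => 2^-1 * (f l + g l)); first exact: atomic_stieltjes_mean.
  by move=> i; rewrite !mxE xf yg.
move=> i; rewrite !mxE; have := xx' i; have := yy' i.
by rewrite !ltr_norml => /andP[? ?] /andP[? ?]; apply/andP; split; lra.
Qed.

Lemma closure_rV_seq (A : set 'rV[R]_n.+1) x : closure A x ->
  exists2 u : nat -> 'rV[R]_n.+1, forall k, A (u k) &
    forall i, (fun k => u k 0 i) @ \oo --> x 0 i.
Proof.
move=> /closure_rVP cAx.
have /choice[u uP] : forall k : nat, exists y, A y /\
    forall i, `|x 0 i - y 0 i| < k.+1%:R^-1.
  by move=> k; have [|y Ay xy] := cAx k.+1%:R^-1; [rewrite invr_gt0|exists y].
exists u => [k|i]; first by have [] := uP k.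
apply/cvgrPdist_lt => e e0.
near=> k; have [_ /(_ i)] := uP k; move=> /lt_trans; apply.
by near: k; exact: near_infty_natSinv_lt (PosNum e0).
Unshelve. all: by end_near.
Qed.

Lemma stieltjes_hull_harmonic x y : stieltjes_hull x -> stieltjes_hull y ->
  (forall i, 0 < x 0 i) -> (forall i, 0 < y 0 i) ->
  stieltjes_hull (\row_i (2 * (x 0 i * y 0 i / (x 0 i + y 0 i)))).
Proof.
move=> /closure_rV_seq[u Au ux] /closure_rV_seq[v Av vy] x0 y0.
apply/closure_rVP => e e0.
have cz i : (fun k => 2 * (u k 0 i * v k 0 i / (u k 0 i + v k 0 i))) @ \oo -->
    2 * (x 0 i * y 0 i / (x 0 i + y 0 i)).
  apply: cvgMr; apply: cvgM; first exact: cvgM.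
  by apply: cvgV; [rewrite gt_eqF// addr_gt0|exact: cvgD].
have cz' : \forall k \near \oo, forall i, `|2 * (x 0 i * y 0 i / (x 0 i + y 0 i)) -
    2 * (u k 0 i * v k 0 i / (u k 0 i + v k 0 i))| < e.
  by apply: filter_forall => i; move/cvgrPdist_lt : (cz i); exact.
(* Positivity of the approximants is needed at one point only, by [atomic_stieltjes_gt0], and it
   holds eventually because the limits are positive. *)
have u0 : \forall k \near \oo, 0 < u k 0 ord0.
  by have := ux ord0; move/cvgr_gt; apply.
have v0 : \forall k \near \oo, 0 < v k 0 ord0.
  by have := vy ord0; move/cvgr_gt; apply.
have [k [[uk vk] zk]] := filter_ex (filterI (filterI u0 v0) cz').
have [f sf fE] := Au k; have [g sg gE] := Av k.
exists (\row_i (2 * (u k 0 i * v k 0 i / (u k 0 i + v k 0 i)))).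
  exists (fun l => 2 * (f l * g l / (f l + g l))).
    by apply: (atomic_stieltjes_harmonic sf sg (lam_gt0 ord0)); rewrite -?fE -?gE.
  by move=> i; rewrite mxE fE gE.
by move=> i; rewrite !mxE; exact: zk.
Qed.

(** The difference of the means is [(a - b)^2 / (2 (a + b))], and [|a - b| <= a + b]. So each
    iteration at least halves the gap. *)
Lemma arithmetic_harmonic_step (a b : R) : 0 < a -> 0 < b ->
  `|2^-1 * (a + b) - 2 * (a * b / (a + b))| <= 2^-1 * `|a - b|.
Proof.
move=> a0 b0; have ab : 0 < a + b by rewrite addr_gt0.
have -> : 2^-1 * (a + b) - 2 * (a * b / (a + b)) = 2^-1 * ((a - b) ^+ 2 / (a + b)).
  by field; rewrite gt_eqF.
rewrite normrM [X in X * _]ger0_norm// ler_pM2l// normrM normfV [ `|a + b|]ger0_norm ?(ltW ab)//.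
rewrite ler_pdivrMr// normrX expr2 ler_wpM2l//.
by rewrite ler_norml; lra.
Qed.

(* The arithmetic-harmonic mean iteration converges to the geometric mean. *)
Lemma stieltjes_hull_geometric x y : stieltjes_hull x -> stieltjes_hull y ->
  (forall i, 0 < x 0 i) -> (forall i, 0 < y 0 i) ->
  stieltjes_hull (\row_i Num.sqrt (x 0 i * y 0 i)).
Proof.
move=> Hx Hy x0 y0.
(* Invariants of the iteration: the arithmetic and harmonic means have the same coordinatewise
   product as the original pair, and the gap after [k] steps is at most [2^-k] times the initial
   one. *)
have H k : exists a b : 'rV[R]_n.+1, [/\ stieltjes_hull a, stieltjes_hull b &
    forall i, [/\ 0 < a 0 i, 0 < b 0 i, a 0 i * b 0 i = x 0 i * y 0 i &
      `|a 0 i - b 0 i| <= 2^-1 ^+ k * `|x 0 i - y 0 i|]].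
  elim: k => [|k [a [b [Ha Hb ab]]]].
    by exists x, y; split=> // i; rewrite expr0 mul1r; split.
  exists (2^-1 *: (a + b)), (\row_i (2 * (a 0 i * b 0 i / (a 0 i + b 0 i)))).
  split; first exact: stieltjes_hull_midpoint.
    by apply: stieltjes_hull_harmonic => // i; have [] := ab i.
  move=> i; have [ai bi abi dab] := ab i; have abi0 := addr_gt0 ai bi.
  rewrite !mxE; split.
  - by rewrite mulr_gt0// invr_gt0.
  - by rewrite mulr_gt0// divr_gt0// mulr_gt0.
  - by rewrite -abi; field; rewrite gt_eqF.
  - apply: le_trans (arithmetic_harmonic_step ai bi) _.
    by rewrite exprS -mulrA ler_pM2l.
have closed_geo : closure stieltjes_hull (\row_i Num.sqrt (x 0 i * y 0 i)).
  apply/closure_rVP => e e0.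
  pose s := \sum_i `|x 0 i - y 0 i|.
  have s0 : 0 <= s by rewrite sumr_ge0.
  have [k ks] : exists k, 2^-1 ^+ k * s < e.
    have cv : (fun k => 2^-1 ^+ k * s) @ \oo --> 0 * s.
      by apply: cvgMl; apply: cvg_expr; rewrite ger0_norm// invf_lt1 ?ltr1n.
    rewrite mul0r in cv; have /cvgrPdist_lt /(_ e e0) := cv.
    move=> /filter_ex[k]; rewrite sub0r normrN => h.
    by exists k; exact: le_lt_trans (ler_norm _) h.
  have [a [b [Ha Hb ab]]] := H k; exists a => // i; rewrite mxE.
  have [ai bi <- dab] := ab i.
  have sab : 0 < Num.sqrt (a 0 i * b 0 i) by rewrite sqrtr_gt0 mulr_gt0.
  have sabE : Num.sqrt (a 0 i * b 0 i) ^+ 2 = a 0 i * b 0 i.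
    by rewrite sqr_sqrtr// mulr_ge0// ltW.
  (* The geometric mean of [a] and [b] lies between them, so its distance to [a] is at most the
     gap. *)
  apply: (@le_lt_trans _ _ `|a 0 i - b 0 i|).
    move: sab sabE; set r := Num.sqrt _ => r0 rE.
    move: (a 0 i) (b 0 i) ai bi rE => p q p0 q0 rE.
    have [pq|/ltW pq] := leP p q.
      have pr : p <= r by rewrite leNgt; apply/negP => ?; nra.
      have rq : r <= q by rewrite leNgt; apply/negP => ?; nra.
      by rewrite (distrC p) !ger0_norm; lra.
    have pr : r <= p by rewrite leNgt; apply/negP => ?; nra.
    have rq : q <= r by rewrite leNgt; apply/negP => ?; nra.
    by rewrite distrC !ger0_norm; lra.
  apply: le_lt_trans dab (le_lt_trans _ ks).
  rewrite ler_wpM2l ?exprn_ge0// /s (bigD1 i)//= lerDl sumr_ge0//.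
by have /closure_id -> := closed_stieltjes_hull.
Qed.

(** In logarithmic coordinates geometric means become midpoints, which is the form that
    [closed_convex_integral] accepts. *)
Definition log_stieltjes_hull : set 'rV[R]_n.+1 :=
  [set x | stieltjes_hull (\row_i expR (x 0 i))].

Lemma closed_log_stieltjes_hull : closed log_stieltjes_hull.
Proof.
apply/(closure_id _).2; apply/seteqP; split; first exact: subset_closure.
move=> x /closure_rV_seq[u Lu ux]; rewrite /log_stieltjes_hull/=.
have /closure_id -> := closed_stieltjes_hull; apply/closure_rVP => e e0.
have : \forall k \near \oo, forall i, `|expR (x 0 i) - expR (u k 0 i)| < e.
  apply: filter_forall => i.
  have /cvgrPdist_lt : (fun k => expR (u k 0 i)) @ \oo --> expR (x 0 i).
    by apply: continuous_cvg (ux i); exact: continuous_expR.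
  exact.
move=> /filter_ex[k uk]; exists (\row_i expR (u k 0 i)); first exact: Lu.
by move=> i; rewrite !mxE; exact: uk.
Qed.

Lemma log_stieltjes_hull_midpoint : midpoint_convex log_stieltjes_hull.
Proof.
move=> x y; rewrite /log_stieltjes_hull/= => Hx Hy.
have e0 (z : 'rV[R]_n.+1) i : 0 < (\row_j expR (z 0 j)) 0 i.
  by rewrite mxE expR_gt0.
have := stieltjes_hull_geometric Hx Hy (e0 x) (e0 y).
congr stieltjes_hull; apply/rowP => i; rewrite !mxE -expRD.
rewrite -[RHS]ger0_norm ?expR_ge0// -sqrtr_sqr; congr Num.sqrt.
by rewrite -expRM_natl; congr expR; field.
Qed.

Lemma log_stieltjes_hull0 : log_stieltjes_hull 0.
Proof.
have := stieltjes_hull1; rewrite /log_stieltjes_hull/=.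
by congr stieltjes_hull; apply/rowP => i; rewrite !mxE expR0.
Qed.

End stieltjes_hull.

(** * Compactness *)

(* The kernel [a / (l + a)] in the compact variable [x = a / (1 + a)]. *)
Definition stieltjes_kernel (R : realFieldType) (l x : R) : R :=
  x / (x + l * (1 - x)).

Section stieltjes_kernel.
Context (R : realType) (l : R).
Hypothesis l_gt0 : 0 < l.
Local Notation phi := (stieltjes_kernel l).

Let den_ge x : 0 <= x <= 1 -> Num.min 1 l <= x + l * (1 - x).
Proof.
move=> /andP[x0 x1]; set c := Num.min 1 l.
have c1 : c <= 1 by rewrite ge_min lexx.
have cl : c <= l by rewrite ge_min lexx orbT.
nra.
Qed.

Let c_gt0 : 0 < Num.min 1 l. Proof. by rewrite lt_min ltr01. Qed.

Lemma stieltjes_kernelB x y : 0 <= x <= 1 -> 0 <= y <= 1 ->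
  phi y - phi x = l * (y - x) / ((x + l * (1 - x)) * (y + l * (1 - y))).
Proof.
move=> x01 y01; rewrite /stieltjes_kernel; field.
by rewrite !gt_eqF// (lt_le_trans c_gt0)// den_ge.
Qed.

Lemma stieltjes_kernel_homo x y : 0 <= x -> x <= y -> y <= 1 -> phi x <= phi y.
Proof.
move=> x0 xy y1; rewrite -subr_ge0 stieltjes_kernelB; last 2 first.
- by rewrite x0 (le_trans xy).
- by rewrite y1 (le_trans x0).
have x1 := le_trans xy y1; have y0 := le_trans x0 xy.
by rewrite divr_ge0 ?mulr_ge0 ?subr_ge0 ?addr_ge0 ?mulr_ge0 ?subr_ge0 ?(ltW l_gt0).
Qed.

Lemma stieltjes_kernel0 : phi 0 = 0.
Proof. by rewrite /stieltjes_kernel mul0r. Qed.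

Lemma stieltjes_kernel_lip x y : 0 <= x -> x <= y -> y <= 1 ->
  phi y - phi x <= l / Num.min 1 l ^+ 2 * (y - x).
Proof.
move=> x0 xy y1.
have x01 : 0 <= x <= 1 by rewrite x0 (le_trans xy).
have y01 : 0 <= y <= 1 by rewrite y1 (le_trans x0).
rewrite stieltjes_kernelB// [leRHS]mulrAC ler_wpM2l ?mulr_ge0 ?subr_ge0 ?(ltW l_gt0)//.
have dx := den_ge x01; have dy := den_ge y01.
rewrite lef_pV2 ?posrE ?exprn_gt0//.
  by rewrite expr2 ler_pM// (ltW c_gt0).
by rewrite mulr_gt0// (lt_le_trans c_gt0).
Qed.

Lemma stieltjes_kernel_itv x : 0 <= x <= 1 -> 0 <= phi x <= 1.
Proof.
move=> x01; have /andP[x0 x1] := x01.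
have d0 := lt_le_trans c_gt0 (den_ge x01).
rewrite divr_ge0 ?(ltW d0)//= ler_pdivrMr// mul1r lerDl mulr_ge0 ?subr_ge0//.
exact: ltW.
Qed.

Definition grid_incr N (i : nat) : R := phi (i.+1%:R / N.+1%:R) - phi (i%:R / N.+1%:R).
(** Since the kernel vanishes at 0, integration by parts turns its integral against [m] into that of
    [S] against the increments of the kernel. For nonincreasing [S], left end points give the upper
    sum and right end points the lower one. *)
Definition upper_sum N (S : R -> R) : R :=
  \sum_(i < N.+1) S (i%:R / N.+1%:R) * grid_incr N i.
Definition lower_sum N (S : R -> R) : R :=
  \sum_(i < N.+1) S (i.+1%:R / N.+1%:R) * grid_incr N i.

Let grid0 N i : 0 <= i%:R / N.+1%:R :> R. Proof. by rewrite divr_ge0. Qed.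
Let grid1 N i : (i <= N.+1)%N -> i%:R / N.+1%:R <= 1 :> R.
Proof. by move=> iN; rewrite ler_pdivrMr// mul1r ler_nat. Qed.
Let gridS N i : i%:R / N.+1%:R <= i.+1%:R / N.+1%:R :> R.
Proof. by rewrite ler_pM2r ?invr_gt0// ler_nat. Qed.

Lemma grid_incr_ge0 N (i : 'I_N.+1) : 0 <= grid_incr N i.
Proof. by rewrite subr_ge0 stieltjes_kernel_homo// grid1. Qed.

(** Each increment of the kernel is at most its Lipschitz constant times the mesh, and the
    differences of [S] telescope to at most 1. *)
Lemma upper_lower_sum N (S : R -> R) : {homo S : x y /~ x <= y} ->
  (forall x, 0 <= S x <= 1) ->
  upper_sum N S - lower_sum N S <= l / Num.min 1 l ^+ 2 / N.+1%:R.
Proof.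
move=> dS S01; set K := l / _.
have K0 : 0 <= K by rewrite divr_ge0 ?exprn_ge0// ltW.
rewrite /upper_sum /lower_sum -sumrB.
under eq_bigr do rewrite -mulrBl.
apply: (@le_trans _ _ (\sum_(i < N.+1)
    (S (i%:R / N.+1%:R) - S (i.+1%:R / N.+1%:R)) * (K / N.+1%:R))).
  apply: ler_sum => i _; rewrite ler_wpM2l ?subr_ge0 ?dS//.
  rewrite (le_trans (stieltjes_kernel_lip _ _ _))// ?grid1//.
  by rewrite -mulrBl -natrB// subSnn mul1r.
rewrite -mulr_suml ler_piMl ?(divr_ge0 K0)//.
under eq_bigr do rewrite -[S (_ / _)]opprK [- - _ - _]addrC.
have := telescope_sumr (fun i => - S (i%:R / N.+1%:R)) (leq0n N.+1).
rewrite big_mkord /= => ->; rewrite opprK.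
by have /andP[a _] := S01 (N.+1%:R / N.+1%:R); have /andP[_ b] := S01 (0%:R / N.+1%:R); lra.
Qed.

(** This is the case of a point mass at [q]. The value of [s] at [q] itself is left free, so both
    strict and large survival functions are covered. The increments of the kernel stopped at [q]
    telescope to its value at [q], and are compared term by term. *)
Lemma kernel_sandwich N (q : R) (s : R -> R) : 0 <= q <= 1 ->
  (forall x, 0 <= s x <= 1) -> (forall x, 0 <= x -> x < q -> s x = 1) ->
  (forall x, q < x -> x <= 1 -> s x = 0) ->
  lower_sum N s <= phi q <= upper_sum N s.
Proof.
move=> /andP[q0 q1] s01 s1 s0.
have tele : phi q = \sum_(i < N.+1) (phi (Num.min q (i.+1%:R / N.+1%:R)) -
                                   phi (Num.min q (i%:R / N.+1%:R))).
  have /= := telescope_sumr (fun i => phi (Num.min q (i%:R / N.+1%:R))) (leq0n N.+1).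
  rewrite big_mkord => ->.
  by rewrite divff// min_l// mul0r min_r// stieltjes_kernel0 subr0.
rewrite tele; apply/andP; split; apply: ler_sum => i _.
- have [iq|qi] := leP (i.+1%:R / N.+1%:R) q.
    rewrite (min_r (le_trans _ iq))// ler_piMl ?grid_incr_ge0//.
    by have /andP[] := s01 (i.+1%:R / N.+1%:R).
  rewrite s0 ?grid1// mul0r subr_ge0 stieltjes_kernel_homo//.
    by rewrite le_min q0 grid0.
  by rewrite ge_min lexx.
- have [qi|iq] := leP q (i%:R / N.+1%:R).
    rewrite min_l; last exact: le_trans qi _.
    by rewrite subrr mulr_ge0 ?grid_incr_ge0//; have /andP[] := s01 (i%:R / N.+1%:R).
  rewrite s1// mul1r lerD2r stieltjes_kernel_homo ?grid1//.
    by rewrite le_min q0 grid0.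
  by rewrite ge_min lexx orbT.
Qed.

End stieltjes_kernel.

(* The grid sums encode [h l = \int stieltjes_kernel l dm] for the probability
   [m] on [0, 1] with [S x = m ]x, 1]]. *)
Definition survival_of (R : realType) (h S : R -> R) : Prop :=
  [/\ forall x, 0 <= S x <= 1, {homo S : x y /~ x <= y} &
      forall l, 0 < l -> forall N, lower_sum l N S <= h l <= upper_sum l N S].

Lemma atomic_survival (R : realType) (f : R -> R) : atomic_stieltjes f ->
  exists S, survival_of f S.
Proof.
move=> [n [w [a [w0 a0 w1 fE]]]].
pose x j := a j / (1 + a j).
have a1 j : 0 < 1 + a j by rewrite ltr_pwDl.
have x01 j : 0 <= x j <= 1.
  by rewrite divr_ge0 ?(ltW (a1 j))//= ler_pdivrMr// mul1r lerDr.
pose s (j : 'I_n) (y : R) : R := (y < x j)%R%:R.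
have s01 j y : 0 <= s j y <= 1 by rewrite /s; case: (y < x j); rewrite ?lexx ?ler01.
have sandwich l N j : 0 < l ->
    lower_sum l N (s j) <= a j / (l + a j) <= upper_sum l N (s j).
  move=> l0; have -> : a j / (l + a j) = stieltjes_kernel l (x j).
    have a1j : 1 + a j != 0 by rewrite gt_eqF.
    have e : x j + l * (1 - x j) = (l + a j) / (1 + a j) by rewrite /x; field.
    by rewrite /stieltjes_kernel e invf_div mulrA divfK.
  apply: kernel_sandwich => //.
  - by move=> y _ yx; rewrite /s yx.
  - by move=> y xy _; rewrite /s ltNge (ltW xy).
exists (fun y => \sum_j w j * s j y); split.
- move=> y; rewrite sumr_ge0 => [|j _]; last first.
    by rewrite mulr_ge0//; have /andP[] := s01 j y.
  apply: le_trans w1; apply: ler_sum => j _.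
  by rewrite ler_piMr//; have /andP[] := s01 j y.
- move=> y z yz; apply: ler_sum => j _; rewrite ler_wpM2l// /s.
  by case: (ltP y (x j)) => [yx|xy]; rewrite ?ler0n// (le_lt_trans yz).
- move=> l l0 N; rewrite fE//.
  have lowE : lower_sum l N (fun y => \sum_j w j * s j y) =
      \sum_j w j * lower_sum l N (s j).
    rewrite /lower_sum; under eq_bigr do rewrite mulr_suml.
    rewrite exchange_big; apply: eq_bigr => j _; rewrite mulr_sumr.
    by apply: eq_bigr => i _; rewrite mulrA.
  have uppE : upper_sum l N (fun y => \sum_j w j * s j y) =
      \sum_j w j * upper_sum l N (s j).
    rewrite /upper_sum; under eq_bigr do rewrite mulr_suml.
    rewrite exchange_big; apply: eq_bigr => j _; rewrite mulr_sumr.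
    by apply: eq_bigr => i _; rewrite mulrA.
  rewrite lowE uppE; apply/andP; split; apply: ler_sum => j _; rewrite ler_wpM2l//.
    by have /andP[] := sandwich l N j l0.
  by have /andP[] := sandwich l N j l0.
Qed.

Lemma ler_cvg_filter (R : realFieldType) (T : Type) (F : set_system T)
    (FF : ProperFilter F) (f g : T -> R) (l l' : R) :
  f @ F --> l -> g @ F --> l' -> (forall x, f x <= g x) -> l <= l'.
Proof.
move=> fl gl fg; rewrite -subr_ge0.
apply: (cvgr_to_ge (cvgB gl fl)).
by apply: nearW => x /=; rewrite subr_ge0.
Qed.

Lemma cvg_sumr (R : realType) (T : Type) (F : set_system T) n
    (f : 'I_n -> T -> R) (l : 'I_n -> R) : Filter F ->
  (forall i, f i @ F --> l i) ->
  (fun x => \sum_(i < n) f i x) @ F --> \sum_(i < n) l i.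
Proof.
move=> FF fl; apply: (@cvg_big _ _ +%R 0 xpredT _ _ F) => //.
exact: add_continuous.
Qed.

Lemma ultra_fmap (T V : Type) (f : T -> V) (U : set_system T) :
  UltraFilter U -> UltraFilter (f @ U).
Proof.
move=> UU; have UP := ultra_proper; split; first exact: fmap_proper_filter.
move=> G GP UG; apply/seteqP; split=> // A GA.
have [//|UAC] := in_ultra_setVsetC (f @^-1` A) UU.
have GAC : G (~` A) by apply: UG.
have := @filterI _ G (@filter_filter _ _ GP) _ _ GA GAC.
by rewrite setICr => /(@filter_not_empty _ G GP).
Qed.

(* Helly selection along an ultrafilter of finite sets of points. *)
Lemma hull_survival (R : realType) (h : R -> R) :
  (forall n (lam : 'I_n.+1 -> R), (forall i, 0 < lam i) ->
     stieltjes_hull lam (\row_i h (lam i))) ->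
  exists S, survival_of h S.
Proof.
move=> hullh.
have approx (i : seq R * nat) : exists fS : (R -> R) * (R -> R),
    survival_of fS.1 fS.2 /\
    forall l, l \in i.1 -> 0 < l -> `|h l - fS.1 l| < i.2.+1%:R^-1.
  (* The index [i] asks for precision [1 / (i.2 + 1)] at the points listed in [i.1]. The extra point
     1 makes the list nonempty, as the index type ['I_n.+1] of the hull demands. *)
  pose ls := 1 :: [seq l <- i.1 | 0 < l].
  have ls0 (k : 'I_(size ls).-1.+1) : 0 < nth 1 ls k.
    have : nth 1 ls k \in ls by rewrite mem_nth.
    by rewrite inE => /orP[/eqP->|]; rewrite ?mem_filter// => /andP[].
  have e0 : 0 < i.2.+1%:R^-1 :> R by rewrite invr_gt0.
  have := hullh _ _ ls0; move=> /closure_rVP /(_ _ e0)[y [f sf yf] hy].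
  have [S fS] := atomic_survival sf; exists (f, S); split=> //= l li l0.
  have lls : l \in ls by rewrite inE mem_filter l0 li orbT.
  have k0 : (index l ls < (size ls).-1.+1)%N by rewrite -index_mem in lls.
  by have := hy (Ordinal k0); rewrite yf mxE /= (nth_index 1 lls).
move: approx => /choice[fS fSP].
(* Along this filter every point is eventually listed and the precision tends to 0; an ultrafilter
   refining it keeps both properties. *)
pose Fr : set_system (seq R * nat) := filter_from setT
  (fun i : seq R * nat => [set j : seq R * nat | {subset i.1 <= j.1} /\ (i.2 <= j.2)%N]).
have FF : ProperFilter Fr.
  apply: filter_from_proper; last by move=> i _; exists i; split.
  apply: filter_from_filter; first by exists ([::], 0%N).
  move=> i j _ _; exists (i.1 ++ j.1, maxn i.2 j.2) => // k [/= kl kn]; split.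
    split; last exact: leq_trans (leq_maxl _ _) kn.
    by move=> x xi; apply: kl; rewrite mem_cat xi.
  split; last exact: leq_trans (leq_maxr _ _) kn.
  by move=> x xi; apply: kl; rewrite mem_cat xi orbT.
have [U [UU FU]] := ultraFilterLemma FF.
have UP : ProperFilter U by exact: ultra_proper.
(* Compactness of [[0, 1]] gives the limit at every [x] simultaneously. The grid sums involve
   finitely many values of [S], so the sandwich passes to the limit. *)
have /choice[S SP] : forall x, exists y : R, (fun i => (fS i).2 x) @ U --> y.
  move=> x; have := @segment_compact R 0 1; rewrite compact_ultra => K.
  have [] := K ((fun i => (fS i).2 x) @ U) (ultra_fmap _ UU).
    rewrite /= nbhs_simpl; apply: filterE => i /=; rewrite in_itv/=.
    by have [[/(_ x)]] := fSP i.
  by move=> y [_ yP]; exists y.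
have fcvg l : 0 < l -> (fun i => (fS i).1 l) @ U --> h l.
  move=> l0; apply/cvgrPdist_lt => e e0.
  have [k /= /ltW ke] := filter_ex (near_infty_natSinv_lt (PosNum e0)).
  apply: FU; exists ([:: l], k) => // j [/= lj kj].
  have [_ /(_ l)] := fSP j; rewrite lj ?mem_head// => /(_ isT l0) /lt_le_trans; apply.
  by apply: le_trans ke; rewrite lef_pV2 ?posrE// ler_nat.
have ccst (c : R) : (fun=> c) @ U --> c by exact: cvg_cst.
exists S; split.
- move=> x; apply/andP; split.
    apply: (ler_cvg_filter UP (ccst 0) (SP x)).
    by move=> i; have [[/(_ x)/andP[? ?] _ _] _] := fSP i.
  apply: (ler_cvg_filter UP (SP x) (ccst 1)).
  by move=> i; have [[/(_ x)/andP[? ?] _ _] _] := fSP i.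
- move=> x y xy; apply: (ler_cvg_filter UP (SP x) (SP y)).
  by move=> i; have [[_ dS _] _] := fSP i; exact: dS.
- move=> l l0 N; apply/andP; split.
    have cl : (fun i => lower_sum l N (fS i).2) @ U --> lower_sum l N S.
      by apply: cvg_sumr => i; apply: cvgMl; exact: SP.
    apply: (ler_cvg_filter UP cl (fcvg l l0)).
    by move=> i; have [[_ _ /(_ l l0 N)/andP[? ?]] _] := fSP i.
  have cu : (fun i => upper_sum l N (fS i).2) @ U --> upper_sum l N S.
    by apply: cvg_sumr => i; apply: cvgMl; exact: SP.
  apply: (ler_cvg_filter UP (fcvg l l0) cu).
  by move=> i; have [[_ _ /(_ l l0 N)/andP[? ?]] _] := fSP i.
Qed.

(** The quantile function of a uniform variable has survival function [S] up to values at jumps,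
    which [kernel_sandwich] ignores. Its kernel integral and [h l] then lie between the same lower
    and upper sums, whose distance tends to 0. No regularity of [S] beyond monotonicity enters. *)
Lemma survival_quantile (R : realType) (h S : R -> R) : survival_of h S ->
  exists q : R -> R, [/\ measurable_fun setT q, forall u, 0 <= q u <= 1 &
    forall l, 0 < l ->
      (\int[lebesgue_measure]_(u in `[0%R, 1%R]) (stieltjes_kernel l (q u))%:E =
       (h l)%:E)%E].
Proof.
move=> [S01 dS hS].
(* The alternative [x = 0] keeps the set nonempty when [u > S 0]; the mass missing from [S] thereby
   sits at [x = 0], where the kernel vanishes. *)
pose A u := [set x | 0 <= x <= 1 /\ (x = 0 \/ u <= S x)].
have A0 u : A u 0 by split; [rewrite lexx ler01|left].
have supA u : has_sup (A u).
  by split; [exists 0; exact: A0|exists 1 => x [/andP[_ x1] _]].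
pose q u := sup (A u).
have q01 u : 0 <= q u <= 1.
  apply/andP; split; first exact: (sup_upper_bound (supA u) (A0 u)).
  by apply: sup_le_ub; [exists 0; exact: A0|move=> x [/andP[_ x1] _]].
have qni : {homo q : x y /~ x <= y}.
  move=> u v uv; apply: sup_le => //.
    move=> x [x01 ux]; exists x; split=> //; split=> //.
    by case: ux => [->|ux]; [left|right; exact: le_trans uv ux].
  by exists 0; exact: A0.
pose s u x : R := (u <= S x)%R%:R.
have s1 u x : 0 <= x -> x < q u -> s u x = 1.
  move=> x0 xq; have [y [y01 [y0|uy]] xy] := sup_gt (supA u).1 xq.
    by move: xy; rewrite y0 ltNge x0.
  by rewrite /s (le_trans uy)// dS// ltW.
have s0 u x : q u < x -> x <= 1 -> s u x = 0.
  move=> qx x1; rewrite /s; case: leP => // uS.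
  have : x <= q u.
    apply: (sup_upper_bound (supA u)); split; last by right.
    by rewrite x1 andbT (le_trans _ (ltW qx))//; have /andP[] := q01 u.
  by rewrite leNgt qx.
have s01 u x : 0 <= s u x <= 1 by rewrite /s; case: (u <= S x); rewrite ?lexx ?ler01.
have mI : measurable (`[0, 1]%classic : set R) by exact: measurable_itv.
have int_s x : (\int[lebesgue_measure]_(u in `[0%R, 1%R]) (s u x)%:E = (S x)%:E)%E.
  rewrite (_ : (fun u => _) = EFin \o \1_(`]-oo, S x]%classic : set R)); last first.
    by apply/funext => u /=; rewrite /s indicE mem_setE in_itv.
  have /andP[Sx0 Sx1] := S01 x.
  rewrite integral_indic// (_ : _ `&` _ = `[0, S x]%classic); last first.
    apply/seteqP; split => u /=; rewrite !in_itv/=; first by move=> [-> /andP[->]].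
    by move=> /andP[-> uS]; rewrite uS (le_trans uS).
  rewrite /= lebesgue_measure_itv/= lte_fin oppr0 adde0.
  by case: ltgtP Sx0 => // <-.
exists q; split=> //; first by apply: nonincreasing_measurable => // u v; exact: qni.
move=> l l0.
have incr0 N (i : 'I_N.+1) := grid_incr_ge0 l0 i.
have ms y : measurable_fun (`[0, 1]%classic : set R) (fun u => (s u y)%:E).
  apply/measurable_EFinP; apply: nonincreasing_measurable => // u v uv.
  by rewrite /s; case: (leP v (S y)) => [/(le_trans uv) ->|_]; rewrite ?ler0n.
have mterm N (x : 'I_N.+1 -> R) i : measurable_fun (`[0, 1]%classic : set R)
    (fun u => (s u (x i) * grid_incr l N i)%:E).
  apply/measurable_EFinP; apply: measurable_funM => //.
  by apply/measurable_EFinP; exact: ms.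
have msum N (x : 'I_N.+1 -> R) : measurable_fun (`[0, 1]%classic : set R)
    (fun u => (\sum_(i < N.+1) s u (x i) * grid_incr l N i)%:E).
  apply/measurable_EFinP; apply: measurable_sum => i.
  by apply/measurable_EFinP; exact: mterm.
have int_sum N (x : 'I_N.+1 -> R) :
    (\int[lebesgue_measure]_(u in `[0%R, 1%R])
      (\sum_(i < N.+1) s u (x i) * grid_incr l N i)%:E =
     (\sum_(i < N.+1) S (x i) * grid_incr l N i)%:E)%E.
  under eq_integral do rewrite -sumEFin.
  rewrite ge0_integral_sum//; last 2 first.
  - by move=> i; exact: mterm.
  - move=> i u _; rewrite lee_fin mulr_ge0//; by have /andP[] := s01 u (x i).
  rewrite -sumEFin; apply: eq_bigr => i _.
  under eq_integral do rewrite EFinM.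
  rewrite ge0_integralZr ?lee_fin//; last 2 first.
  - exact: ms.
  - by move=> u _; rewrite lee_fin; have /andP[] := s01 u (x i).
  by rewrite int_s.
have mphi : measurable_fun (`[0, 1]%classic : set R) (fun u => stieltjes_kernel l (q u)).
  apply: nonincreasing_measurable => // u v uv.
  have /andP[qv _] := q01 v; have /andP[_ qu] := q01 u.
  by apply: stieltjes_kernel_homo => //; exact: qni.
have sandwich N u := kernel_sandwich l0 N (q01 u) (s01 u) (s1 u) (s0 u).
pose J := (\int[lebesgue_measure]_(u in `[0%R, 1%R]) (stieltjes_kernel l (q u))%:E)%E.
have phi0 u : 0 <= stieltjes_kernel l (q u).
  by have /andP[] := stieltjes_kernel_itv l0 (q01 u).
have loJ N : ((lower_sum l N S)%:E <= J)%E.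
  rewrite /lower_sum -(int_sum N (fun i => i.+1%:R / N.+1%:R)).
  apply: ge0_le_integral => //=.
  - by move=> u _; rewrite lee_fin sumr_ge0// => i _; rewrite mulr_ge0//;
      have /andP[] := s01 u (i.+1%:R / N.+1%:R).
  - exact: msum.
  - exact/measurable_EFinP.
  - by move=> u _; rewrite lee_fin; have /andP[] := sandwich N u.
have upJ N : (J <= (upper_sum l N S)%:E)%E.
  rewrite /upper_sum -(int_sum N (fun i => i%:R / N.+1%:R)).
  apply: ge0_le_integral => //=.
  - by move=> u _; rewrite lee_fin.
  - exact/measurable_EFinP.
  - exact: msum.
  - by move=> u _; rewrite lee_fin; have /andP[] := sandwich N u.
have Jfin : J \is a fin_num.
  rewrite ge0_fin_numE; last by apply: integral_ge0 => u _; rewrite lee_fin.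
  exact: le_lt_trans (upJ 0%N) (ltry _).
rewrite -/J -(fineK Jfin); congr EFin.
have close N : `|fine J - h l| <= l / Num.min 1 l ^+ 2 / N.+1%:R.
  have a : fine J <= upper_sum l N S by rewrite -lee_fin fineK.
  have b : lower_sum l N S <= fine J by rewrite -lee_fin fineK.
  have /andP[c d] := hS l l0 N.
  have e := upper_lower_sum l0 N dS S01.
  move: a b c d e; move: (upper_sum _ _ _) (lower_sum _ _ _) (fine J) (h l) (_ / _ / _).
  by move=> U L j k B *; rewrite ler_norml; apply/andP; split; lra.
apply/eqP; rewrite -subr_eq0 -normr_le0.
set K := l / _ in close.
have cv : (fun N => K * N.+1%:R^-1) @ \oo --> K * 0 by apply: cvgMr; exact: cvg_harmonic.
rewrite -(mulr0 K); apply: (cvgr_to_ge cv); apply: nearW => N; exact: close.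
Qed.

(** * Power moments *)

Lemma bernoulli_ineq (R : realDomainType) (z : R) N : 0 <= z <= 1 ->
  1 - N%:R * z <= (1 - z) ^+ N.
Proof.
move=> /andP[z0 z1]; elim: N => [|N ih]; first by rewrite mul0r subr0 expr0.
rewrite exprS; apply: (@le_trans _ _ ((1 - z) * (1 - N%:R * z))).
  have : 0 <= N%:R * (z * z) :> R by rewrite !mulr_ge0.
  by rewrite -natr1; move: (N%:R : R) => n; lra.
by rewrite ler_wpM2l// subr_ge0.
Qed.

Lemma bernoulli_ineq_inv (R : realFieldType) (z : R) N : 0 <= z <= 1 ->
  (1 - z) ^+ N * (1 + N%:R * z) <= 1.
Proof.
move=> /andP[z0 z1]; elim: N => [|N ih]; first by rewrite mul0r addr0 expr0 mulr1.
apply: le_trans ih; rewrite exprSr -mulrA ler_wpM2l ?exprn_ge0 ?subr_ge0//.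
have : 0 <= N%:R * (z * z) :> R by rewrite !mulr_ge0.
have : 0 <= z * z by rewrite mulr_ge0.
by rewrite -natr1; move: (N%:R : R) => n; lra.
Qed.

Section power_moments.
Context (R : realType) d (T : measurableType d) (P : probability T R).
Context d' (T' : measurableType d') (P' : probability T' R).
Variables (Y : T -> R) (Y' : T' -> R).
Hypotheses (mY : measurable_fun setT Y) (mY' : measurable_fun setT Y').
Hypotheses (Y01 : forall x, 0 <= Y x <= 1) (Y01' : forall x, 0 <= Y' x <= 1).
Hypothesis YY' : forall l, 0 < l ->
  (\int[P]_x (Y x `^ l)%:E = \int[P']_x (Y' x `^ l)%:E)%E.

Lemma integral_power_binomial l N : 0 < l ->
  (\int[P]_x ((1 - Y x `^ l) ^+ N)%:E = \int[P']_x ((1 - Y' x `^ l) ^+ N)%:E)%E.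
Proof.
move=> l0.
have expand (d0 : measure_display) (X : measurableType d0) (Q : probability X R)
    (Z : X -> R) (mZ : measurable_fun setT Z) (Z01 : forall x, 0 <= Z x <= 1) :
    (\int[Q]_x ((1 - Z x `^ l) ^+ N)%:E =
     \sum_(j < N.+1) ((-1) ^+ j *+ 'C(N, j))%:E * \int[Q]_x ((Z x `^ l) ^+ j)%:E)%E.
  have mZl j : measurable_fun setT (fun x => (Z x `^ l) ^+ j).
    by apply: measurable_funX; exact: (measurableT_comp (measurable_powR l) mZ).
  have iZl j : Q.-integrable setT (fun x => ((Z x `^ l) ^+ j)%:E).
    apply: measurable_bounded_integrable => //.
      exact: le_lt_trans (probability_le1 _ _) (ltry _).
    exists 1; split; [exact: num_real|move=> M M1 x _ /=].
    rewrite ger0_norm ?exprn_ge0 ?powR_ge0//; apply: le_trans (ltW M1).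
    have p1 : 1 `^ l = 1 :> R by rewrite powR1.
    rewrite exprn_ile1 ?powR_ge0// -[leRHS]p1.
    by have /andP[? ?] := Z01 x; rewrite ge0_ler_powR// ?nnegrE// ltW.
  transitivity (\int[Q]_x (\sum_(j < N.+1) ((-1) ^+ j *+ 'C(N, j))%:E * ((Z x `^ l) ^+ j)%:E))%E.
    apply: eq_integral => x _; rewrite exprBn -sumEFin; apply: eq_bigr => j _.
    by rewrite expr1n mulr1 -EFinM mulrnAl.
  rewrite integral_sum//; last by move=> j; exact: integrableZl.
  by apply: eq_bigr => j _; rewrite integralZl.
(* The hypothesis on moments concerns positive exponents. The term of degree 0 agrees because both
   measures have total mass 1. *)
rewrite (expand _ _ P)// (expand _ _ P')//; apply: eq_bigr => -[[|j] jN] _ /=.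
  under eq_integral do rewrite expr0; under [in RHS]eq_integral do rewrite expr0.
  by rewrite !integral_cst//= !probability_setT.
congr (_ * _)%E.
have pw (z : R) : 0 <= z -> (z `^ l) ^+ j.+1 = z `^ (l * j.+1%:R).
  by move=> z0; rewrite powRrM powR_mulrn// powR_ge0.
transitivity (\int[P]_x (Y x `^ (l * j.+1%:R))%:E)%E.
  by apply: eq_integral => x _; rewrite pw//; have /andP[] := Y01 x.
rewrite YY' ?mulr_gt0//.
by apply: eq_integral => x _; rewrite pw//; have /andP[] := Y01' x.
Qed.

(* [(1 - Y^(n l))^(2^n)] tends to the indicator of [Y^l < 1/2]. *)
Lemma power_moments_le y0 y1 : 0 <= y0 -> y0 < y1 -> y1 <= 1 ->
  (P [set x | (Y x <= y0)%R] <= P' [set x | (Y' x <= y1)%R])%E.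
Proof.
move=> y00 y01 y11; pose m := (y0 + y1) / 2.
have y0m : y0 < m by rewrite /m; lra.
have my1 : m < y1 by rewrite /m; lra.
have m0 : 0 < m by exact: le_lt_trans y00 y0m.
have m1 : m < 1 by exact: lt_le_trans my1 y11.
(* This exponent solves [m^l = 1/2]. As [m] lies strictly between the levels,
   [2 y0^l < 1 < 2 y1^l]. *)
pose l := ln 2 / (- ln m).
have lnm : 0 < - ln m by rewrite oppr_gt0 ln_lt0// m0.
have ln2 : 0 < ln 2 :> R by rewrite ln_gt0// ltr1n.
have l0 : 0 < l by rewrite divr_gt0.
have ml : m `^ l = 2^-1.
  have -> : m `^ l = expR (l * ln m) by rewrite /powR gt_eqF.
  have -> : l * ln m = - ln 2.
    by rewrite /l invrN mulrN mulNr divfK// lt_eqF// -oppr_gt0.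
  by rewrite expRN lnK// posrE.
pose r := 2 * y0 `^ l; pose r' := (2 * y1 `^ l)^-1.
have y0l : 0 <= y0 `^ l by exact: powR_ge0.
have r0 : 0 <= r by rewrite /r mulr_ge0.
have r1 : r < 1.
  by rewrite /r -ltr_pdivlMl// mulr1 -ml gt0_ltr_powR// ?nnegrE// ltW.
have r'1 : 0 < r' < 1.
  have h : 2^-1 < y1 `^ l.
    by rewrite -ml gt0_ltr_powR// ?nnegrE ?ltW// (lt_trans m0).
  have h' : 1 < 2 * y1 `^ l by lra.
  by rewrite invr_gt0 invf_lt1 ?h' ?(lt_trans ltr01 h').
pose A := [set x | (Y x <= y0)%R]; pose B := [set x | (Y' x <= y1)%R].
have mA : measurable A.
  by rewrite -[A]setTI; exact: measurable_fun_le.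
have mB : measurable B.
  by rewrite -[B]setTI; exact: measurable_fun_le.
(* With [z = Y^(l (n + 1))] and [N = 2^(n + 1)] one has [N z = (2 Y^l)^(n + 1)]. The two Bernoulli
   bounds then give at least [1 - r^(n + 1)] where [Y <= y0], and at most [r'^(n + 1)] where
   [Y' > y1]. *)
pose f n x := (1 - Y x `^ (l * n.+1%:R)) ^+ (2 ^ n.+1).
pose f' n x := (1 - Y' x `^ (l * n.+1%:R)) ^+ (2 ^ n.+1).
have powE (z : R) n : z `^ (l * n.+1%:R) = (z `^ l) ^+ n.+1.
  by rewrite powRrM powR_mulrn// powR_ge0.
have pow01 (z : R) : 0 <= z <= 1 -> 0 <= z `^ l <= 1.
  have p1 : 1 `^ l = 1 :> R by rewrite powR1.
  move=> /andP[z0 z1]; rewrite powR_ge0/= -[leRHS]p1.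
  by rewrite ge0_ler_powR// ?nnegrE// ltW.
have pown01 (z : R) n : 0 <= z <= 1 -> 0 <= z `^ (l * n.+1%:R) <= 1.
  move=> z01; have /andP[a b] := pow01 _ z01.
  by rewrite powE exprn_ge0//= exprn_ile1.
have fmeas (d0 : measure_display) (X : measurableType d0) (Z : X -> R) n :
    measurable_fun setT Z ->
    measurable_fun setT (fun x => (1 - Z x `^ (l * n.+1%:R)) ^+ (2 ^ n.+1)).
  move=> mZ; apply: measurable_funX; apply: measurable_funB => //.
  exact: (measurableT_comp (measurable_powR _) mZ).
have f01 (z : R) n : 0 <= z <= 1 -> 0 <= (1 - z `^ (l * n.+1%:R)) ^+ (2 ^ n.+1) <= 1.
  move=> z01; have /andP[a b] := pown01 _ n z01.
  by rewrite exprn_ge0 ?subr_ge0//= exprn_ile1// ?subr_ge0// lerBlDr lerDl.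
have low n : ((1 - r ^+ n.+1)%:E * P A <= \int[P]_x (f n x)%:E)%E.
  rewrite -(integral_cst P mA); apply: (@le_trans _ _ (\int[P]_(x in A) (f n x)%:E)%E).
    apply: ge0_le_integral => //=.
    - by move=> x _; rewrite lee_fin subr_ge0 exprn_ile1// ltW.
    - by apply/measurable_EFinP; apply: measurable_funTS; exact: fmeas.
    - move=> x Ax; rewrite lee_fin.
      have YA := pown01 _ n (Y01 x).
      apply: le_trans (bernoulli_ineq (2 ^ n.+1) YA).
      rewrite lerD2l lerN2 powE natrX -exprMn lerXn2r// ?nnegrE ?mulr_ge0 ?powR_ge0//.
      rewrite ler_pM2l// ge0_ler_powR ?nnegrE ?(ltW l0)//.
      by have /andP[] := Y01 x.
  apply: ge0_subset_integral => //.
    by apply/measurable_EFinP; exact: fmeas.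
  by move=> x _; rewrite lee_fin; have /andP[] := f01 _ n (Y01 x).
have upp n : (\int[P']_x (f' n x)%:E <= P' B + (r' ^+ n.+1)%:E)%E.
  have -> : (P' B + (r' ^+ n.+1)%:E = \int[P']_x ((\1_B x)%:E + (cst (r' ^+ n.+1) x)%:E))%E.
    rewrite ge0_integralD//=; last 2 first.
    - by apply/measurable_EFinP; exact: measurable_indic.
    - by move=> x _; rewrite lee_fin exprn_ge0//; have /andP[/ltW] := r'1.
    rewrite integral_indic// setIT integral_cst//=.
    by rewrite probability_setT mule1.
  apply: ge0_le_integral => //=.
  - by move=> x _; rewrite lee_fin; have /andP[] := f01 _ n (Y01' x).
  - by apply/measurable_EFinP; exact: fmeas.
  - apply/measurable_EFinP; apply: measurable_funD => //; exact: measurable_indic.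
  - move=> x _; rewrite -EFinD lee_fin indicE.
    have /andP[f0 f1] := f01 _ n (Y01' x); have /andP[/ltW r'0 _] := r'1.
    have [xB|] := boolP (x \in B).
      by apply: (le_trans f1); rewrite lerDl exprn_ge0.
    rewrite notin_setE /B/= => /negP; rewrite -ltNge => yY.
    have /andP[Y0 Y1] := pown01 _ n (Y01' x).
    have h := bernoulli_ineq_inv (2 ^ n.+1) (pown01 _ n (Y01' x)).
    move: h; rewrite natrX powE -exprMn add0r => h.
    have h1 : 2 * y1 `^ l <= 2 * Y' x `^ l.
      rewrite ler_pM2l// ge0_ler_powR ?nnegrE ?(ltW l0) ?(ltW yY)//.
        by rewrite ltW// (lt_trans m0).
      by have /andP[] := Y01' x.
    have p0 : 0 < (2 * y1 `^ l) ^+ n.+1.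
      by rewrite exprn_gt0// mulr_gt0// powR_gt0// (lt_trans m0).
    rewrite /f' powE /r' exprVn -[leRHS]mul1r ler_pdivlMr//; apply: le_trans h.
    rewrite ler_wpM2l ?exprn_ge0 ?subr_ge0 -?powE//.
    rewrite (le_trans (_ : _ <= (2 * Y' x `^ l) ^+ n.+1)) ?lerDr//.
    by rewrite lerXn2r// ?nnegrE ?mulr_ge0 ?powR_ge0.
have [PAfin PBfin] : P A \is a fin_num /\ P' B \is a fin_num.
  by split; exact: fin_num_measure.
have key n : fine (P A) * (1 - r ^+ n.+1) <= fine (P' B) + r' ^+ n.+1.
  rewrite -lee_fin EFinM [leRHS]EFinD !fineK// muleC.
  apply: le_trans (low n) _; rewrite integral_power_binomial ?(mulr_gt0 l0)//.
  exact: (upp n).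
have c1 : (fun n => fine (P A) * (1 - r ^+ n.+1)) @ \oo --> fine (P A) * (1 - 0).
  apply: cvgMr; apply: cvgB; first exact: cvg_cst.
  by rewrite (cvg_shiftS (fun n => r ^+ n)); apply: cvg_expr; rewrite ger0_norm.
have c2 : (fun n => fine (P' B) + r' ^+ n.+1) @ \oo --> fine (P' B) + 0.
  apply: cvgD; first exact: cvg_cst.
  have /andP[? ?] := r'1.
  by rewrite (cvg_shiftS (fun n => r' ^+ n)); apply: cvg_expr; rewrite ger0_norm// ltW.
rewrite -(fineK PAfin) -(fineK PBfin) lee_fin.
have := ler_cvg_to c1 c2; rewrite subr0 mulr1 addr0; apply.
by apply: nearW => n; exact: key.
Qed.

(** The loss between two levels in [power_moments_le] is absorbed by strict inequalities: [Y < y] is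
    the increasing union of the events [Y <= y - 1 / (k + 1)], and half of the gap [1 / (k + 1)]
    leaves room for a second level below [y]. *)
Lemma power_moments_lt_le y : y <= 1 ->
  (P [set x | (Y x < y)%R] <= P' [set x | (Y' x < y)%R])%E.
Proof.
move=> y1.
have [y0|y0] := leP y 0.
  rewrite (_ : [set x | (Y x < y)%R] = set0) ?measure0//.
  by apply/seteqP; split=> // x /=; have /andP[Y0 _] := Y01 x; rewrite ltNge (le_trans y0).
pose A (k : nat) := [set x | (Y x <= y - k.+1%:R^-1)%R].
have mA k : measurable (A k) by rewrite -[A k]setTI; exact: measurable_fun_le.
have bigA : [set x | (Y x < y)%R] = \bigcup_k A k.
  apply/seteqP; split=> [x /= xy|x [k _] /=].
    have e0 : 0 < y - Y x by rewrite subr_gt0.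
    have [k /= /ltW ke] := filter_ex (near_infty_natSinv_lt (PosNum e0)).
    by exists k => //=; rewrite /A/= lerBrDl -lerBrDr.
  rewrite /A/= => h; apply: (le_lt_trans h).
  by rewrite ltrBlDr ltrDl invr_gt0.
have ndA : nondecreasing_seq A.
  move=> m n mn; apply/subsetPset => x; rewrite /A/= => /le_trans; apply.
  by rewrite lerD2l lerN2 lef_pV2 ?posrE// ler_nat ltnS.
have cA : (P \o A) @ \oo --> P (\bigcup_k A k).
  by apply: nondecreasing_cvg_mu => //; exact: bigcupT_measurable.
rewrite bigA -(cvg_lim _ cA)//; apply: lime_le.
  by apply/cvg_ex; eexists; exact: cA.
apply: nearW => k /=.
have k0 : 0 < k.+1%:R^-1 :> R by rewrite invr_gt0.
have [neg|pos] := ltP (y - k.+1%:R^-1) 0.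
  rewrite (_ : A k = set0) ?measure0//.
  apply/seteqP; split=> // x; rewrite /A/=; have /andP[Y0 _] := Y01 x.
  by move=> /(le_trans Y0); rewrite leNgt neg.
pose z := y - k.+1%:R^-1 / 2.
have zP (e : R) : 0 < e -> y - e / 2 <= 1 /\ y - e / 2 < y /\ y - e < y - e / 2.
  by move=> e0; lra.
have [z1 [zy kz]] := zP _ k0.
apply: (le_trans (power_moments_le pos kz z1)).
apply: le_measure; rewrite ?inE.
- by rewrite -[X in measurable X]setTI; exact: measurable_fun_le.
- under eq_set do rewrite ltNge.
  rewrite -[X in measurable X]setCK; apply: measurableC.
  rewrite (_ : ~` _ = [set x | (y <= Y' x)%R]).
    by rewrite -[X in measurable X]setTI; exact: measurable_fun_le.
  by apply/seteqP; split=> x /=; [move/negP; rewrite negbK|move=> h; rewrite h].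
- by move=> x /= /le_lt_trans; apply.
Qed.

End power_moments.

Lemma power_moments_lt (R : realType) d (T : measurableType d)
    (P : probability T R) d' (T' : measurableType d') (P' : probability T' R)
    (Y : T -> R) (Y' : T' -> R) :
  measurable_fun setT Y -> measurable_fun setT Y' ->
  (forall x, 0 <= Y x <= 1) -> (forall x, 0 <= Y' x <= 1) ->
  (forall l, 0 < l ->
    (\int[P]_x (Y x `^ l)%:E = \int[P']_x (Y' x `^ l)%:E)%E) ->
  forall y, y <= 1 -> P [set x | (Y x < y)%R] = P' [set x | (Y' x < y)%R].
Proof.
move=> mY mY' Y01 Y01' YY' y y1; apply/eqP; rewrite eq_le.
rewrite power_moments_lt_le//= power_moments_lt_le// => l l0.
by rewrite YY'.
Qed.

Definition unif01 (R : realType) : probability (measurableTypeR R) R :=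
  uniform_prob (@ltr01 R).

Lemma integral_powR01 (R : realType) (a : R) : 0 <= a ->
  (\int[lebesgue_measure]_(v in `[0%R, 1%R]) (v `^ a)%:E = ((1 + a)^-1)%:E)%E.
Proof.
move=> a0; have a1 : 0 < a + 1 by rewrite ltr_wpDl.
have powc (b : R) : 0 <= b -> (@powR R ^~ b) @ 0^'+ --> 0 `^ b.
  rewrite le_eqVlt => /predU1P[<-|b0].
    by under eq_fun do rewrite powRr0; rewrite powRr0; exact: cvg_cst.
  by rewrite powR0 ?gt_eqF//; exact: powR_cvg0.
have powd (x b : R) : 0 < x -> derivable (@powR R ^~ b) x 1.
  by move=> x0; apply: derivable_powR; rewrite in_itv/= x0.
have powcc (x b : R) : 0 < x -> {for x, continuous (@powR R ^~ b)}.
  by move=> x0; apply: differentiable_continuous; apply/derivable1_diffP; exact: powd.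
rewrite (@continuous_FTC2 _ _ (fun v => (a + 1)^-1 * v `^ (a + 1)))//.
- by rewrite powR1 powR0 ?gt_eqF// mulr1 mulr0 sube0 addrC.
- apply/continuous_within_itvP => //; split.
  + by move=> x; rewrite in_itv/= => /andP[x0 _]; exact: powcc.
  + exact: powc.
  + by apply: cvg_at_left_filter; exact: powcc.
- split.
  + move=> x; rewrite in_itv/= => /andP[x0 _]; apply: derivableM => //.
    exact: powd.
  + by apply: cvgMr; exact: powc (ltW a1).
  + by apply: cvg_at_left_filter; apply: cvgMr; exact: powcc.
- move=> x; rewrite in_itv/= => /andP[x0 _].
  rewrite derive1Ml; last exact: powd.
  rewrite powR_derive1 ?in_itv/= ?x0// addrK mulrA mulVf ?mul1r// gt_eqF//.
Qed.

(** * Laplace transforms of mixtures of exponential laws *)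

Section exp_neg.
Context (R : realType).

(* The value is 1 at every x <= 0, including -oo where [fine] is 0. *)
Definition exp_neg (x : \bar R) : R :=
  if x == +oo%E then 0 else Num.min 1 (expR (- fine x)).

Lemma exp_neg01 x : 0 <= exp_neg x <= 1.
Proof.
rewrite /exp_neg; case: ifP => _; first by rewrite lexx ler01.
by rewrite le_min ler01 expR_ge0 ge_min lexx.
Qed.

Lemma measurable_exp_neg : measurable_fun setT exp_neg.
Proof.
apply: measurable_fun_ifT => //; first exact: measurable_fun_eqe.
apply: measurable_minr => //; apply: measurableT_comp => //.
exact: measurableT_comp.
Qed.

Lemma exp_negX x l : (0 <= x)%E -> 0 < l ->
  (exp_neg x `^ l)%:E = expeR (- (l%:E * x)).
Proof.
rewrite /exp_neg; case: x => [r| |]//= r0 l0; last first.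
  by rewrite mulry gtr0_sg// mul1e /= powR0// gt_eqF.
rewrite lee_fin in r0.
rewrite min_r -?EFinM ?EFinN /=; last by rewrite -[leRHS]expR0 ler_expR oppr_le0.
by rewrite /powR gt_eqF ?expR_gt0// expRK mulrN.
Qed.

Lemma exp_neg_lt x t : (0 <= x)%E -> 0 <= t ->
  (exp_neg x < expR (- t)) = (t%:E < x)%E.
Proof.
rewrite /exp_neg; case: x => [r| |]//= r0 t0; last by rewrite expR_gt0 ltry.
rewrite lee_fin in r0.
rewrite min_r; last by rewrite -[leRHS]expR0 ler_expR oppr_le0.
by rewrite ltr_expR ltrN2 lte_fin.
Qed.

Lemma exp_neg_ge x l v : (0 <= x)%E -> 0 < l -> 0 < v <= 1 ->
  (v <= exp_neg x `^ l) = (x <= (- ln v / l)%:E)%E.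
Proof.
move=> x0 l0 /andP[v0 v1]; rewrite -lee_fin exp_negX//.
case: x x0 => [r| |]//= r0; last first.
  by rewrite mulry gtr0_sg// mul1e /= lee_fin leNgt v0 leye_eq.
rewrite !lee_fin -{1}(lnK v0) ler_expR ler_pdivlMr// lerNr.
by rewrite mulrC.
Qed.

Lemma measurable_expeR : measurable_fun setT (@expeR R).
Proof.
have -> : @expeR R = fun x => if x == +oo%E then +oo%E else
    (if x == -oo%E then 0 else expR (fine x))%:E.
  by apply/funext => -[r| |].
apply: measurable_fun_ifT => //; first exact: measurable_fun_eqe.
apply/measurable_EFinP; apply: measurable_fun_ifT => //.
  exact: measurable_fun_eqe.
exact: measurableT_comp.
Qed.

End exp_neg.

Section unif01.
Context (R : realType).
Local Notation unif := (unif01 R).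

Lemma integral_unif01 (f : R -> \bar R) : measurable_fun setT f ->
  (forall x, 0 <= f x)%E ->
  (\int[unif]_x f x = \int[lebesgue_measure]_(x in `]0%R, 1%R]) f x)%E.
Proof.
move=> mf f0; rewrite /unif01 integral_uniform// subr0 invr1 mul1e.
by rewrite integral_itv_obnd_cbnd//; exact: measurable_funTS.
Qed.

Lemma unif01_le z : 0 <= z <= 1 ->
  (\int[unif]_v ((v <= z)%R%:R)%:E = z%:E)%E.
Proof.
move=> /andP[z0 z1]; rewrite integral_unif01; last 2 first.
- by apply/measurable_EFinP; apply: measurableT_comp => //; exact: measurable_fun_ler.
- by move=> x; rewrite lee_fin.
rewrite (_ : (fun u => _) = EFin \o \1_(`]-oo, z]%classic : set R)); last first.
  by apply/funext => u /=; rewrite indicE mem_setE in_itv.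
rewrite integral_indic// (_ : _ `&` _ = `]0, z]%classic); last first.
  apply/seteqP; split => u /=; rewrite !in_itv/=; first by move=> [-> /andP[->]].
  by move=> /andP[-> uS]; rewrite uS (le_trans uS).
rewrite /= lebesgue_measure_itv/= lte_fin oppr0 adde0.
by case: ltgtP z0 => // <-.
Qed.

Lemma unif01_lt z : 0 <= z <= 1 ->
  (\int[unif]_v ((v < z)%R%:R)%:E = z%:E)%E.
Proof.
move=> /andP[z0 z1]; rewrite integral_unif01; last 2 first.
- by apply/measurable_EFinP; apply: measurableT_comp => //; exact: measurable_fun_ltr.
- by move=> x; rewrite lee_fin.
rewrite (_ : (fun u => _) = EFin \o \1_(`]-oo, z[%classic : set R)); last first.
  by apply/funext => u /=; rewrite indicE mem_setE in_itv.
rewrite integral_indic// (_ : _ `&` _ = `]0, z[%classic); last first.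
  apply/seteqP; split => u /=; rewrite !in_itv/=; first by move=> [-> /andP[->]].
  by move=> /andP[-> uS]; rewrite uS (ltW (lt_le_trans uS _)).
rewrite /= lebesgue_measure_itv/= lte_fin oppr0 adde0.
by case: ltgtP z0 => // <-.
Qed.

Lemma unif01_powR a : 0 <= a -> (\int[unif]_v (v `^ a)%:E = ((1 + a)^-1)%:E)%E.
Proof.
move=> a0; rewrite /unif01 integral_uniform ?subr0 ?invr1 ?mul1e ?integral_powR01//.
- by apply/measurable_EFinP.
- by move=> v; rewrite lee_fin powR_ge0.
Qed.

End unif01.

Section mixture_laplace.
Context (R : realType).
Local Notation unif := (unif01 R).

(** Laplace transform at [l] of the exponential law of rate [x], the rate [+oo] standing for the
    atom at 0. *)
Definition ekernel (l : R) (x : \bar R) : R :=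
  if x is r%:E then r / (l + r) else 1.

(** The time [t] with [exp(- l t) = v]: for [0 < v <= 1] the event [v <= exp(- l X)] is
    [X <= log_time l v]. The maximum keeps it a non-negative time for every real [v]. *)
Definition log_time (l v : R) : R := Num.max 0 (- ln v / l).

Lemma measurable_log_time l : measurable_fun setT (log_time l).
Proof.
apply: measurable_maxr => //; apply: measurable_funM => //.
by apply: measurableT_comp => //; exact: measurable_ln.
Qed.

Lemma exp_cdf_ge0 t (x : \bar R) : 0 <= t -> (0 < x)%E -> (0 <= exp_cdf t x)%E.
Proof.
move=> t0; case: x => [r| |]//= r0; rewrite lee_fin subr_ge0 -expR0 ler_expR.
by rewrite oppr_le0 mulr_ge0// -lee_fin ltW.
Qed.

Lemma measurable_exp_cdf d (T : measurableType d) (f : T -> R) (g : T -> \bar R) :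
  measurable_fun setT f -> measurable_fun setT g ->
  measurable_fun setT (fun z => exp_cdf (f z) (g z)).
Proof.
move=> mf mg.
have -> : (fun z => exp_cdf (f z) (g z)) = fun z =>
    (if (g z == +oo%E) || (g z == -oo%E) then 1 else 1 - expR (- (f z * fine (g z))))%:E.
  by apply/funext => z; case: (g z).
apply/measurable_EFinP; apply: measurable_fun_ifT => //.
  by apply: measurable_or; exact: measurable_fun_eqe.
apply: measurable_funB => //; apply: measurableT_comp => //.
apply: measurableT_comp => //; apply: measurable_funM => //.
exact: measurableT_comp.
Qed.

(** At [t = - ln v / l] the survival probability [exp(- t r)] is [v^(r / l)], whose integral over
    [[0, 1]] is [l / (l + r)]. *)
Lemma integral_exp_cdf l x : 0 < l -> (0 < x)%E ->
  (\int[unif]_v exp_cdf (log_time l v) x = (ekernel l x)%:E)%E.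
Proof.
move=> l0 x0; have lt0 v : 0 <= log_time l v by rewrite le_max lexx.
rewrite integral_unif01; last 2 first.
- by apply: measurable_exp_cdf => //; exact: measurable_log_time.
- by move=> v; exact: exp_cdf_ge0.
case: x x0 => [r| |]//= r0; last first.
  rewrite integral_cst//= lebesgue_measure_itv/= lte_fin ltr01 oppr0 adde0 mule1.
  by [].
rewrite lte_fin in r0; have a0 : 0 <= r / l by rewrite divr_ge0// ltW.
transitivity (\int[lebesgue_measure]_(v in `]0%R, 1%R]) ((1 - v `^ (r / l))%:E))%E.
  apply: eq_integral => v; rewrite inE/= in_itv/= => /andP[v0 v1].
  rewrite /log_time max_r; last by rewrite divr_ge0 ?(ltW l0)// oppr_ge0 ln_le0.
  by rewrite /powR gt_eqF//; congr (1 - expR _)%:E; field; rewrite gt_eqF.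
rewrite integral_itv_obnd_cbnd; last first.
  apply/measurable_EFinP; apply: measurable_funB => //.
  by apply: measurable_funTS; exact: measurable_powR.
have mu01 : (lebesgue_measure (`[0%R, 1%R]%classic : set R) < +oo)%E.
  by rewrite lebesgue_measure_itv/= lte_fin ltr01 oppr0 adde0 ltry.
have bnd (f : R -> R) : measurable_fun (`[0, 1]%classic : set R) f ->
    (forall v, 0 <= v <= 1 -> 0 <= f v <= 1) ->
    lebesgue_measure.-integrable `[0, 1] (EFin \o f).
  move=> mf f01; apply: measurable_bounded_integrable => //.
  exists 1; split; [exact: num_real|move=> M M1 v /=; rewrite in_itv/= => v01].
  by have /andP[? ?] := f01 _ v01; rewrite ger0_norm// (le_trans _ (ltW M1)).
have I1 : lebesgue_measure.-integrable `[0, 1] (EFin \o (fun=> 1 : R)).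
  by apply: bnd => // v _; rewrite ler01 lexx.
have I2 : lebesgue_measure.-integrable `[0, 1] (EFin \o (fun v : R => v `^ (r / l))).
  apply: bnd; first by apply: measurable_funTS; exact: measurable_powR.
  move=> v /andP[v0 v1]; rewrite powR_ge0/=.
  have p1 : 1 `^ (r / l) = 1 :> R by rewrite powR1.
  by rewrite -[leRHS]p1 ge0_ler_powR ?nnegrE.
rewrite integralB_EFin// integral_powR01// integral_cst//=.
rewrite lebesgue_measure_itv/= lte_fin ltr01 oppr0 adde0 mule1 -EFinB.
congr EFin; field; rewrite !gt_eqF ?addr_gt0//.
Qed.

End mixture_laplace.

Lemma measurable_egt0 (R : realType) : measurable [set x : \bar R | (0 < x)%E].
Proof.
rewrite -[X in measurable X]setTI.
by apply: measurable_lte.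
Qed.

Lemma measure_indic (R : realType) d (T : measurableType d)
    (mu : {measure set T -> \bar R}) (A : set T) : measurable A ->
  mu A = (\int[mu]_x (\1_A x)%:E)%E.
Proof. by move=> mA; rewrite integral_indic// setIT. Qed.

(** * From mixtures of exponential laws to Laplace transforms *)

Section laplace_of_ME.
Context (R : realType) d (Omega : measurableType d) (P : probability Omega R).
Variable X : {RV P >-> \bar R}.
Hypothesis X_ge0 : {ae P, forall w, (0 <= X w)%E}.
Local Notation unif := (unif01 R).

Lemma measurable_exp_neg_RV : measurable_fun setT (fun w => exp_neg (X w)).
Proof. by apply: measurableT_comp; [exact: measurable_exp_neg|]. Qed.

(** Powers of a variable with values in [[0, 1]] are the form in which moments are compared. The
    integrands agree only where [X] is non-negative, hence almost everywhere. *)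
Lemma laplace_exp_neg l : 0 < l ->
  (\int[P]_w expeR (- (l%:E * X w)) = \int[P]_w (exp_neg (X w) `^ l)%:E)%E.
Proof.
move=> l0; apply: ge0_ae_eq_integral => //.
- apply: measurableT_comp; first exact: measurable_expeR.
  apply: measurableT_comp => //.
  apply: emeasurable_funM => //.
- apply/measurable_EFinP.
  exact: (measurableT_comp (measurable_powR l) measurable_exp_neg_RV).
- by move=> w _; exact: expeR_ge0.
- by move=> w _; rewrite lee_fin powR_ge0.
- by apply: filterS X_ge0 => w X0 _; rewrite exp_negX.
Qed.

Let measurable_fun_pow_ge l :
  measurable_fun setT (fun z : Omega * R => ((z.2 <= exp_neg (X z.1) `^ l)%R%:R : R)).
Proof.
apply: measurableT_comp => //; apply: measurable_fun_ler => //.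
apply: (measurableT_comp (measurable_powR l)).
exact: (measurableT_comp measurable_exp_neg_RV measurable_fst).
Qed.

Lemma real_lawE (B : set R) : measurable B ->
  real_law X B = P (X @^-1` (EFin @` B)).
Proof. by []. Qed.

Lemma real_law_itv t : 0 <= t ->
  real_law X `[0, t]%classic = P [set w | (X w <= t%:E)%E].
Proof.
move=> t0; rewrite real_lawE//.
have mE : measurable ([set x | (x <= t%:E)%E] : set (\bar R)).
  rewrite -[X in measurable X]setTI.
  by apply: measurable_lee.
have mA : measurable (X @^-1` (EFin @` `[0, t]%classic)).
  rewrite -[X in measurable X]setTI; apply: (measurable_funPT X) => //.
  by apply: measurable_image_EFin; exact: measurable_itv.
have mB : measurable (X @^-1` [set x | (x <= t%:E)%E]).
  by rewrite -[X in measurable X]setTI; exact: (measurable_funPT X).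
rewrite (measure_indic P mA) [RHS](measure_indic P mB).
apply: ge0_ae_eq_integral => //.
- by apply/measurable_EFinP; exact: measurable_indic.
- by apply/measurable_EFinP; exact: measurable_indic.
- apply: filterS X_ge0 => w X0 _; congr (_%:E); rewrite !indicE; congr (_%:R).
  congr nat_of_bool; apply/idP/idP; rewrite !inE/=.
    by move=> [r /=]; rewrite in_itv/= => /andP[_ rt] <-; rewrite lee_fin.
  move: X0; case: (X w) => [r| |]//=; rewrite !lee_fin => r0 rt.
  by exists r => //; rewrite in_itv/= r0.
Qed.

(** Layer cake: the mean of [exp(- l X)] is the integral over [v] of the probability of
    [X <= log_time l v]. [ME] expresses this distribution function through [rho], and Tonelli's
    theorem reduces the claim to a single rate. *)
Lemma ME_laplace : ME (real_law X) ->
  exists rho : subprobability (\bar R) R, forall l, 0 < l ->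
    (\int[P]_w expeR (- (l%:E * X w)) =
     \int[rho]_(x in [set x | (0 < x)%E]) (ekernel l x)%:E)%E.
Proof.
move=> [_ [rho _ cdf]]; exists rho => l l0; rewrite laplace_exp_neg//.
have pow01 w : 0 <= exp_neg (X w) `^ l <= 1.
  have /andP[a b] := exp_neg01 (X w).
  have p1 : 1 `^ l = 1 :> R by rewrite powR1.
  by rewrite powR_ge0 -[leRHS]p1 ge0_ler_powR ?nnegrE// ltW.
transitivity (\int[P]_w \int[unif]_v ((v <= exp_neg (X w) `^ l)%R%:R)%:E)%E.
  by apply: eq_integral => w _; rewrite unif01_le.
pose f (z : Omega * measurableTypeR R) := ((z.2 <= exp_neg (X z.1) `^ l)%R%:R : R)%:E.
have mf : measurable_fun setT f.
  by apply/measurable_EFinP; exact: measurable_fun_pow_ge.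
have f0 z : (0 <= f z)%E by rewrite lee_fin.
rewrite (fubini_tonelli f mf f0).
pose k (z : \bar R * measurableTypeR R) :=
  if (0 < z.1)%E then exp_cdf (log_time l z.2) z.1 else 0%E.
have lt0 v : 0 <= log_time l v by rewrite le_max lexx.
have k0 z : (0 <= k z)%E by rewrite /k; case: ifP => // z0; exact: exp_cdf_ge0.
have mk : measurable_fun setT k.
  apply: measurable_fun_ifT => //; first exact: measurable_fun_lte.
  apply: measurable_exp_cdf => //; apply: measurableT_comp => //.
  exact: measurable_log_time.
transitivity (\int[unif]_v \int[rho]_x k (x, v))%E.
  rewrite [LHS]integral_unif01; last 2 first.
  - exact: (@measurable_fun_fubini_tonelli_G _ _ _ _ _ P f mf f0).
  - by move=> v; apply: integral_ge0 => w _; rewrite lee_fin.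
  rewrite [RHS]integral_unif01; last 2 first.
  - exact: (@measurable_fun_fubini_tonelli_G _ _ _ _ _ rho k mk k0).
  - by move=> v; exact: integral_ge0.
  apply: eq_integral => v; rewrite inE/= in_itv/= => /andP[v0 v1].
  have -> : (\int[rho]_x k (x, v) = real_law X `[0%R, log_time l v]%classic)%E.
    rewrite cdf// [RHS]integral_mkcond; apply: eq_integral => x _.
    by rewrite patchE /k/= mem_setE.
  rewrite real_law_itv//.
  have mB : measurable (X @^-1` [set x | (x <= (log_time l v)%:E)%E]).
    rewrite -[X in measurable X]setTI; apply: (measurable_funPT X) => //.
    by rewrite -[X in measurable X]setTI; apply: measurable_lee.
  rewrite [RHS](measure_indic P mB).
  apply: ge0_ae_eq_integral => //.
  - apply/measurable_EFinP.
    exact: (measurableT_comp (measurable_fun_pow_ge l) (measurable_pair2 v)).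
  - by apply/measurable_EFinP; exact: measurable_indic.
  - apply: filterS X_ge0 => w X0 _; congr (_%:E); rewrite indicE; congr (_%:R).
    congr nat_of_bool; rewrite exp_neg_ge ?v0// mem_setE.
    rewrite /log_time max_r// divr_ge0 ?(ltW l0)// oppr_ge0 ln_le0//.
rewrite -(fubini_tonelli k mk k0) [RHS]integral_mkcond.
apply: eq_integral => x _; rewrite patchE.
have [x0|x0] := boolP (0%R < x)%E.
  by rewrite mem_set// -(integral_exp_cdf l0 x0); apply: eq_integral => v _; rewrite /k/= x0.
rewrite memNset; last exact/negP.
rewrite -[RHS](integral0 unif setT); apply: eq_integral => v _.
by rewrite /k/= (negbTE x0).
Qed.

End laplace_of_ME.

Section positive_part.
Context (R : realType) (m : probability (\bar R) R).

(** A rate 0 stands for mass of the variable at [+oo], which [real_law] drops; the mixing measure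
    must accordingly lose its mass at 0. *)
Definition positive_part : set (\bar R) -> \bar R := mrestr m (@measurable_egt0 R).

HB.instance Definition _ := Measure.on positive_part.

Let positive_part_setT : (positive_part setT <= 1)%E.
Proof.
rewrite /positive_part /mrestr.
exact: probability_le1 (measurableI _ _ measurableT (@measurable_egt0 R)).
Qed.

HB.instance Definition _ :=
  Measure_isSubProbability.Build _ _ _ positive_part positive_part_setT.

Lemma positive_part_le0 : positive_part [set x | (x <= 0)%E] = 0%E.
Proof.
rewrite /positive_part /mrestr (_ : _ `&` _ = set0) ?measure0//.
by apply/seteqP; split=> // x [/= + x0]; rewrite leNgt x0.
Qed.

Lemma integral_positive_part (f : \bar R -> \bar R) :
  (\int[positive_part]_(x in [set x | 0 < x]) f x = \int[m]_(x in [set x | 0 < x]) f x)%E.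
Proof.
apply: eq_measure_integral => A mA A0; rewrite /positive_part /mrestr; congr (m _).
by apply/setIidPl.
Qed.

End positive_part.

Lemma measurable_fun_inv (R : realType) d (T : measurableType d) (f : T -> R) :
  measurable_fun setT f -> measurable_fun setT (fun z => (f z)^-1).
Proof.
move=> mf.
have -> : (fun z => (f z)^-1) = fun z =>
    if 0 <= f z then f z `^ (-1) else - ((- f z) `^ (-1)).
  apply/funext => z; case: ifPn => [f0|]; first by rewrite powR_inv1.
  by rewrite -ltNge => f0; rewrite powR_inv1 ?oppr_ge0 ?(ltW f0)// invrN opprK.
apply: measurable_fun_ifT; first exact: measurable_fun_ler.
  exact: (measurableT_comp (measurable_powR _) mf).
apply: measurableT_comp => //; apply: (measurableT_comp (measurable_powR _)).
exact: measurableT_comp.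
Qed.

Lemma measurable_fun_powR2 (R : realType) d (T : measurableType d) (f g : T -> R) :
  measurable_fun setT f -> measurable_fun setT g ->
  measurable_fun setT (fun z => f z `^ g z).
Proof.
move=> mf mg; rewrite /powR.
apply: measurable_fun_ifT => //; first exact: measurable_fun_eqr.
  by apply: measurableT_comp => //; exact: measurable_fun_eqr.
apply: measurableT_comp => //; apply: measurable_funM => //.
by apply: measurableT_comp => //; exact: measurable_ln.
Qed.

(** Inverse of [a |-> a / (1 + a)]. At [x = 1] the convention on division by 0 would give the rate 0
    instead of [+oo]. *)
Definition rate_of (R : realType) (x : R) : \bar R :=
  if x == 1 then +oo%E else (x / (1 - x))%:E.

Lemma measurable_rate_of (R : realType) : measurable_fun setT (@rate_of R).
Proof.
apply: measurable_fun_ifT => //; first exact: measurable_fun_eqr.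
apply/measurable_EFinP; apply: measurable_funM => //.
by apply: measurable_fun_inv; exact: measurable_funB.
Qed.

(** * From Laplace transforms back to mixtures of exponential laws *)

Section quantile_ME.
Context (R : realType) d (Omega : measurableType d) (P : probability Omega R).
Variable X : {RV P >-> \bar R}.
Hypothesis X_ge0 : {ae P, forall w, (0 <= X w)%E}.
Local Notation unif := (unif01 R).
Variable q : R -> R.
Hypotheses (mq : measurable_fun setT q) (q01 : forall u, 0 <= q u <= 1).
Hypothesis XqE : forall l, 0 < l ->
  (\int[P]_w expeR (- (l%:E * X w)) = \int[unif]_u (stieltjes_kernel l (q u))%:E)%E.

(** A uniform variable lies in [[0, 1]] only almost surely, whereas the comparison of power moments
    asks for this bound everywhere. *)
Let clamp (v : R) : R := Num.min 1 (Num.max 0 v).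
(* For uniform [v], the law of [- ln] of this variable is exponential with rate
   [rate_of (q u)]. *)
Let Y (z : measurableTypeR R * measurableTypeR R) : R :=
  if q z.1 == 0 then 0 else clamp z.2 `^ ((1 - q z.1) / q z.1).

Let clamp01 v : 0 <= clamp v <= 1.
Proof. by rewrite /clamp le_min ler01 le_max lexx/= ge_min lexx. Qed.

Let pow01 (z p : R) : 0 <= z <= 1 -> 0 <= p -> 0 <= z `^ p <= 1.
Proof.
move=> /andP[z0 z1] p0; have p1 : 1 `^ p = 1 :> R by rewrite powR1.
by rewrite powR_ge0 -[leRHS]p1 ge0_ler_powR ?nnegrE.
Qed.

Let mclamp : measurable_fun setT clamp.
Proof. by apply: measurable_minr => //; exact: measurable_maxr. Qed.

Let Y01 z : 0 <= Y z <= 1.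
Proof.
rewrite /Y; case: ifP => _; first by rewrite lexx ler01.
have /andP[a b] := q01 z.1.
by rewrite pow01 ?clamp01// divr_ge0// subr_ge0.
Qed.

Let mY : measurable_fun setT Y.
Proof.
have mq1 : measurable_fun setT (fun z : measurableTypeR R * measurableTypeR R => q z.1).
  exact: measurableT_comp.
apply: measurable_fun_ifT => //; first exact: measurable_fun_eqr.
apply: measurable_fun_powR2.
  exact: (measurableT_comp mclamp measurable_snd).
apply: measurable_funM; first exact: measurable_funB.
exact: measurable_fun_inv.
Qed.

Let expY l : 0 < l -> (\int[P]_w (exp_neg (X w) `^ l)%:E =
   \int[unif \x unif]_z (Y z `^ l)%:E)%E.
Proof.
move=> l0; rewrite -laplace_exp_neg// XqE//.
have mYl : measurable_fun setT (fun z => (Y z `^ l)%:E).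
  by apply/measurable_EFinP; exact: (measurableT_comp (measurable_powR l) mY).
have Yl0 z : (0 <= (Y z `^ l)%:E)%E by rewrite lee_fin powR_ge0.
rewrite (fubini_tonelli1 _ mYl Yl0).
apply: eq_integral => u _; rewrite /fubini_F /Y/=.
have /andP[a b] := q01 u.
(* Rate 0 is the infinite waiting time, so [Y] is 0 there; the formula would give 1, as division by
   0 yields the exponent 0. Otherwise [p] is the inverse rate [1 / a], and the integral of [v^(p l)]
   is [1 / (1 + p l) = a / (l + a)]. *)
have [q0|q0] := eqVneq (q u) 0.
  rewrite q0 stieltjes_kernel0 -[LHS](integral0 unif setT).
  by apply: eq_integral => v _; rewrite powR0// gt_eqF.
have qgt0 : 0 < q u by rewrite lt0r q0.
set p := (1 - q u) / q u; have p0 : 0 <= p by rewrite divr_ge0 ?subr_ge0.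
have -> : stieltjes_kernel l (q u) = (1 + p * l)^-1.
  rewrite /stieltjes_kernel /p -[LHS]invf_div; congr (_^-1); field; exact: q0.
rewrite -(unif01_powR (mulr_ge0 p0 (ltW l0))).
rewrite integral_unif01; last 2 first.
- by apply/measurable_EFinP; exact: measurable_powR.
- by move=> v; rewrite lee_fin powR_ge0.
rewrite [RHS]integral_unif01; last 2 first.
- apply/measurable_EFinP; apply: (measurableT_comp (measurable_powR l)).
  exact: (measurableT_comp (measurable_powR p) mclamp).
- by move=> v; rewrite lee_fin powR_ge0.
apply: eq_integral => v; rewrite inE/= in_itv/= => /andP[v0 v1].
by rewrite /clamp max_r ?(ltW v0)// min_r// powRrM.
Qed.

(** For a finite positive rate [r], [v^(1 / r) < exp(- t)] means [v < exp(- t r)]. Rate 0 makes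
    [Y = 0], always below the level; rate [+oo] makes [Y = 1], never below it. *)
Let cdfY t u : 0 <= t ->
  (\int[unif]_v ((Y (u, v) < expR (- t))%R%:R)%:E =
   1 - (if q u == 0%R then 0 else exp_cdf t (rate_of (q u))))%E.
Proof.
move=> t0; have e1 : expR (- t) <= 1 by rewrite -[leRHS]expR0 ler_expR oppr_le0.
have /andP[a b] := q01 u; rewrite /Y/=.
have [q0|q0] := eqVneq (q u) 0.
  under eq_integral do rewrite expR_gt0.
  by rewrite integral_cst//= probability_setT mul1e sube0.
have qgt0 : 0 < q u by rewrite lt0r q0.
rewrite /rate_of; have [q1|q1] := eqVneq (q u) 1.
  rewrite /= subee// q1 subrr mul0r -[RHS](integral0 unif setT).
  by apply: eq_integral => v _; rewrite powRr0 ltNge e1.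
have qlt1 : q u < 1 by rewrite lt_neqAle q1.
set r := q u / (1 - q u); have r0 : 0 < r by rewrite divr_gt0// subr_gt0.
have -> : (1 - q u) / q u = r^-1 by rewrite /r invf_div.
rewrite /= -EFinB opprB addrCA subrr addr0.
have e01 : 0 <= expR (- (t * r)) <= 1.
  by rewrite expR_ge0 -[leRHS]expR0 ler_expR oppr_le0 mulr_ge0// ltW.
rewrite -(unif01_lt e01).
have mlt (f g : R -> R) : measurable_fun setT f -> measurable_fun setT g ->
    measurable_fun setT (fun v => ((f v < g v)%R%:R : R)%:E).
  move=> mf mg; apply/measurable_EFinP; apply: measurableT_comp => //.
  exact: measurable_fun_ltr.
rewrite [LHS]integral_unif01; last 2 first.
- by apply: mlt => //; exact: (measurableT_comp (measurable_powR _) mclamp).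
- by move=> v; rewrite lee_fin.
rewrite [RHS]integral_unif01; last 2 first.
- exact: mlt.
- by move=> v; rewrite lee_fin.
apply: eq_integral => v; rewrite inE/= in_itv/= => /andP[v0 v1].
rewrite /clamp max_r ?(ltW v0)// min_r//.
have -> : v `^ r^-1 = expR (r^-1 * ln v) by rewrite /powR gt_eqF.
rewrite -{2}(lnK v0) !ltr_expR; congr ((_ : bool)%:R)%:E.
by rewrite mulrC ltr_pdivrMr// mulNr.
Qed.

(** Equal power moments give [exp_neg X] and [Y] the same probability of being below [exp(- t)]. For
    [X] this event is [X > t], so the distribution function of [X] is the mean of [exp_cdf t] at the
    random rate [rate_of (q u)], whose law is the mixing measure. *)
Lemma quantile_ME : ME (real_law X).
Proof.
have mrq : measurable_fun setT (fun u => rate_of (q u)).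
  by apply: measurableT_comp => //; exact: measurable_rate_of.
split.
  have mA : measurable (EFin @` (`]-oo, 0[%classic : set R)).
    by apply: measurable_image_EFin; exact: measurable_itv.
  have mXA : measurable (X @^-1` (EFin @` `]-oo, 0[%classic)).
    by rewrite -[X in measurable X]setTI; exact: (measurable_funPT X).
  rewrite -[LHS]/(P (X @^-1` (EFin @` `]-oo, 0[%classic))) (measure_indic P mXA) -(integral0 P setT).
  apply: ge0_ae_eq_integral => //.
  - by apply/measurable_EFinP; exact: measurable_indic.
  - apply: filterS X_ge0 => w X0 _; rewrite indicE memNset//= => -[r /=].
    by rewrite in_itv/= => r0 rX; move: X0; rewrite -rX lee_fin leNgt r0.
pose mixin := isMeasurableFun.Build _ _ (measurableTypeR R) (\bar R)
  (fun u => rate_of (q u)) mrq.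
pose rq : {mfun measurableTypeR R >-> \bar R} := HB.pack (fun u => rate_of (q u)) mixin.
pose m : probability (\bar R) R := distribution unif rq.
exists (positive_part m); first exact: positive_part_le0.
move=> t t0; rewrite -[LHS]/(real_law X `[0, t]%classic) real_law_itv//.
pose g u := (if q u == 0%R then 0 else exp_cdf t (rate_of (q u)))%E.
have e1 : expR (- t) <= 1 by rewrite -[leRHS]expR0 ler_expR oppr_le0.
have rate_gt0 u : (0 < rate_of (q u))%E = (q u != 0).
  have /andP[a b] := q01 u; rewrite /rate_of.
  have [->|q1] := eqVneq (q u) 1; first by rewrite ltry oner_eq0.
  rewrite lte_fin; have [->|q0] := eqVneq (q u) 0; first by rewrite mul0r ltxx.
  by rewrite divr_gt0// ?subr_gt0 lt_neqAle ?q1// eq_sym q0.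
have mg : measurable_fun setT g.
  apply: measurable_fun_ifT => //; first exact: measurable_fun_eqr.
  exact: measurable_exp_cdf.
have g01 u : (0 <= g u <= 1)%E.
  rewrite /g; case: ifPn => q0; first by rewrite lexx lee_fin ler01.
  rewrite exp_cdf_ge0 ?rate_gt0//=; case: (rate_of _) => [r| |]//=.
  by rewrite lee_fin gerBl expR_ge0.
have muYg : ((unif \x unif) [set z | (Y z < expR (- t))%R] = \int[unif]_u (1 - g u))%E.
  have mYt : measurable_fun setT (fun z => ((Y z < expR (- t))%R%:R : R)%:E).
    apply/measurable_EFinP; apply: measurableT_comp => //.
    exact: measurable_fun_ltr.
  have Yt0 z : (0 <= ((Y z < expR (- t))%R%:R : R)%:E)%E by rewrite lee_fin.
  rewrite measure_indic; last first.
    under eq_set do rewrite -lte_fin.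
    rewrite -[X in measurable X]setTI; apply: measurable_lte => //.
    exact/measurable_EFinP.
  transitivity (\int[unif \x unif]_z ((Y z < expR (- t))%R%:R)%:E)%E.
    by apply: eq_integral => z _; rewrite indicE mem_setE.
  rewrite (fubini_tonelli1 _ mYt Yt0).
  by apply: eq_integral => u _; rewrite /fubini_F cdfY.
have sum1 : (\int[unif]_u (1 - g u) + \int[unif]_u g u = 1)%E.
  rewrite -ge0_integralD//; last 3 first.
  - move=> u _; have /andP[g0 g1] := g01 u; rewrite sube_ge0 ?g1//.
    by rewrite ge0_fin_numE// (le_lt_trans g1 (ltry _)).
  - exact: emeasurable_funB.
  - by move=> u _; have /andP[] := g01 u.
  transitivity (\int[unif]_u (cst 1 u))%E; last first.
    by rewrite integral_cst//= probability_setT mule1.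
  apply: eq_integral => u _; rewrite subeK//.
  have /andP[g0 g1] := g01 u.
  by rewrite ge0_fin_numE//; exact: le_lt_trans g1 (ltry _).
have -> : (\int[positive_part m]_(x in [set x | 0 < x]) exp_cdf t x =
    \int[unif]_u g u)%E.
  rewrite integral_positive_part /m/= ge0_integral_pushforward//.
  - rewrite integral_mkcond; apply: eq_integral => u _; rewrite patchE /g.
    have [q0|q0] := eqVneq (q u) 0.
      by rewrite memNset//=; apply/negP; rewrite rate_gt0 q0 eqxx.
    by rewrite mem_set//= rate_gt0.
  - exact: measurable_egt0.
  - by apply: measurable_funTS; exact: measurable_exp_cdf.
  - by move=> x; rewrite inE => x0; exact: exp_cdf_ge0.
pose A := [set w | (exp_neg (X w) < expR (- t))%R].
have mA : measurable A.
  rewrite /A; under eq_set do rewrite -lte_fin.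
  rewrite -[X in measurable X]setTI; apply: measurable_lte => //.
  by apply/measurable_EFinP; exact: measurable_exp_neg_RV.
have PA : P A = (\int[unif]_u (1 - g u))%E.
  rewrite -muYg; apply: (power_moments_lt (P' := (unif \x unif)%E)) => //.
  - exact: measurable_exp_neg_RV.
  - by move=> w; exact: exp_neg01.
have -> : P [set w | (X w <= t%:E)%E] = P (~` A).
  have mB : measurable (X @^-1` [set x | (x <= t%:E)%E]).
    rewrite -[X in measurable X]setTI; apply: (measurable_funPT X) => //.
    by rewrite -[X in measurable X]setTI; apply: measurable_lee.
  rewrite [LHS](measure_indic P mB) (measure_indic P (measurableC mA)).
  apply: ge0_ae_eq_integral => //.
  - by apply/measurable_EFinP; exact: measurable_indic.
  - by apply/measurable_EFinP; apply: measurable_indic; exact: measurableC.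
  - apply: filterS X_ge0 => w X0 _; congr (_%:E); rewrite !indicE; congr (_%:R).
    congr nat_of_bool; apply/idP/idP; rewrite !inE/= /A/= exp_neg_lt//.
      by move=> Xt; rewrite ltNge Xt.
    by move/negP; rewrite -leNgt.
have PAfin : P A \is a fin_num by exact: fin_num_measure.
rewrite -PA in sum1; rewrite probability_setC//.
by rewrite -[X in (X - _)%E]sum1 addeAC subee// add0e.
Qed.

End quantile_ME.

(** * Mixing over the parameter *)

Lemma measurable_ekernel (R : realType) (l : R) : measurable_fun setT (ekernel l).
Proof.
have -> : ekernel l = fun x => if (x == +oo%E) || (x == -oo%E) then 1
    else fine x / (l + fine x).
  by apply/funext; case.
apply: measurable_fun_ifT => //.
  by apply: measurable_or; exact: measurable_fun_eqe.
apply: measurable_funM => //; apply: measurable_fun_inv.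
exact: measurable_funD.
Qed.

Lemma ekernel01 (R : realType) (l : R) x : 0 < l -> (0 < x)%E ->
  0 <= ekernel l x <= 1.
Proof.
move=> l0; case: x => [r| |]//=; last by rewrite ler01 lexx.
rewrite lte_fin => r0; rewrite divr_ge0 ?(ltW r0) ?(ltW (addr_gt0 l0 r0))//=.
by rewrite ler_pdivrMr ?addr_gt0// mul1r lerDr ltW.
Qed.

(** Finite rates give atomic kernels, the rate [+oo] gives the constant 1, and the point 0 of the
    hull absorbs the mass missing from [rho]; [closed_convex_integral] averages them. *)
Lemma stieltjes_transform_hull (R : realType) (rho : subprobability (\bar R) R)
    n (lam : 'I_n.+1 -> R) : (forall i, 0 < lam i) ->
  stieltjes_hull lam
    (\row_i \int[rho]_(x in [set x | (0 < x)%E]) ekernel (lam i) x).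
Proof.
move=> lam0.
have := @closed_convex_integral R _ _ rho _ _ (stieltjes_hull lam)
  (fun x => \row_i ekernel (lam i) x) (@measurable_egt0 R).
have rho1 : (rho [set x | (0 < x)%E] <= 1)%E.
  apply: (@le_trans _ _ (rho setT)); last exact: sprobability_setT.
  by apply: le_measure; rewrite ?inE//; exact: measurable_egt0.
move=> /(_ rho1 (@closed_stieltjes_hull _ _ lam) (@stieltjes_hull_midpoint _ _ lam)).
move=> /(_ (stieltjes_hull0 lam)).
have -> : \row_i \int[rho]_(x in [set x | (0 < x)%E]) (\row_j ekernel (lam j) x) 0 i =
    \row_i \int[rho]_(x in [set x | (0 < x)%E]) ekernel (lam i) x.
  by apply/rowP => i; rewrite !mxE; apply: eq_Rintegral => x _; rewrite mxE.
apply.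
- move=> [r| |]//= r0.
    rewrite lte_fin in r0.
    exact: (@atomic_stieltjes_hull _ _ lam _ (atomic_stieltjes_kernel (ltW r0))).
  have := stieltjes_hull1 lam0; congr stieltjes_hull.
  by apply/rowP => i; rewrite !mxE.
- move=> i; apply: measurable_bounded_integrable.
  + exact: measurable_egt0.
  + exact: le_lt_trans rho1 (ltry _).
  + have -> : (fun t => (\row_j ekernel (lam j) t) 0 i) = ekernel (lam i).
      by apply/funext => x; rewrite mxE.
    by apply: measurable_funTS; exact: measurable_ekernel.
  + exists 1; split; [exact: num_real|move=> M M1 x /= x0].
    rewrite mxE; have /andP[a b] := ekernel01 (lam0 i) x0.
    by rewrite ger0_norm// (le_trans b)// ltW.
Qed.

Section mixing.
Context (R : realType) (dE : measure_display) (E : measurableType dE).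
Variables (p : probability E R) (W : set E) (mW : measurable W).
Variables (L : R -> E -> R).
Hypothesis iL : forall l, 0 < l -> p.-integrable W (EFin \o L l).
Variable d : E -> measure_display.
Variables (Omega : forall y, measurableType (d y)).
Variables (P : forall y, probability (Omega y) R) (X : forall y, {RV (P y) >-> \bar R}).
Hypothesis X_ge0 : forall y, {ae P y, forall w, (0 <= X y w)%E}.
Hypothesis XL : forall y l, 0 < l ->
  (\int[P y]_w expeR (- (l%:E * X y w)) = (expR (L l y))%:E)%E.
Hypothesis X_ME : forall y, ME (real_law (X y)).

Lemma mixing_ME d' (Omega' : measurableType d') (P' : probability Omega' R)
    (X' : {RV P' >-> \bar R}) :
  {ae P', forall w, (0 <= X' w)%E} ->
  (forall l, 0 < l -> (\int[P']_w expeR (- (l%:E * X' w)) =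
     (expR (\int[p]_(y in W) L l y))%:E)%E) ->
  ME (real_law X').
Proof.
move=> X'0 X'L.
have [] := @hull_survival R (fun l => expR (\int[p]_(y in W) L l y)).
  move=> n lam lam0.
  have := @closed_convex_integral R _ _ p W _ (log_stieltjes_hull lam)
    (fun y => \row_i L (lam i) y) mW (probability_le1 p mW)
    (@closed_log_stieltjes_hull _ _ lam) (@log_stieltjes_hull_midpoint _ _ lam lam0)
    (log_stieltjes_hull0 lam0).
  have hL y : W y -> log_stieltjes_hull lam (\row_i L (lam i) y).
    move=> _; have [rho rhoP] := ME_laplace (X_ge0 y) (X_ME y).
    have := @stieltjes_transform_hull _ rho _ _ lam0; rewrite /log_stieltjes_hull/=.
    congr stieltjes_hull; apply/rowP => i; rewrite !mxE.
    by rewrite /Rintegral -rhoP// XL.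
  have iLi i : p.-integrable W (EFin \o (fun y => (\row_i L (lam i) y) 0 i)).
    rewrite (_ : EFin \o _ = EFin \o L (lam i)); first exact: iL.
    by apply/funext => y; rewrite /= mxE.
  move=> /(_ hL iLi); rewrite /log_stieltjes_hull/=.
  congr stieltjes_hull; apply/rowP => i.
  rewrite !mxE; congr expR; apply: eq_Rintegral => y _; by rewrite mxE.
move=> S /survival_quantile[q [mq q01 qP]].
apply: (quantile_ME X'0 mq q01) => l l0; rewrite X'L// -qP//.
rewrite /unif01 integral_uniform ?subr0 ?invr1 ?mul1e//.
- apply/measurable_EFinP; apply: measurable_funM => //.
  apply: measurable_fun_inv; apply: measurable_funD => //.
  by apply: measurable_funM => //; exact: measurable_funB.
- by move=> u; rewrite lee_fin; have /andP[] := stieltjes_kernel_itv l0 (q01 u).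
Qed.
End mixing.

(** * Campbell formula *)

Lemma nneseries_single (R : realType) (u : nat -> \bar R) k0 :
  (forall k, 0 <= u k)%E -> (forall k, k != k0 -> u k = 0%E) ->
  (\sum_(k <oo) u k = u k0)%E.
Proof.
move=> u0 uk; rewrite nneseries_esumT//.
rewrite (_ : u = fun k => if k \in [set k0] then u k else 0%E); last first.
  by apply/funext => k; rewrite in_set1; case: eqVneq => // /uk.
by rewrite -esum_mkcond esum_set1 ?in_set1 ?eqxx.
Qed.

(** This is the exponential series at [z = m exp(- c)]. The factor [C] carries the remaining factors
    of a product of independent variables. *)
Lemma poisson_laplace_series (R : realType) (m c C : R) : 0 <= m -> 0 <= C ->
  (\sum_(k <oo) ((expR (- (c * k%:R)))%:E * ((m ^+ k / k`!%:R * expR (- m)) * C)%:E) =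
   (expR (- (m * (1 - expR (- c)))) * C)%:E)%E.
Proof.
move=> m0 C0; pose z := m * expR (- c).
have z0 : 0 <= z by rewrite mulr_ge0 ?expR_ge0.
transitivity (\sum_(k <oo) ((C * expR (- m))%:E * (z ^+ k / k`!%:R)%:E))%E.
  apply: eq_eseriesr => k _; rewrite -!EFinM; congr EFin.
  rewrite /z exprMn -expRM_natl.
  have -> : k%:R * - c = - (c * k%:R) by rewrite mulrN mulrC.
  by rewrite -!mulrA; ring.
rewrite nneseriesZl; last first.
  by move=> k _; rewrite lee_fin divr_ge0// exprn_ge0.
have -> : (\sum_(k <oo) (z ^+ k / k`!%:R)%:E = (expR z)%:E)%E.
  rewrite expRE -EFin_lim; last first.
    rewrite /pseries/=; under eq_fun do rewrite mulrC.
    exact: is_cvg_series_exp_coeff.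
  apply/congr_lim/funext => n/=; rewrite /pseries/= /series/= -sumEFin//.
  by under eq_bigr do rewrite mulrC.
rewrite -EFinM; congr EFin; rewrite -mulrA -expRD mulrC; congr (_ * _).
by congr expR; rewrite /z; ring.
Qed.

(** * Laplace transform of independent Poisson counts *)

Section independent_poisson.
Context (R : realType) d (Omega : measurableType d) (P : probability Omega R).
Variables (j : nat) (N : 'I_j -> Omega -> \bar R) (m c : 'I_j -> R).
Hypothesis mN : forall i, measurable_fun setT (N i).
Hypothesis N_nat : forall i w, N i w = +oo%E \/ exists k : nat, N i w = k%:R%:E.
Hypotheses (m_ge0 : forall i, 0 <= m i) (c_gt0 : forall i, 0 < c i).
Hypothesis N_poisson : forall i (k : nat), P [set w | N i w = k%:R%:E] =
  (m i ^+ k / k`!%:R * expR (- m i))%:E.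
Hypothesis N_indep : forall B : 'I_j -> set (\bar R), (forall i, measurable (B i)) ->
  P (\bigcap_i (N i @^-1` B i)) = (\prod_(i < j) P (N i @^-1` B i))%E.

(** Independence is given for events only. At [r = 0] the product is the indicator of an
    intersection, where it applies; at [r = j] it is the product of exponentials that is wanted. *)
Let hybrid (r : nat) (B : 'I_j -> set (\bar R)) (i : 'I_j) (w : Omega) : R :=
  if (i < r)%N then exp_neg ((c i)%:E * N i w) else \1_(B i) (N i w).

Let hybrid_int (r : nat) (B : 'I_j -> set (\bar R)) (i : 'I_j) : R :=
  if (i < r)%N then expR (- (m i * (1 - expR (- c i))))
  else fine (P (N i @^-1` B i)).

Let hybrid_ge0 r B i w : 0 <= hybrid r B i w.
Proof.
rewrite /hybrid; case: ifP => _; last by rewrite indicE ler0n.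
by have /andP[] := exp_neg01 ((c i)%:E * N i w).
Qed.

Let hybrid_int_ge0 r B i : 0 <= hybrid_int r B i.
Proof.
by rewrite /hybrid_int; case: ifP => _; [exact: expR_ge0|exact: fine_ge0].
Qed.

Let mhybrid r B i : (forall i, measurable (B i)) -> measurable_fun setT (hybrid r B i).
Proof.
move=> mB; rewrite /hybrid; case: (i < r)%N.
  apply: (measurableT_comp (@measurable_exp_neg R)).
  by apply: emeasurable_funM => //; exact: measurable_cst.
have m1 : measurable_fun setT (\1_(B i) : \bar R -> R) by exact: measurable_indic.
exact: (measurableT_comp m1 (mN i)).
Qed.

(* The factors are replaced one at a time, expanding each over the values of
   the count. *)
Let integral_hybrid r B : (r <= j)%N -> (forall i, measurable (B i)) ->
  (\int[P]_w (\prod_(i < j) hybrid r B i w)%:E = (\prod_(i < j) hybrid_int r B i)%:E)%E.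
Proof.
elim: r B => [|r IH] B rj mB.
  have mNB i : measurable (N i @^-1` B i).
    by rewrite -[X in measurable X]setTI; exact: mN.
  rewrite (_ : (fun w => _) = EFin \o \1_(\bigcap_i (N i @^-1` B i))); last first.
    apply/funext => w /=; congr EFin; rewrite indicE.
    have [wB|wB] := boolP (w \in _).
      rewrite big1// => i _; rewrite /hybrid ltn0 indicE mem_set//.
      by move: wB; rewrite inE => /(_ i Logic.I).
    have [i wi] : exists i, ~ (N i @^-1` B i) w.
      apply: contrapT => h; move/negP: wB; apply; rewrite inE => i _.
      by apply: contrapT => h'; apply: h; exists i.
    rewrite (bigD1 i)//= /hybrid ltn0 indicE memNset ?mul0r//.
  rewrite integral_indic//; last by apply: fin_bigcap_measurable => // i _; exact: mNB.
  rewrite setIT -[LHS]/(P (\bigcap_i (N i @^-1` B i))) N_indep//.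
  elim/big_ind2 : _ => // [x1 x2 y1 y2 -> ->|i _]; first by rewrite EFinM.
  by rewrite /hybrid_int ltn0 fineK//; exact: fin_num_measure.
pose i0 := Ordinal rj.
pose H w := \prod_(i < j | i != i0) hybrid r.+1 B i w.
pose C := \prod_(i < j | i != i0) hybrid_int r.+1 B i.
have H0 w : 0 <= H w by rewrite prodr_ge0.
have C0 : 0 <= C by rewrite prodr_ge0.
pose B' k i := if i == i0 then [set k%:R%:E : \bar R] else B i.
have mB' k i : measurable (B' k i) by rewrite /B'; case: ifP => // _; exact: emeasurable_set1.
have lt_i0 i : i != i0 -> (i < r.+1)%N = (i < r)%N.
  by move=> ii0; rewrite ltnS leq_eqVlt -[(i == r :> nat)]/(i == i0) (negbTE ii0).
have HB' k w : \prod_(i < j) hybrid r (B' k) i w = \1_[set k%:R%:E] (N i0 w) * H w.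
  rewrite (bigD1 i0)//= /hybrid ltnn /B' eqxx; congr (_ * _).
  by apply: eq_bigr => i ii0; rewrite /hybrid lt_i0// (negbTE ii0).
have CB' k : \prod_(i < j) hybrid_int r (B' k) i = fine (P (N i0 @^-1` [set k%:R%:E])) * C.
  rewrite (bigD1 i0)//= /hybrid_int ltnn /B' eqxx; congr (_ * _).
  by apply: eq_bigr => i ii0; rewrite /hybrid_int lt_i0// (negbTE ii0).
have cgt := c_gt0 i0.
(* The exponential of the count at [i0] is a sum over [k] of [exp(- c k)] times the indicator of
   [N = k], which the induction hypothesis takes as the event at [i0]. Where the count is [+oo],
   both sides vanish since [exp_neg +oo = 0]. *)
transitivity (\int[P]_w (\sum_(k <oo) ((expR (- (c i0 * k%:R)))%:E *
    (\prod_(i < j) hybrid r (B' k) i w)%:E)))%E.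
  apply: eq_integral => w _.
  rewrite (bigD1 i0)//= -/(H w) {1}/hybrid ltnSn.
  have u0 k : (0 <= (expR (- (c i0 * k%:R)))%:E * (\prod_(i < j) hybrid r (B' k) i w)%:E)%E.
    by rewrite -EFinM lee_fin mulr_ge0 ?expR_ge0// prodr_ge0.
  case: (N_nat i0 w) => [Nw|[k0 Nw]].
    rewrite Nw mulry gtr0_sg// mul1e /exp_neg eqxx mul0r eseries0// => k _ _.
    by rewrite HB' Nw indicE memNset//= mul0r mule0.
  rewrite (@nneseries_single _ _ k0)//.
    rewrite HB' Nw indicE mem_set//= mul1r -!EFinM /exp_neg/= min_r//.
    by rewrite -[leRHS]expR0 ler_expR oppr_le0 mulr_ge0// ltW.
  move=> k kk0; rewrite HB' Nw indicE memNset/= ?mul0r ?mule0//.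
  by move=> [] /eqP; rewrite eqr_nat eq_sym (negbTE kk0).
rewrite integral_nneseries//; last 2 first.
- move=> k; apply: emeasurable_funM => //; apply/measurable_EFinP.
  by apply: measurable_prod => i _; exact: mhybrid.
- by move=> k w _; rewrite -EFinM lee_fin mulr_ge0 ?expR_ge0// prodr_ge0.
rewrite (bigD1 i0)//= -/C {1}/hybrid_int ltnSn.
rewrite -(poisson_laplace_series (c i0) (m_ge0 i0) C0).
apply: eq_eseriesr => k _.
have mH : measurable_fun setT (fun w => (\prod_(i < j) hybrid r (B' k) i w)%:E).
  by apply/measurable_EFinP; apply: measurable_prod => i _; exact: mhybrid.
rewrite ge0_integralZl//; last first.
  by move=> w _; rewrite lee_fin prodr_ge0.
by rewrite IH ?(ltnW rj)// CB' -[N i0 @^-1` _]/[set w | N i0 w = k%:R%:E] N_poisson.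
Qed.

Lemma integral_prod_poisson :
  (\int[P]_w (\prod_(i < j) exp_neg ((c i)%:E * N i w))%:E =
   (\prod_(i < j) expR (- (m i * (1 - expR (- c i)))))%:E)%E.
Proof.
have := @integral_hybrid j (fun=> set0) (leqnn j) (fun=> measurable0).
under eq_integral do under eq_bigr do rewrite /hybrid ltn_ord.
by under [X in _ = X%:E -> _]eq_bigr do rewrite /hybrid_int ltn_ord.
Qed.

End independent_poisson.

Lemma esum_cst (R : realType) (T : choiceType) (A : set T) (r : R) : 0 < r ->
  (\esum_(s in A) r%:E = r%:E * counting A)%E.
Proof.
move=> r0; rewrite /counting; case: asboolP => [finA|infA].
  rewrite esum_fset//; last by move=> i _; rewrite lee_fin ltW.
  rewrite fsbig_finite//= sumEFin big_const_seq count_predT -Monoid.iteropE.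
  by rewrite -[iterop _ _ _ _]/(r *+ _) -EFinM mulr_natr.
rewrite gt0_muley ?lte_fin//; apply/eqyP => M M0.
have [k kM] : exists k : nat, M <= r * k%:R.
  exists (Num.truncn (M / r)).+1; rewrite mulrC -ler_pdivrMr//.
  by rewrite ltW// truncnS_gt.
have [F FA Fk] := infinite_set_fset k infA.
apply: esum_ge; exists [set` F]; first by split => //; exact: finite_fset.
rewrite fsbig_finite//= set_fsetK sumEFin.
rewrite big_const_seq count_predT -Monoid.iteropE -[iterop _ _ _ _]/(r *+ _).
by rewrite lee_fin (le_trans kM)// -[leRHS]mulr_natr ler_pM2l// ler_nat.
Qed.

Lemma counting_nat (R : realType) (T : choiceType) (A : set T) :
  counting A = +oo%E :> \bar R \/ exists k : nat, counting A = k%:R%:E :> \bar R.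
Proof.
by rewrite /counting; case: asboolP => ?; [right; eexists|left].
Qed.

(** Monotone convergence for sums over an index set that may be uncountable, such as the times in
    [[0, t]]: it suffices to pass to the limit on each finite subset. *)
Lemma esum_cvg (R : realType) (T : choiceType) (A : set T)
    (u : nat -> T -> \bar R) (f : T -> \bar R) :
  (forall n s, A s -> 0 <= u n s)%E ->
  (forall s, A s -> nondecreasing_seq (u ^~ s)) ->
  (forall s, A s -> (u ^~ s) @ \oo --> f s) ->
  (fun n => \esum_(s in A) u n s)%E @ \oo --> (\esum_(s in A) f s)%E.
Proof.
move=> u0 und uf.
have f_ge n s : A s -> (u n s <= f s)%E.
  move=> As.
  have -> : f s = ereal_sup (range (u ^~ s)).
    by apply: (cvg_unique _ (uf s As)) => //; exact/ereal_nondecreasing_cvgn/und.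
  by apply: ereal_sup_ubound; exists n.
have nd : nondecreasing_seq (fun n => \esum_(s in A) u n s)%E.
  by move=> m n mn; apply: le_esum => s As; exact: und.
suff -> : (\esum_(s in A) f s = ereal_sup (range (fun n => \esum_(s in A) u n s)))%E.
  exact: ereal_nondecreasing_cvgn.
apply/eqP; rewrite eq_le; apply/andP; split; last first.
  by apply: ge_ereal_sup => _ [n _ <-]; apply: le_esum => s As; exact: f_ge.
apply: ge_ereal_sup => _ [F [finF FA] <-].
rewrite fsbig_finite//=.
have cF : (fun n => \sum_(s <- fset_set F) u n s)%E @ \oo --> (\sum_(s <- fset_set F) f s)%E.
  rewrite big_seq; under eq_fun do rewrite big_seq.
  apply: cvg_nnesum => s; rewrite in_fset_set// inE => Fs.
    by apply: nearW => n; exact/u0/FA.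
  exact/uf/FA.
apply: (cvge_le _ cF); apply: nearW => n.
apply: (@le_trans _ _ (\esum_(s in A) u n s)%E); last first.
  by apply: ereal_sup_ubound; exists n.
apply: esum_ge; exists F => //; rewrite fsbig_finite//=.
Qed.

Section simple_levels.
Context (R : realType) d (T : measurableType d).
Variable phi : {nnsfun T >-> R}.

(** The level 0 contributes nothing to the sums, while its preimage may have infinite measure and so
    no Poisson count. *)
Definition positive_levels : seq R := [seq r <- fset_set (range phi) | 0 < r].
Definition level (i : 'I_(size positive_levels)) : R := nth 0 positive_levels i.
Definition level_set (i : 'I_(size positive_levels)) : set T := phi @^-1` [set level i].

Lemma level_gt0 i : 0 < level i.
Proof.
have : level i \in positive_levels by rewrite mem_nth.
by rewrite mem_filter => /andP[].
Qed.

Lemma measurable_level_set i : measurable (level_set i).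
Proof. exact: measurable_sfunP. Qed.

Lemma trivIset_level_set : trivIset setT level_set.
Proof.
apply/trivIsetP => i k _ _ ik; apply/seteqP; split=> // x [].
rewrite /level_set/= => -> /eqP; rewrite nth_uniq//; last by rewrite filter_uniq// fset_uniq.
by move=> h; move: ik; rewrite -(inj_eq val_inj) h.
Qed.

Lemma sum_levels (g : R -> \bar R) x : g 0 = 0%E ->
  g (phi x) = (\sum_i g (level i) * (\1_(level_set i) x)%:E)%E.
Proof.
move=> g0.
have [x0|x0] := eqVneq (phi x) 0.
  rewrite x0 g0 big1// => i _; rewrite indicE memNset ?mule0// /level_set/= x0.
  by move=> h; have := level_gt0 i; rewrite -h ltxx.
have xl : phi x \in positive_levels.
  rewrite mem_filter lt0r x0 fun_ge0/= in_fset_set ?inE; last exact: fimfunP.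
  by exists x.
have xi : (index (phi x) positive_levels < size positive_levels)%N by rewrite index_mem.
have lx : level (Ordinal xi) = phi x by rewrite /level nth_index.
rewrite (bigD1 (Ordinal xi))//= big1 => [|i ixi]; last first.
  rewrite indicE memNset ?mule0// => lix.
  have /trivIsetP/(_ i (Ordinal xi) Logic.I Logic.I ixi) := trivIset_level_set.
  move/seteqP => [/(_ x) + _]; apply; split=> //.
rewrite adde0 lx indicE mem_set ?mule1//.
Qed.

Lemma integral_levels (mu : {measure set T -> \bar R}) (g : R -> R) :
  g 0 = 0 -> (forall r, 0 <= r -> 0 <= g r) ->
  (\int[mu]_x (g (phi x))%:E = \sum_i (g (level i))%:E * mu (level_set i))%E.
Proof.
move=> g0 gge0.
transitivity (\int[mu]_x \sum_i (g (level i))%:E * (\1_(level_set i) x)%:E)%E.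
  apply: eq_integral => x _.
  by rewrite -[LHS]/((EFin \o g) (phi x)) (@sum_levels (EFin \o g))//= g0.
have m1 i : measurable_fun setT (fun x => (\1_(level_set i) x)%:E : \bar R).
  by apply/measurable_EFinP; apply: measurable_indic; exact: measurable_level_set.
have gl i : 0 <= g (level i) by rewrite gge0// ltW// level_gt0.
rewrite ge0_integral_sum//; last 2 first.
- by move=> i; apply: emeasurable_funM.
- by move=> i x _; rewrite -EFinM lee_fin mulr_ge0// indicE.
apply: eq_bigr => i _; rewrite ge0_integralZl ?lee_fin//.
by rewrite integral_indic ?setIT//; exact: measurable_level_set.
Qed.

End simple_levels.

Section exp_neg_theory.
Context (R : realType).

Lemma exp_neg0 : exp_neg (0%E : \bar R) = 1.
Proof. by rewrite /exp_neg/= oppr0 expR0 minxx. Qed.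

Lemma exp_neg_fin (r : R) : 0 <= r -> exp_neg r%:E = expR (- r).
Proof.
move=> r0; rewrite /exp_neg/=; apply/min_idPr.
by rewrite -expR0 ler_expR oppr_le0.
Qed.

Lemma exp_neg_expeR (x : \bar R) : (0 <= x)%E -> (exp_neg x)%:E = expeR (- x).
Proof.
by case: x => [r| |]//= r0; rewrite exp_neg_fin.
Qed.

Lemma exp_neg_le0 (x : \bar R) : (x <= 0)%E -> exp_neg x = 1.
Proof.
case: x => [r| |]//= r0; last by rewrite /exp_neg/= oppr0 expR0 minxx.
by rewrite /exp_neg/=; apply/min_idPl; rewrite -expR0 ler_expR oppr_ge0.
Qed.

Lemma exp_negD (x y : \bar R) : (0 <= x)%E -> (0 <= y)%E ->
  exp_neg (x + y) = exp_neg x * exp_neg y.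
Proof.
case: x y => [r| |] [s| |]//= r0 s0; rewrite ?mul0r ?mulr0 ?mulr0//.
by rewrite -EFinD !exp_neg_fin ?addr_ge0// opprD expRD.
Qed.

Lemma exp_neg_sum (I : Type) (s : seq I) (F : I -> \bar R) :
  (forall i, 0 <= F i)%E ->
  exp_neg (\sum_(i <- s) F i)%E = \prod_(i <- s) exp_neg (F i).
Proof.
move=> F0; elim: s => [|i s IH]; first by rewrite !big_nil exp_neg0.
by rewrite !big_cons exp_negD ?IH// sume_ge0.
Qed.

Lemma exp_neg_nonincr (x y : \bar R) : (x <= y)%E -> exp_neg y <= exp_neg x.
Proof.
rewrite /exp_neg; case: x y => [r| |] [s| |]//=; rewrite ?lee_fin ?lexx// => rs; rewrite ?lexx//.
- by rewrite le_min !ge_min lexx/= ler_expR lerN2 rs orbT.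
- by rewrite oppr0 expR0 minxx ge_min lexx.
Qed.

Lemma exp_neg_cvg (u : (\bar R)^nat) (x : \bar R) :
  (forall n, 0 <= u n)%E -> u @ \oo --> x -> exp_neg (u n) @[n --> \oo] --> exp_neg x.
Proof.
move=> u0 ux.
have x0 : (0 <= x)%E by apply: (cvge_ge _ ux); exact: nearW.
case: x ux x0 => [r| |]// ux x0.
  have /fine_cvgP[uf ur] := ux.
  rewrite exp_neg_fin -?lee_fin//.
  apply: (@cvg_trans _ (expR (- fine (u n)) @[n --> \oo])); last first.
    by apply: continuous_cvg; [exact: continuous_expR|exact: cvgN].
  apply: near_eq_cvg; near=> n.
  have un : u n \is a fin_num by near: n.
  by rewrite -{2}(fineK un) exp_neg_fin// fine_ge0.
rewrite {2}/exp_neg/=; apply/cvgr0Pnorm_lt => e e0.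
have /cvgeyPge/(_ (1 - ln e)) := ux.
apply: filterS => n un.
have /andP[h _] := exp_neg01 (u n).
rewrite ger0_norm// (le_lt_trans (exp_neg_nonincr un))//.
rewrite /exp_neg/= (le_lt_trans (y := expR (- (1 - ln e))))//; first by rewrite ge_min lexx orbT.
by rewrite -[ltRHS](@lnK R)// ltr_expR; lra.
Unshelve. all: by end_near. Qed.
End exp_neg_theory.

Lemma cvg_integral_nondecreasing (R : realType) d (T : measurableType d)
    (mu : {measure set T -> \bar R}) (D : set T) (g : nat -> T -> \bar R) (f : T -> \bar R) :
  measurable D -> (forall m, measurable_fun D (g m)) ->
  (forall m x, D x -> 0 <= g m x)%E ->
  (forall x, D x -> nondecreasing_seq (g ^~ x)) ->
  (forall x, D x -> g ^~ x @ \oo --> f x) ->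
  (\int[mu]_(x in D) g m x)%E @[m --> \oo] --> (\int[mu]_(x in D) f x)%E.
Proof.
move=> mD mg g0 ndg gf.
rewrite (_ : integral mu D f = (\int[mu]_(x in D) limn (g ^~ x))%E).
  exact: cvg_monotone_convergence.
by apply: eq_integral => x; rewrite inE => Dx; apply/esym/cvg_lim => //; exact: gf.
Qed.

Section campbell.
Context (R : realType) d d' (Omega : measurableType d) (S : measurableType d').
Variables (P : probability Omega R) (D : set S).
Variables (n : {sigma_finite_measure set S -> \bar R}) (e : R -> Omega -> option S).
Hypothesis ppp : poisson_point_process P D n e.
Variables (t l : R).
Hypotheses (t_ge0 : 0 <= t) (l_gt0 : 0 < l).

Let sum_simple (phi : {nnsfun S >-> R}) w :
  (\esum_(s in [set s | 0 <= s <= t]%R) oapp (EFin \o phi) 0 (e s w) =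
   \sum_i (level i)%:E * point_count e (`[0%R, t] `*` @level_set _ _ _ phi i) w)%E.
Proof.
pose c (i : 'I_(size (positive_levels phi))) s : \bar R :=
  if s \in [set s | exists2 x, e s w = Some x & level_set i x] then (level i)%:E else 0%E.
have cE s : oapp (EFin \o phi) 0%E (e s w) = (\sum_i c i s)%E.
  rewrite /c; case esw: (e s w) => [x|]/=; last first.
    by rewrite big1// => i _; rewrite memNset//= => -[x]; rewrite esw.
  rewrite -[LHS]/(EFin (phi x)) (@sum_levels _ _ _ phi EFin)//.
  apply: eq_bigr => i _; rewrite indicE; case: ifPn.
    by rewrite inE/= esw => -[_ [<-] xi]; rewrite mem_set ?mule1.
  move/negP; rewrite inE/= esw => h; rewrite memNset ?mule0// => xi; apply: h.
  by exists x.
under eq_esum do rewrite cE.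
rewrite esum_sum; last first.
  move=> s i _ _; rewrite /c; case: ifP => // _; rewrite lee_fin ltW//; exact: level_gt0.
apply: eq_bigr => i _; rewrite /c -esum_mkcondr esum_cst; last exact: level_gt0.
congr (_ * _)%E; rewrite /point_count; congr counting.
apply/seteqP; split => s/=.
  by move=> [st [x ex xi]]; exists x => //; split => //=; rewrite in_itv.
by move=> [x ex [/=]]; rewrite in_itv/= => st xi; split=> //; exists x.
Qed.

(** The products of [[0, t]] with the level sets are disjoint, so their counts are independent and
    Poisson with means [t * n (level_set i)], and the sum of the marks is the combination of these
    counts weighted by the levels. *)
Let campbell_simple (phi : {nnsfun S >-> R}) :
  (forall i, n (@level_set _ _ _ phi i) < +oo)%E ->
  (\int[P]_w (exp_neg (l%:E * \esum_(s in [set s | 0 <= s <= t]%R) oapp (EFin \o phi) 0 (e s w)))%:E =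
   (exp_neg (t%:E * \int[n]_x (1 - exp_neg (l%:E * (phi x)%:E))%:E))%:E)%E.
Proof.
move=> nfin; case: ppp => _ mcount pois indep.
pose A (i : 'I_(size (positive_levels phi))) : set (R * S) := `[0%R, t] `*` level_set i.
have regA i : measurable (A i) /\ A i `<=` `[0%R, +oo[ `*` setT.
  split; first by apply: measurableX; [exact: measurable_itv|exact: measurable_level_set].
  by move=> [s x] [/= + _]; rewrite in_itv/= => /andP[s0 _]; split => //=; rewrite in_itv/= s0.
have nA i : (lebesgue_measure \x n)%E (A i) = (t * fine (n (level_set i)))%:E.
  rewrite product_measure1E//; last exact: measurable_level_set.
  rewrite EFinM fineK ?ge0_fin_numE//; congr (_ * _)%E.
  rewrite [LHS]lebesgue_measure_itv/= lte_fin sube0; by case: ltgtP t_ge0 => // <-.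
have trA : trivIset setT A.
  apply/trivIsetP => i k _ _ ik; apply/seteqP; split=> // -[s x] [[/= _ xi] [/= _ xk]].
  have /trivIsetP/(_ i k Logic.I Logic.I ik) := @trivIset_level_set _ _ _ phi.
  by move/seteqP => [/(_ x) + _]; apply.
have := @integral_prod_poisson R _ _ P _ (fun i => point_count e (A i))
  (fun i => t * fine (n (level_set i))) (fun i => l * level i).
have pA i (k : nat) : P [set w | point_count e (A i) w = k%:R%:E] =
    ((t * fine (n (level_set i))) ^+ k / k`!%:R * expR (- (t * fine (n (level_set i)))))%:E.
  by have := pois (A i) (regA i); rewrite nA => /(_ (ltry _) k).
move=> /(_ (fun i => mcount _ (regA i)) (fun i w => counting_nat _ _)).
have m0 i : 0 <= t * fine (n (@level_set _ _ _ phi i)) by rewrite mulr_ge0 ?fine_ge0.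
have c0 i : 0 < l * @level _ _ _ phi i by rewrite mulr_gt0 ?level_gt0.
move=> /(_ m0 c0 pA).
move=> /(_ (fun B mB => indep _ A B regA trA mB)).
under eq_integral => w _.
  rewrite -exp_neg_sum; last first.
    move=> i; apply: mule_ge0; first by rewrite lee_fin ltW.
    by rewrite /point_count.
  under eq_bigr do rewrite EFinM -muleA.
  rewrite -ge0_sume_distrr; last first.
    move=> i _; apply: mule_ge0; first by rewrite lee_fin ltW// level_gt0.
    by rewrite /point_count.
  rewrite -sum_simple.
  over.
move=> ->; congr EFin.
have e1 r : 0 <= r -> 0 <= 1 - exp_neg (l * r)%:E.
  by move=> _; rewrite subr_ge0; case/andP: (exp_neg01 (l * r)%:E).
under eq_integral do rewrite -EFinM.
rewrite (@integral_levels _ _ _ phi n (fun r => 1 - exp_neg (l * r)%:E))//; last first.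
  by rewrite mulr0 exp_neg0 subrr.
rewrite ge0_sume_distrr; last first.
  by move=> i _; apply: mule_ge0 => //; rewrite lee_fin e1// ltW// level_gt0.
rewrite exp_neg_sum; last first.
  move=> i; apply: mule_ge0 => //; apply: mule_ge0 => //.
  by rewrite lee_fin e1// ltW// level_gt0.
apply: eq_bigr => i _.
transitivity (exp_neg (t%:E * ((1 - exp_neg (l * @level _ _ _ phi i)%:E)%:E *
    (fine (n (level_set i)))%:E))); last first.
  by congr (exp_neg (_ * (_ * _))); rewrite fineK ?ge0_fin_numE.
rewrite -!EFinM exp_neg_fin/=.
  by congr expR; rewrite exp_neg_fin ?(ltW (c0 i))//; ring.
by rewrite mulr_ge0// mulr_ge0 ?fine_ge0// e1// ltW// level_gt0.
Qed.

Variable f : S -> \bar R.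
Hypothesis mf : measurable_fun setT f.
Hypothesis f0 : forall x, (0 <= f x)%E.

Let phi := nnsfun_approx measurableT mf.

Let phi_f x : (fun m => (phi m x)%:E) @ \oo --> f x.
Proof. by apply: cvg_nnsfun_approx => //. Qed.

Let phi_nd x : nondecreasing_seq (fun m => (phi m x)%:E).
Proof.
by move=> a b ab; rewrite lee_fin; exact: (lef_at x (nd_nnsfun_approx measurableT mf)).
Qed.

Let F m w := (\esum_(s in [set s | 0 <= s <= t]%R) oapp (EFin \o phi m) 0 (e s w))%E.
Let Foo w := (\esum_(s in [set s | 0 <= s <= t]%R) oapp f 0 (e s w))%E.

Let F_ge0 m w : (0 <= F m w)%E.
Proof. by apply: esum_ge0 => s _; case: (e s w) => //= x; rewrite lee_fin. Qed.

Let F_Foo w : F ^~ w @ \oo --> Foo w.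
Proof.
apply: esum_cvg => [m s _|s _|s _]; case: (e s w) => [x|]//=.
- by rewrite lee_fin.
- exact: cvg_cst.
Qed.

Let mF m : measurable_fun setT (F m).
Proof.
rewrite /F; under eq_fun do rewrite sum_simple.
apply: emeasurable_sum => i; apply: measurable_funeM.
case: ppp => _ mcount _ _; apply: mcount; split.
  by apply: measurableX; [exact: measurable_itv|exact: measurable_level_set].
by move=> [s x] [/= + _]; rewrite in_itv/= => /andP[s0 _]; split => //=; rewrite in_itv/= s0.
Qed.

(** Although the times form an uncountable set, the sum is a monotone limit of finite combinations
    of point counts, which are measurable. *)
Lemma measurable_mark_sum : measurable_fun setT
  (fun w => \esum_(s in [set s | 0 <= s <= t]%R) oapp f 0 (e s w))%E.
Proof. by apply: emeasurable_fun_cvg mF _ => w _; exact: F_Foo. Qed.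

(** Simple functions increase to [f]. The expectation converges by domination by 1, the exponent by
    monotone convergence, an infinite limit being harmless because [exp_neg] tends to 0 there. The
    hypothesis on [n] makes every positive level set finite, as it lies in some [r <= f]. *)
Lemma campbell : (forall r : R, (0 < r)%R -> n [set x | r%:E <= f x] < +oo)%E ->
  (\int[P]_w (exp_neg (l%:E * \esum_(s in [set s | 0 <= s <= t]%R) oapp f 0 (e s w)))%:E =
   (exp_neg (t%:E * \int[n]_x (1 - exp_neg (l%:E * f x))%:E))%:E)%E.
Proof.
move=> nf.
have phi_le m x : ((phi m x)%:E <= f x)%E.
  rewrite (cvg_unique _ (@phi_f x) (ereal_nondecreasing_cvgn (@phi_nd x)))//.
  by apply: ereal_sup_ubound; exists m.
have nphi m i : (n (@level_set _ _ _ (phi m) i) < +oo)%E.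
  apply: le_lt_trans (nf _ (level_gt0 i)).
  apply: le_measure; rewrite ?inE; first exact: measurable_level_set.
    by rewrite -[X in measurable X]setTI; apply: measurable_lee => //; exact: measurable_cst.
  by move=> x /= <-; exact: phi_le.
have lF_cvg w : exp_neg (l%:E * F m w) @[m --> \oo] --> exp_neg (l%:E * Foo w).
  apply: exp_neg_cvg => [m|]; first by rewrite mule_ge0// lee_fin ltW.
  exact: cvgeZl.
have mlF m : measurable_fun setT (fun w => (exp_neg (l%:E * F m w))%:E).
  apply/measurable_EFinP; apply: (measurableT_comp (@measurable_exp_neg R)).
  exact: measurable_funeM.
have lF_cvgE w : (exp_neg (l%:E * F m w))%:E @[m --> \oo] --> (exp_neg (l%:E * Foo w))%:E.
  by apply: cvg_EFin; [exact: nearW|exact: lF_cvg].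
have [||||_ _ lhs] := @dominated_convergence _ _ _ P _ measurableT
    (fun m w => (exp_neg (l%:E * F m w))%:E) (fun w => (exp_neg (l%:E * Foo w))%:E) (cst 1%E) mlF.
- exact: (emeasurable_fun_cvg _ _ mlF (fun w _ => lF_cvgE w)).
- by apply: aeW => w _; exact: lF_cvgE.
- exact: (finite_measure_integrable_cst P 1%R).
- apply: aeW => w m _; have /andP[h0 h1] := exp_neg01 (l%:E * F m w).
  by rewrite abse_EFin ger0_norm// lee_fin.
have lim_int : (\int[n]_x (1 - exp_neg (l%:E * (phi m x)%:E))%:E @[m --> \oo] -->
    \int[n]_x (1 - exp_neg (l%:E * f x))%:E)%E.
  have phi_cvg x : (1 - exp_neg (l%:E * (phi m x)%:E))%:E @[m --> \oo] -->
      (1 - exp_neg (l%:E * f x))%:E.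
    apply: cvg_EFin; first exact: nearW.
    apply: cvgB; first exact: cvg_cst.
    apply: exp_neg_cvg => [m|]; first by rewrite mule_ge0 ?lee_fin ?fun_ge0 ?(ltW l_gt0).
    exact: cvgeZl.
  apply: cvg_integral_nondecreasing => //.
  - move=> m; apply/measurable_EFinP; apply: measurable_funB => //.
    apply: (measurableT_comp (@measurable_exp_neg R)); apply: measurable_funeM.
    exact/measurable_EFinP.
  - by move=> m x _; rewrite lee_fin subr_ge0; case/andP: (exp_neg01 (l%:E * (phi m x)%:E)%E).
  - move=> x _ a b ab; rewrite lee_fin lerB// exp_neg_nonincr// lee_pmul2l ?lte_fin//.
    exact: phi_nd.
have int_ge0 (g : S -> \bar R) : (0 <= \int[n]_x (1 - exp_neg (g x))%:E)%E.
  by apply: integral_ge0 => x _; rewrite lee_fin subr_ge0; case/andP: (exp_neg01 (g x)).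
apply: (cvg_unique _ lhs) => //.
rewrite (_ : [sequence _]_n = fun m =>
    (exp_neg (t%:E * \int[n]_x (1 - exp_neg (l%:E * (phi m x)%:E))%:E)%E)%:E); last first.
  by apply/funext => m; exact: campbell_simple.
apply: cvg_EFin; first exact: nearW.
apply: exp_neg_cvg => [m|]; first by rewrite mule_ge0.
exact: cvgeZl.
Qed.

End campbell.

(** * The mixed Levy measure *)

Lemma integral_mixture (R : realType) d d' (X : measurableType d) (Y : measurableType d')
    (mu : {measure set X -> \bar R}) (W : set X) (k : X -> {measure set Y -> \bar R})
    (n : {measure set Y -> \bar R}) (f : Y -> \bar R) :
  measurable W ->
  (forall U, measurable U -> measurable_fun setT (k ^~ U)) ->
  (forall U, measurable U -> n U = \int[mu]_(x in W) k x U)%E ->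
  measurable_fun setT f -> (forall y, 0 <= f y)%E ->
  (\int[n]_y f y = \int[mu]_(x in W) \int[k x]_y f y)%E.
Proof.
move=> mW mk nE mf f0.
pose phi := nnsfun_approx measurableT mf.
have phi_f y : (fun m => (phi m y)%:E) @ \oo --> f y.
  by apply: cvg_nnsfun_approx => //.
have phi_nd y : nondecreasing_seq (fun m => (phi m y)%:E).
  by move=> a b ab; rewrite lee_fin; exact: (lef_at y (nd_nnsfun_approx measurableT mf)).
have mphi m : measurable_fun setT (fun y => (phi m y)%:E).
  exact/measurable_EFinP.
have phi0 m y : (0 <= (phi m y)%:E)%E by rewrite lee_fin.
have int_cvg (nu : {measure set Y -> \bar R}) :
    (\int[nu]_y (phi m y)%:E)%E @[m --> \oo] --> (\int[nu]_y f y)%E.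
  by apply: cvg_integral_nondecreasing => // y _; exact: phi_f.
have mixS m : (\int[n]_y (phi m y)%:E = \int[mu]_(x in W) \int[k x]_y (phi m y)%:E)%E.
  rewrite (@integral_levels _ _ _ (phi m) n id)//.
  under [RHS]eq_integral do rewrite (@integral_levels _ _ _ (phi m) _ id)//.
  have mkl i : measurable_fun W (fun x => k x (@level_set _ _ _ (phi m) i)).
    by apply: measurable_funTS; apply: mk; exact: measurable_level_set.
  have l0 i : (0 <= (@level _ _ _ (phi m) i)%:E)%E by rewrite lee_fin ltW// level_gt0.
  rewrite ge0_integral_sum//; last 2 first.
  - by move=> i; apply: measurable_funeM.
  - by move=> i x _; apply: mule_ge0.
  apply: eq_bigr => i _; rewrite ge0_integralZl//.
  by congr (_ * _)%E; apply: nE; exact: measurable_level_set.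
apply: (cvg_unique _ (int_cvg n)) => //.
rewrite (_ : (fun m => _) = fun m => (\int[mu]_(x in W) \int[k x]_y (phi m y)%:E)%E).
  2: by apply/funext => m; exact: mixS.
apply: cvg_integral_nondecreasing => //.
- move=> m; apply: measurable_funTS.
  exact: measurable_fun_integral_kernel.
- by move=> m x _; exact: integral_ge0.
- move=> x _ a b ab; apply: ge0_le_integral => //= y _; exact: phi_nd.
Qed.

(** The middle term is at most both [l x] and 1. Finiteness of [levy_mass] thereby controls the
    exponent at every [l]. *)
Lemma bernstein_le_min (R : realType) (l x : R) : 0 < l -> 0 <= x ->
  0 <= 1 - expR (- (l * x)) <= Num.max 1 l * Num.min x 1.
Proof.
move=> l0 x0.
have lx0 : 0 <= l * x by rewrite mulr_ge0// ltW.
have e1 : expR (- (l * x)) <= 1 by rewrite -[leRHS]expR0 ler_expR oppr_le0.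
rewrite subr_ge0 e1/=.
have h1 : 1 - expR (- (l * x)) <= l * x by have := expR_ge1Dx (- (l * x)); lra.
have h2 : 1 - expR (- (l * x)) <= 1 by rewrite gerBl expR_ge0.
have [x1|x1] := leP x 1.
  by rewrite (le_trans h1)// ler_wpM2r// le_max lexx orbT.
by rewrite mulr1 (le_trans h2)// le_max lexx.
Qed.

Section levy_kernel.
Context (R : realType) d (E : measurableType d) (a : E -> R) (nu : R.-sigmafker E ~> R).
Hypothesis a_ge0 : forall y, 0 <= a y.
Hypothesis ma : measurable_fun setT a.

(* Killing at rate [a y] is a mass [a y] at +oo. *)
Definition levy_kernel (y : E) : {measure set (\bar R) -> \bar R}.
Proof.
refine (measure_add (pushforward (nu y) (@EFin R)) (mscale (NngNum (a_ge0 y)) (dirac +oo%E))).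
exact: EFin_measurable.
Defined.

Lemma levy_kernelE y B :
  levy_kernel y B = (nu y (EFin @^-1` B) + (a y)%:E * \d_(+oo%E) B)%E.
Proof. exact: measure_addE. Qed.

Lemma measurable_levy_kernel B : measurable B -> measurable_fun setT (levy_kernel ^~ B).
Proof.
move=> mB; under eq_fun do rewrite levy_kernelE.
apply: emeasurable_funD.
  apply: measurable_kernel; rewrite -[X in measurable X]setTI.
  exact: EFin_measurable.
by apply: emeasurable_funM => //; exact/measurable_EFinP.
Qed.

Lemma integral_levy_kernel y (g : \bar R -> \bar R) : measurable_fun setT g ->
  (forall x, 0 <= g x)%E -> (forall x, x <= 0 -> g x = 0)%E ->
  (\int[levy_kernel y]_x g x =
   \int[nu y]_(s in `]0%R, +oo[) g s%:E + (a y)%:E * g +oo)%E.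
Proof.
move=> mg g0 gn.
rewrite ge0_integral_measure_add// ge0_integral_mscale// integral_dirac// diracT mul1e.
congr (_ + _)%E.
rewrite ge0_integral_pushforward//.
rewrite preimage_setT.
rewrite [RHS]integral_mkcond.
apply: eq_integral => s _; rewrite patchE; case: ifPn => // sP.
rewrite /= gn// lee_fin leNgt; apply/negP => s0; move/negP: sP; apply.
by rewrite inE/= in_itv/= s0.
Qed.

(** Killing becomes an ordinary jump to [+oo], where [1 - exp_neg] equals 1 and so reproduces the
    constant term [a y]. *)
Lemma bernstein_fun_levy y b l : 0 < l ->
  bernstein_fun (a y) b (nu y) l =
  ((b * l)%:E + \int[levy_kernel y]_x (1 - exp_neg (l%:E * x))%:E)%E.
Proof.
move=> l0; rewrite integral_levy_kernel.
- rewrite /bernstein_fun mulry gtr0_sg// mul1e.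
  have -> : exp_neg (+oo%E : \bar R) = 0 by [].
  rewrite subr0 mule1 -EFinM -addeA addeC -addeA; congr (_ + (_ + _))%E.
  apply: eq_integral => s; rewrite inE/= in_itv/= andbT => s0.
  by rewrite -EFinM exp_neg_fin// mulr_ge0 ?ltW.
- apply/measurable_EFinP; apply: measurable_funB => //.
  by apply: (measurableT_comp (@measurable_exp_neg R)); apply: measurable_funeM.
- by move=> x; rewrite lee_fin subr_ge0; case/andP: (exp_neg01 (l%:E * x)).
- move=> x x0; rewrite exp_neg_le0 ?subrr// mule_ge0_le0// lee_fin ltW//.
Qed.

End levy_kernel.

Lemma bounded_integral_lty (R : realType) d (T : measurableType d)
    (mu : {finite_measure set T -> \bar R}) (D : set T) (g : T -> \bar R) (M : R) :
  measurable D -> measurable_fun D g -> (forall x, 0 <= g x <= M%:E)%E ->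
  (\int[mu]_(x in D) g x < +oo)%E.
Proof.
move=> mD mg gM; apply: (@le_lt_trans _ _ (\int[mu]_(x in D) M%:E)%E).
  by apply: ge0_le_integral => // x _; case/andP: (gM x).
by rewrite integral_cst// ltey_eq fin_numM//; exact: fin_num_measure.
Qed.

Lemma levy_mass_ge0 (R : realType) (mu : {measure set R -> \bar R}) : (0 <= levy_mass mu)%E.
Proof.
apply: integral_ge0 => s; rewrite /= in_itv/= andbT => s0.
by rewrite lee_fin le_min (ltW s0) ler01.
Qed.

Lemma measurable_levy_mass (R : realType) d (E : measurableType d) (nu : R.-sigmafker E ~> R) :
  measurable_fun setT (fun y => levy_mass (nu y)).
Proof.
rewrite /levy_mass; under eq_fun do rewrite integral_mkcond.
apply: measurable_fun_integral_kernel.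
- by move=> U mU; exact: measurable_kernel.
- move=> s; rewrite patchE; case: ifPn => //; rewrite inE/= in_itv/= andbT => s0.
  by rewrite lee_fin le_min (ltW s0) ler01.
- apply/(measurable_restrictT _ _).1 => //.
  by apply/measurable_EFinP; apply: measurable_minr.
Qed.

(** * The averaged exponent and the Laplace transform of the Poisson construction *)

Section mixed_exponent.
Context (R : realType) dE (E : measurableType dE) (p : probability E R) (W : set E).
Variables (a b : E -> R) (nu : R.-sigmafker E ~> R).
Hypothesis mW : measurable W.
Hypothesis a_ge0 : forall y, 0 <= a y.
Hypothesis b_ge0 : forall y, 0 <= b y.
Hypothesis ma : measurable_fun setT a.
Hypothesis mb : measurable_fun setT b.
Hypothesis V_fin : forall y, (levy_mass (nu y) < +oo)%E.
Hypothesis int_a : (\int[p]_(y in W) (a y)%:E < +oo)%E.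
Hypothesis int_b : (\int[p]_(y in W) (b y)%:E < +oo)%E.
Hypothesis int_V : (\int[p]_(y in W) levy_mass (nu y) < +oo)%E.

Let jump l y : \bar R := (\int[levy_kernel nu a_ge0 y]_x (1 - exp_neg (l%:E * x))%:E)%E.
Let expo l y : \bar R := bernstein_fun (a y) (b y) (nu y) l.

Let measurable_one_sub l : measurable_fun setT (fun x : \bar R => (1 - exp_neg (l%:E * x))%:E).
Proof.
apply/measurable_EFinP; apply: measurable_funB => //.
by apply: (measurableT_comp (@measurable_exp_neg R)); apply: measurable_funeM.
Qed.

Let one_sub_ge0 (x : \bar R) : (0 <= (1 - exp_neg x)%:E)%E.
Proof. by rewrite lee_fin subr_ge0; case/andP: (exp_neg01 x). Qed.

Let measurable_jump l : measurable_fun setT (jump l).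
Proof.
by apply: measurable_fun_integral_kernel => // U mU; exact: measurable_levy_kernel.
Qed.

Let jump_le l y : 0 < l -> (jump l y <= (Num.max 1 l)%:E * levy_mass (nu y) + (a y)%:E)%E.
Proof.
move=> l0; rewrite /jump integral_levy_kernel//; last first.
  move=> x x0; rewrite exp_neg_le0 ?subrr// mule_ge0_le0// lee_fin ltW//.
rewrite mulry gtr0_sg// mul1e leeD//; last first.
  have -> : exp_neg (+oo%E : \bar R) = 0 by [].
  by rewrite subr0 mule1.
have m1 : 0 <= Num.max 1 l by rewrite le_max ler01.
have s0 (s : R) : `]0, +oo[%classic s -> 0 <= s.
  by rewrite /= in_itv/= andbT => /ltW.
have mm : measurable_fun (`]0%R, +oo[%classic : set R) (fun s : R => (Num.min s 1)%:E).
  by apply/measurable_EFinP; apply: measurable_minr.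
rewrite -ge0_integralZl//; last first.
  by move=> s /s0 s0'; rewrite lee_fin le_min s0' ler01.
apply: ge0_le_integral => //.
- apply/measurable_EFinP; apply: measurable_funB => //.
  apply: (measurableT_comp (@measurable_exp_neg R)); apply: measurable_funeM.
  exact: EFin_measurable.
- exact: measurable_funeM.
- move=> s /s0 s0'; rewrite -EFinM exp_neg_fin ?mulr_ge0 ?(ltW l0)// lee_fin.
  by have /andP[] := bernstein_le_min l0 s0'.
Qed.

Let expoE l y : 0 < l -> expo l y = ((b y * l)%:E + jump l y)%E.
Proof. by move=> l0; rewrite /expo bernstein_fun_levy. Qed.

Let jump_ge0 l y : (0 <= jump l y)%E.
Proof. exact: integral_ge0. Qed.

Let integral_jump_lty l : 0 < l -> (\int[p]_(y in W) jump l y < +oo)%E.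
Proof.
move=> l0; have V0 y : (0 <= levy_mass (nu y))%E by exact: levy_mass_ge0.
have mlev := measurable_levy_mass nu.
have m1 : 0 <= Num.max 1 l by rewrite le_max ler01.
have ma' : measurable_fun W (fun y => (a y)%:E).
  by apply: measurable_funTS; exact/measurable_EFinP.
have mV : measurable_fun W (fun y => (Num.max 1 l)%:E * levy_mass (nu y))%E.
  by apply: measurable_funeM; exact: measurable_funTS.
apply: (@le_lt_trans _ _
    (\int[p]_(y in W) ((Num.max 1 l)%:E * levy_mass (nu y) + (a y)%:E))%E).
  apply: ge0_le_integral => //.
  - exact: measurable_funTS.
  - exact: emeasurable_funD.
  - by move=> y _; exact: jump_le.
rewrite ge0_integralD//; last 2 first.
- by move=> y _; apply: mule_ge0.
- by move=> y _; rewrite lee_fin.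
rewrite ge0_integralZl//; last exact: measurable_funTS.
by rewrite lte_add_pinfty// lte_mul_pinfty.
Qed.

Let expo_fin l y : 0 < l -> expo l y \is a fin_num.
Proof.
move=> l0; rewrite expoE// fin_numD/= ge0_fin_numE//.
apply: le_lt_trans (jump_le y l0) _.
by rewrite lte_add_pinfty ?ltry// lte_mul_pinfty// lee_fin le_max ler01.
Qed.

Let integral_expo l : 0 < l ->
  (\int[p]_(y in W) expo l y =
   l%:E * \int[p]_(y in W) (b y)%:E + \int[p]_(y in W) jump l y)%E.
Proof.
move=> l0; under eq_integral do rewrite expoE//.
rewrite ge0_integralD//; last 3 first.
- by move=> y _; rewrite lee_fin mulr_ge0// ltW.
- by apply: measurable_funTS; apply/measurable_EFinP; exact: measurable_funM.
- exact: measurable_funTS.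
congr (_ + _)%E; under eq_integral do rewrite mulrC EFinM.
rewrite ge0_integralZl ?lee_fin ?(ltW l0)//.
  by apply: measurable_funTS; exact/measurable_EFinP.
by move=> y _; rewrite lee_fin.
Qed.

Let L t l y : R := - (t * fine (expo l y)).

Let integral_expo_fin l : 0 < l -> (\int[p]_(y in W) expo l y)%E \is a fin_num.
Proof.
move=> l0; rewrite integral_expo// ge0_fin_numE.
  by rewrite lte_add_pinfty ?integral_jump_lty// lte_mul_pinfty// lee_fin ltW.
rewrite adde_ge0//; last exact: integral_ge0.
by apply: mule_ge0; rewrite ?lee_fin ?(ltW l0)//; apply: integral_ge0 => y _; rewrite lee_fin.
Qed.

Let expo_ge0 l y : 0 < l -> (0 <= expo l y)%E.
Proof. by move=> l0; rewrite expoE// adde_ge0// lee_fin mulr_ge0// ltW. Qed.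

Let integrable_expo l : 0 < l -> p.-integrable W (expo l).
Proof.
move=> l0; apply/integrableP; split.
  apply: measurable_funTS.
  rewrite (_ : expo l = fun y => (b y * l)%:E + jump l y)%E; last first.
    by apply/funext => y; rewrite expoE.
  apply: emeasurable_funD => //; apply/measurable_EFinP; exact: measurable_funM.
under eq_integral do rewrite gee0_abs ?expo_ge0//.
by rewrite -ge0_fin_numE ?integral_expo_fin// integral_ge0// => y _; exact: expo_ge0.
Qed.

Let LE t l y : 0 < l -> (L t l y)%:E = (- t%:E * expo l y)%E.
Proof. by move=> l0; rewrite /L -mulNr EFinM EFinN fineK ?expo_fin. Qed.

Let integrable_L t l : 0 < l -> p.-integrable W (EFin \o L t l).
Proof.
move=> l0; rewrite (_ : EFin \o _ = fun y => ((- t)%:E * expo l y)%E).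
  exact: integrableZl (integrable_expo l0).
by apply/funext => y; rewrite /= LE// EFinN.
Qed.

Let integral_L t l : 0 < l ->
  (\int[p]_(y in W) L t l y = - (t * fine (\int[p]_(y in W) expo l y)%E))%R.
Proof.
move=> l0; rewrite /Rintegral.
under eq_integral do rewrite LE// -EFinN.
rewrite integralZl//; last exact: integrable_expo.
by rewrite -mulNr fineM// integral_expo_fin.
Qed.

Variable n : {sigma_finite_measure set (\bar R) -> \bar R}.
Hypothesis nE : forall B, measurable B ->
  (n B = \int[p]_(y in W) levy_kernel nu a_ge0 y B)%E.

Let integral_n l : (\int[n]_x (1 - exp_neg (l%:E * x))%:E = \int[p]_(y in W) jump l y)%E.
Proof.
by apply: integral_mixture => // U mU; exact: measurable_levy_kernel.
Qed.

(** Markov's inequality: [1 - exp_neg x] is at least the positive constant [c] on this set, and its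
    integral against [n] is the averaged jump part of the exponent at [l = 1], which is finite. *)
Let tail_fin (r : R) : (0 < r)%R -> (n [set x | r%:E <= maxe x 0] < +oo)%E.
Proof.
move=> r0; have mA : measurable [set x : \bar R | (r%:E <= maxe x 0)%E].
  rewrite -[X in measurable X]setTI; apply: measurable_lee => //.
  exact: measurable_maxe.
pose c := 1 - exp_neg r%:E.
have c0 : 0 < c by rewrite subr_gt0 exp_neg_fin ?(ltW r0)// -expR0 ltr_expR oppr_lt0.
have : (c%:E * n [set x | r%:E <= maxe x 0] < +oo)%E.
  apply: le_lt_trans (integral_jump_lty ltr01); rewrite -integral_n.
  rewrite measure_indic// -ge0_integralZl//; last 2 first.
  - by apply/measurable_EFinP; exact: measurable_indic.
  - by rewrite lee_fin ltW.
  apply: ge0_le_integral => //.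
  - by move=> x _; rewrite -EFinM lee_fin indicE mulr_ge0// ltW.
  - by apply: measurable_funeM; apply/measurable_EFinP; exact: measurable_indic.
  move=> x _; rewrite -EFinM mul1e indicE; case: (boolP (x \in _)) => [|_].
    rewrite inE/= le_max => /orP[rx|]; last by rewrite lee_fin leNgt r0.
    by rewrite mulr1 lee_fin lerB// exp_neg_nonincr.
  by rewrite mulr0 one_sub_ge0.
rewrite !ltey; apply: contra_neq => ->.
by rewrite gt0_muley ?lte_fin.
Qed.

Variables (d' : measure_display) (Omega : measurableType d') (P : probability Omega R).
Variables (e : R -> Omega -> option (\bar R)) (t : R).
Hypothesis ppp : poisson_point_process P [set x | 0 < x]%E n e.
Hypothesis t_ge0 : 0 <= t.

Lemma laplace_mixed_poisson l : 0 < l ->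
  (\int[P]_w expeR (- (l%:E * (t%:E * \int[p]_(y in W) (b y)%:E +
     \esum_(s in [set s | (0 <= s <= t)%R]) odflt 0 (e s w)))) =
   (expR (\int[p]_(y in W) (- (t * fine (bernstein_fun (a y) (b y) (nu y) l)))%R))%:E)%E.
Proof.
move=> l0.
(* [campbell] wants a function non-negative on all of [\bar R], while positivity is known for marks
   only. The truncation changes neither the sum over points nor the integral, since [1 - exp_neg]
   vanishes at every [x <= 0]. *)
pose f (x : \bar R) := maxe x 0.
have mf : measurable_fun setT f by apply: measurable_maxe.
have f0 x : (0 <= f x)%E by rewrite le_max lexx orbT.
have intb0 : (0 <= \int[p]_(y in W) (b y)%:E)%E.
  by apply: integral_ge0 => y _; rewrite lee_fin.
have esumE w : (\esum_(s in [set s | (0 <= s <= t)%R]) odflt 0 (e s w) =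
    \esum_(s in [set s | (0 <= s <= t)%R]) oapp f 0 (e s w))%E.
  apply: eq_esum => s /andP[s0 _]; case esw: (e s w) => [x|]//=.
  case: ppp => + _ _ _ => /(_ s w x s0 esw)/= x0.
  by rewrite /f; apply/esym/max_idPl; exact: ltW.
have S0 w : (0 <= \esum_(s in [set s | (0 <= s <= t)%R]) oapp f 0 (e s w))%E.
  by apply: esum_ge0 => s _; case: (e s w) => //= x.
have J0 : (0 <= \int[n]_x (1 - exp_neg (l%:E * x))%:E)%E by exact: integral_ge0.
have := campbell ppp t_ge0 l0 mf f0 tail_fin.
have -> : (\int[n]_x (1 - exp_neg (l%:E * f x))%:E = \int[n]_x (1 - exp_neg (l%:E * x))%:E)%E.
  apply: eq_integral => x _; rewrite /f; case: (leP x 0%E) => // x0.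
  rewrite mule0 exp_neg0 exp_neg_le0//; apply: mule_ge0_le0 => //.
  by rewrite lee_fin ltW.
move=> campb.
transitivity (\int[P]_w ((exp_neg (l%:E * (t%:E * \int[p]_(y in W) (b y)%:E)))%:E *
    (exp_neg (l%:E * \esum_(s in [set s | (0 <= s <= t)%R]) oapp f 0 (e s w)))%:E))%E.
  apply: eq_integral => w _; rewrite esumE ge0_muleDr//; last by rewrite mule_ge0.
  rewrite -EFinM -exp_negD ?exp_neg_expeR//; last 3 first.
  - by rewrite adde_ge0// ?mule_ge0// lee_fin ltW.
  - by rewrite ?mule_ge0// lee_fin ltW.
  - by rewrite ?mule_ge0// lee_fin ltW.
have mS := measurable_mark_sum ppp t mf f0.
rewrite ge0_integralZl//; last 3 first.
- apply/measurable_EFinP; apply: (measurableT_comp (@measurable_exp_neg R)).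
  exact: measurable_funeM.
- by move=> w _; rewrite lee_fin; case/andP: (exp_neg01
    (l%:E * \esum_(s in [set s | (0 <= s <= t)%R]) oapp f 0 (e s w))%E).
- by rewrite lee_fin; case/andP: (exp_neg01 (l%:E * (t%:E * \int[p]_(y in W) (b y)%:E))%E).
rewrite campb integral_n -EFinM -exp_negD; last 2 first.
- by rewrite ?mule_ge0// lee_fin ltW.
- by rewrite mule_ge0// -integral_n.
have -> : (l%:E * (t%:E * \int[p]_(y in W) (b y)%:E) + t%:E * \int[p]_(y in W) jump l y =
    t%:E * \int[p]_(y in W) expo l y)%E.
  rewrite integral_expo// [RHS]ge0_muleDr.
  - by rewrite muleCA.
  - by rewrite mule_ge0// lee_fin ltW.
  - by rewrite -integral_n.
rewrite -[\int[p]_(y in W) - _]/(\int[p]_(y in W) L t l y) integral_L//.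
rewrite -[X in (t%:E * X)%E](fineK (integral_expo_fin l0)) -EFinM exp_neg_fin//.
by rewrite mulr_ge0// fine_ge0// integral_ge0// => y _; exact: expo_ge0.
Qed.

Lemma integrable_mixed_exponent l : 0 < l ->
  p.-integrable W (fun y => (- (t * fine (bernstein_fun (a y) (b y) (nu y) l)))%:E).
Proof. exact: integrable_L. Qed.

Lemma bernstein_fun_fin l y : 0 < l -> bernstein_fun (a y) (b y) (nu y) l \is a fin_num.
Proof. exact: expo_fin. Qed.

End mixed_exponent.

Theorem proposition2p4 (R : realType) (E : ptopologicalType)
  (polishE : polish R E)
  (W : set (borel E)) (mW : measurable W)
  (p : probability (borel E) R) (pW : p W = 1%E)
  (a b : E -> R) (nu : R.-sigmafker borel E ~> R)
  (a_ge0 : forall y, 0 <= a y) (b_ge0 : forall y, 0 <= b y)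
  (nu_pos : forall y, nu y `]-oo, 0]%classic = 0%E)
  (V_fin : forall y, (levy_mass (nu y) < +oo)%E)
  (ma : measurable_fun (setT : set (borel E)) a)
  (mb : measurable_fun (setT : set (borel E)) b)
  (A1 : (exists M : R, forall y, a y <= M /\ b y <= M) \/
        ((\int[p]_(y in W) (a y)%:E < +oo)%E /\
         (\int[p]_(y in W) (b y)%:E < +oo)%E))
  (A2 : (exists M : R, forall y, (levy_mass (nu y) <= M%:E)%E) \/
        (\int[p]_(y in W) levy_mass (nu y) < +oo)%E)
  (d : E -> measure_display) (Omega : forall y : E, measurableType (d y))
  (P : forall y : E, probability (Omega y) R)
  (sigma : forall y : E, R -> {RV (P y) >-> \bar R})
  (sub_sigma : forall y, subordinator (sigma y))
  (lap_sigma : forall y,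
      laplace_exponent (sigma y) (bernstein_fun (a y) (b y) (nu y)))
  (d' : measure_display) (Omega' : measurableType d')
  (P' : probability Omega' R) (sigmap : R -> {RV P' >-> \bar R})
  (dos_sigmap : distributed_order_subordinator W p a b nu sigmap)
  (t : R) (t_ge0 : 0 <= t)
  (ME_sigma : forall y, ME (real_law (sigma y t))) :
  ME (real_law (sigmap t)).
Proof.
(* Bounded functions are integrable against a probability, so both alternatives of each assumption
   reduce to finite integrals. *)
have [a_bd b_bd] : (\int[p]_(y in W) (a y)%:E < +oo)%E /\ (\int[p]_(y in W) (b y)%:E < +oo)%E.
  case: A1 => // -[M ab]; split; apply: (@bounded_integral_lty _ _ _ _ _ _ M) => //.
  - by apply: measurable_funTS; exact/measurable_EFinP.
  - by move=> y; rewrite !lee_fin a_ge0; case: (ab y).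
  - by apply: measurable_funTS; exact/measurable_EFinP.
  - by move=> y; rewrite !lee_fin b_ge0; case: (ab y).
have V_bd : (\int[p]_(y in W) levy_mass (nu y) < +oo)%E.
  case: A2 => // -[M Vb]; apply: (@bounded_integral_lty _ _ _ _ _ _ M) => //.
  - by apply: measurable_funTS; exact: measurable_levy_mass.
  - by move=> y; rewrite levy_mass_ge0 Vb.
case: dos_sigmap => n [e [nE ppp sigmapE]].
have nE' B : measurable B -> (n B = \int[p]_(y in W) levy_kernel nu a_ge0 y B)%E.
  by move=> mB; rewrite nE//; apply: eq_integral => y _; rewrite levy_kernelE.
(* Almost every path starts at 0 and is nondecreasing. *)
have sigma_ge0 y : {ae P y, forall w, (0 <= sigma y t w)%E}.
  case: (sub_sigma y) => s0 s1 _ _; apply: filterS2 s0 s1 => w <- mono.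
  by apply: mono; rewrite lexx t_ge0.
(* The logarithm of the Laplace transform of [sigma y t]; [fine] loses nothing because the exponent
   is finite at every [l > 0]. *)
pose L l y := - (t * fine (bernstein_fun (a y) (b y) (nu y) l)).
apply: (@mixing_ME _ _ _ p W mW L _ _ _ _ _ sigma_ge0 _ ME_sigma).
- by move=> l l0; apply: integrable_mixed_exponent.
- move=> y l l0; rewrite lap_sigma//.
  by rewrite /L -{1}(fineK (@bernstein_fun_fin _ _ (borel E) a b nu a_ge0 V_fin l y l0)).
- apply: aeW => w; rewrite sigmapE// adde_ge0//.
    by rewrite mule_ge0// integral_ge0// => y _; rewrite lee_fin.
  apply: esum_ge0 => s /andP[s0 _]; case esw: (e s w) => [x|]//=.
  by case: ppp => + _ _ _ => /(_ s w x s0 esw)/ltW.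
- move=> l l0; under eq_integral do rewrite sigmapE//.
  exact: (laplace_mixed_poisson mW b_ge0 ma mb V_fin a_bd b_bd V_bd nE' ppp t_ge0 l0).
Qed.
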